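(* For each $s>0$ there exists a constant $C=C(s)>0$, depending only on $s$, such that the following holds. Let $n\ge1$, let $\lambda=1^{n_1}2^{n_2}\cdots$ be a partition of $n$ (with $n_i$ parts of size $i$), let $\mathcal{C}_\lambda\subseteq S_n$ be the conjugacy class of permutations of cycle type $\lambda$, let $\pi$ be chosen uniformly at random from $\mathcal{C}_\lambda$, and let $\alpha_1=n_1/n$. Then \[ \mathbb{E}\!\left[e^{-s\,p(\pi)/\sqrt n}\right]=\exp\left\{-\frac{1-\alpha_1^3}{3}\,s\sqrt n+\left(\frac1{45}+\frac{\alpha_1^3}{18}-\frac{3\alpha_1^5}{10}+\frac{2\alpha_1^6}{9}\right)s^2+E_{\lambda,s}\right\} \] where $|E_{\lambda,s}|\le C n^{-1/4}$.
   Context: For $\pi\in S_n$ (viewed as the word $\pi(1)\cdots\pi(n)$), $\pi$ has a peak at position $i$, where $1<i<n$, if $\pi(i-1)<\pi(i)>\pi(i+1)$; $p(\pi)$ denotes the number of peaks of $\pi$. *)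

(* Defs.v *)
From HB Require Import structures.
From mathcomp Require Import all_boot all_order all_algebra all_fingroup.

Set Implicit Arguments. Unset Strict Implicit. Unset Printing Implicit Defensive.
Import Order.TTheory GRing.Theory Num.Theory.
Local Open Scope ring_scope.

(* Permutations of [n] are 'S_n = {perm 'I_n}, with positions 0..n-1
   (position i (1-based) of the paper is position i-1 here). *)

Definition pval n (pi : 'S_n) (j : nat) : nat :=
  if insub j is Some i then val (pi i) else 0%N.

Definition is_peak n (pi : 'S_n) (j : nat) : bool :=
  [&& (0 < j)%N, (j.+1 < n)%N, (pval pi j.-1 < pval pi j)%N
    & (pval pi j.+1 < pval pi j)%N].

Definition peaks n (pi : 'S_n) : nat := count (is_peak pi) (iota 0 n).

Definition is_partition (n : nat) (lam : seq nat) : bool :=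
  [&& sorted geq lam, all (fun x => 0 < x)%N lam & sumn lam == n].

Definition cycle_type n (pi : 'S_n) : seq nat :=
  sort geq (map (fun X : {set 'I_n} => #|X|) (enum (porbits pi))).

Definition conj_class n (lam : seq nat) : {set 'S_n} :=
  [set pi : 'S_n | cycle_type pi == lam].

Definition mult_part (lam : seq nat) (i : nat) : nat := count_mem i lam.

Definition unif_expect (R : numFieldType) n (A : {set 'S_n}) (f : 'S_n -> R) : R :=
  (\sum_(pi in A) f pi) / #|A|%:R.

(* Main.v *)
(* Averaging over the conjugates of one permutation tau of cycle type lambda, it
   is enough to evaluate the sum G of w^(p+1) over all conjugates tau^sigma.  By
   the theory of enriched P-partitions, (1/2) z^(n+1) w^(p(pi)+1), for
   z = (1+t)/(1-t) and w = 4t/(1+t)^2, is the generating function in t^a of the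
   number of weakly increasing words of length n on 2a letters in which odd
   letters repeat only at ascents of pi and even letters only at descents.
   Exchanging the sums, G counts pairs of a labelling g of [n] by L = 2a letters
   and a linear order of [n] in which tau is compatible with g.  The labels along
   the orbits of tau almost always decide the place of a nontrivial cycle, so that
   adding the cycles one at a time costs a factor 1 + O(1/L + n/L^2) each, and up
   to exp(O(n/L + n^2/L^2)) only the m fixed points matter.  Their count is
   explicit and gives a double sequence zeta(m,N), N = n - m, with
   zeta(m+2,N) = zeta(m+1,N+1) + m(m+1) zeta(m,N), while zeta(0,N) is a Riemann
   sum for N!/(2 b^(N+1)) if t = e^(-2b).  After normalisation, exp(Phi +- Err)
   with Phi = n (B x^3/3 + B^2 (2x^6/9 - 3x^5/10)), B = b^2, x = m/n, are a super-
   and a subsolution of this recursion.  For w = e^(-s/sqrt n) one has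
   tanh^2 b = 1 - w, so b is of order n^(-1/4), which is the size of the error,
   and the Taylor expansion of b in tanh b gives the exponents. *)

Require Import Defs.
From HB Require Import structures.
From mathcomp Require Import all_boot all_fingroup zify.
Set Implicit Arguments. Unset Strict Implicit. Unset Printing Implicit Defensive.

(** * Words compatible with an ascent pattern *)

(** In a compatible order two elements stand as their labels do; if the labels are equal, they stand
    as their images do, or the opposite way when the label is even. So the first disagreement of the
    labels along the two orbits decides, and only pairs that agree for ever remain free. For two
    fixed points one coincidence, of probability 1/L, is enough, and there are too many such pairs
    to be neglected. For a nontrivial cycle, agreement with an element outside needs at least two
    coincidences, of probability 1/L^2 for each of at most n elements; agreement inside the cycle is
    possible only between antipodes, where one coincidence may do. This is the origin of 1/L +
    n/L^2. The weight t^a with t = e^(-2b) concentrates L = 2a near n/b, so that all cycles together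
    cost O(n/L + n^2/L^2) = O(b) in the exponent; much smaller a are cut off and bounded separately.
    As B = b^2 is of order n^(-1/2), terms of size B or n B^3 are harmless, and Phi has to be right
    only to second order in B. *)

Definition before (T : eqType) (s : seq T) (x y : T) := index x s < index y s.

Lemma before_trans (T : eqType) (s : seq T) : transitive (before s).
Proof. by move=> y x z; apply: ltn_trans. Qed.

Lemma before_irr (T : eqType) (s : seq T) : irreflexive (before s).
Proof. by move=> x; apply: ltnn. Qed.

(** If the indices of x and y coincide, y occurs in s too and equals x; an absent y has index
    [size s] and comes after x. *)
Lemma before_total (T : eqType) (s : seq T) x y :
  x \in s -> x != y -> before s y x = ~~ before s x y.
Proof.
move=> xs xy; rewrite /before -leqNgt [RHS]leq_eqVlt [RHS]orbC.
case: eqP => [e|_]; last by rewrite orbF.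
have ys : y \in s by rewrite -index_mem e index_mem.
by case/eqP: xy; rewrite -(nth_index x xs) -e nth_index.
Qed.

Lemma sorted_before (T : eqType) (s : seq T) : uniq s -> sorted (before s) s.
Proof.
case: s => [//|x0 s] Us; apply/(sortedP x0) => i Hi.
by rewrite /before !index_uniq // ltnW.
Qed.

Lemma before_subseq (T : eqType) (s s' : seq T) x y : uniq s -> subseq s' s ->
  x \in s' -> y \in s' -> before s' x y = before s x y.
Proof.
move=> Us ss xs ys.
have imp u v : u \in s' -> v \in s' -> before s' u v -> before s u v.
  move=> us vs; apply: (sorted_ltn_index (@before_trans _ s)) => //.
  exact: subseq_sorted (@before_trans _ s) _ _ ss (sorted_before Us).
apply/idP/idP; first exact: imp.
have [->|nxy] := eqVneq x y; first by rewrite before_irr.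
move=> h; apply: contraT; rewrite -(before_total xs nxy) => /(imp _ _ ys xs).
by rewrite (before_total (mem_subseq ss xs) nxy) h.
Qed.

(** A list sorted by an irreflexive transitive relation is determined by its elements, and
    [before s'] sorts both lists. *)
Lemma eq_before (T : eqType) (s s' : seq T) : uniq s -> perm_eq s s' ->
  {in s &, forall x y, before s x y = before s' x y} -> s = s'.
Proof.
move=> Us pss eqb.
have Us' : uniq s' by rewrite -(perm_uniq pss).
apply: (irr_sorted_eq (@before_trans _ s') (@before_irr _ s')).
- case: s Us pss eqb => [//|x0 s] Us pss eqb; apply/(sortedP x0) => i Hi.
  rewrite -eqb ?mem_nth //; last exact: ltnW.
  by move/(sortedP x0): (sorted_before Us); apply.
- exact: sorted_before.
- exact: perm_mem.
Qed.

Definition update (T : finType) (B : Type) (g : {ffun T -> B}) (x : T) (l : B)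
  : {ffun T -> B} := [ffun y => if y == x then l else g y].

Definition indep (T : finType) (B C : Type) (x : T) (phi : {ffun T -> B} -> C) :=
  forall g l, phi (update g x l) = phi g.

(* Independently of the other coordinates, g x takes each of its L values equally
   often. *)
Lemma resample (T : finType) (L : nat) (x : T)
    (phi : {ffun T -> 'I_L} -> nat) (psi : {ffun T -> 'I_L} -> 'I_L) :
  indep x phi -> indep x psi ->
  L * (\sum_(g : {ffun T -> 'I_L} | g x == psi g) phi g) = \sum_g phi g.
Proof.
move=> hphi hpsi.
transitivity (\sum_(p : {ffun T -> 'I_L} * 'I_L | p.1 x == psi p.1) phi p.1).
  transitivity (\sum_(g : {ffun T -> 'I_L} | g x == psi g) \sum_(l : 'I_L) phi g).
    by rewrite big_distrr; apply: eq_bigr => g _ /=; rewrite sum_nat_const card_ord.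
  by rewrite pair_big_dep; apply: eq_bigl => p; rewrite andbT.
(* Exchange the coordinate x of g with the spare letter. Since phi and psi do not see that
   coordinate, the condition on g x becomes one on the spare letter alone. *)
pose h (p : {ffun T -> 'I_L} * 'I_L) := (update p.1 x p.2, p.1 x).
have hh : involutive h.
  case=> g l; rewrite /h /update /= ffunE eqxx; congr pair.
  by apply/ffunP => y; rewrite !ffunE; case: eqP => [->|].
rewrite (reindex_inj (inv_inj hh)) /=.
transitivity (\sum_(g : {ffun T -> 'I_L}) \sum_(l | l == psi g) phi g); last first.
  by apply: eq_bigr => g _; rewrite big_pred1_eq.
rewrite pair_big_dep; apply: eq_big => [[g l]|[g l] _] /=.
  by rewrite ffunE eqxx hpsi.
by rewrite hphi.
Qed.

(* Letters are numbered from 0; 2i and 2i+1 stand for the letters -i and +i of an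
   enriched P-partition. *)
Definition compat_step (asc : bool) (c d : nat) := (c < d) || ((c == d) && (odd c == asc)).

(** Compatible words of k+1 letters with last letter below j, classified by that letter i. The
    letter before it is below i, or equal to i where the repetition is allowed; hence the shifted
    bound. *)
Fixpoint word_count (asc : nat -> bool) (k j : nat) : nat :=
  if k is k'.+1 then \sum_(i < j) word_count asc k' (i + (odd i == asc k')) else j.

Lemma eq_word_count asc asc' k j : (forall i, i < k -> asc i = asc' i) ->
  word_count asc k j = word_count asc' k j.
Proof.
elim: k j => [//|k IH] j h /=; apply: eq_bigr => i _.
by rewrite (h k) // IH // => i' Hi'; apply: h; apply: ltnW.
Qed.

Lemma compat_step_lt asc (c d : nat) : compat_step asc c d = (c < d + (odd d == asc)).
Proof.
rewrite /compat_step; case: (ltngtP c d) => h /=.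
- by rewrite ltn_addr.
- by case: (odd d == asc); lia.
- by rewrite h; case: (odd d == asc); lia.
Qed.

Definition chain (T : finType) L (e : rel T) (g : {ffun T -> 'I_L}) : rel T :=
  fun x y => compat_step (e x y) (g x) (g y).

Lemma eq_path_in (T : eqType) (e e' : rel T) x s :
  {in x :: s &, e =2 e'} -> path e x s = path e' x s.
Proof.
elim: s x => [//|y s IH] x h /=; rewrite h ?inE ?eqxx ?orbT //.
by rewrite IH // => u v us vs; apply: h; rewrite inE ?us ?vs orbT.
Qed.

Lemma card_lt_split (T : finType) L (Q : pred {ffun T -> 'I_L}) x j :
  #|[set g : {ffun T -> 'I_L} | Q g && (g x < j)]| =
  \sum_(i < j) #|[set g : {ffun T -> 'I_L} | Q g && (g x == i :> nat)]|.
Proof.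
rewrite -sum1dep_card.
rewrite (eq_bigr (fun i : 'I_j => \sum_(g : {ffun T -> 'I_L} | Q g) (g x == i :> nat))); last first.
  by move=> i _; rewrite -sum1dep_card big_mkcondr /=; apply: eq_bigr => g _; case: eqP.
rewrite exchange_big /= big_mkcondr; apply: eq_bigr => g _.
case: ltnP => h.
  rewrite (bigD1 (Ordinal h)) //= eqxx big1 // => i.
  by rewrite -val_eqE eq_sym /= => /negbTE->.
by rewrite big1 // => i _; case: eqP => // e1; move: (ltn_ord i); rewrite -e1 ltnNge h.
Qed.

(** The labels of distinct points are independent and uniform, so the points of s carry a uniform
    word. Powers of L replace a division, and the cut j on the last label is what lets the induction
    run from the end of s. *)
Lemma count_chain_lt (T : finType) L (e : rel T) (x0 : T) (s : seq T) j :
  uniq (x0 :: s) -> j <= L ->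
  L ^ (size s).+1 * #|[set g : {ffun T -> 'I_L} | path (chain e g) x0 s && (g (last x0 s) < j)]|
  = L ^ #|T| * word_count (fun i => e (nth x0 (x0 :: s) i) (nth x0 (x0 :: s) i.+1)) (size s) j.
Proof.
(* Without letters both sides vanish, because T contains x0. *)
case: (posnP L) => [-> _|L0].
  rewrite leqn0 => /eqP->; rewrite exp0n // mul0n.
  case: (posnP #|T|) => [|h]; last by rewrite exp0n.
  by move/card0_eq => /(_ x0).
have slice (Q : pred {ffun T -> 'I_L}) x i (Hi : i < L) : indep x (fun g => Q g : nat) ->
    L * #|[set g : {ffun T -> 'I_L} | Q g && (g x == i :> nat)]| = #|[set g | Q g]|.
  move=> hQ; rewrite -!sum1dep_card.
  rewrite [RHS]big_mkcond /= -(resample (psi := fun=> Ordinal Hi) hQ) //.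
  congr muln; rewrite big_mkcondl; apply: eq_big => g; last by case: (Q g).
  by rewrite -val_eqE.
elim/last_ind: s j => [|s x IH] j Us jL.
  have -> : [set g : {ffun T -> 'I_L} | path (chain e g) x0 [::] && (g (last x0 [::]) < j)] =
     [set g : {ffun T -> 'I_L} | true && (g x0 < j)] by [].
  rewrite expn1 card_lt_split big_distrr /=.
  rewrite (eq_bigr (fun=> L ^ #|T|)); last first.
    move=> i _; rewrite (slice predT x0) ?(leq_trans (ltn_ord i)) //.
    by rewrite (_ : [set g | _] = setT) ?cardsT ?card_ffun ?card_ord //; apply/setP => g; rewrite !inE.
  by rewrite sum_nat_const card_ord mulnC.
rewrite size_rcons last_rcons expnS -mulnA card_lt_split.
rewrite /= 2!big_distrr /= big_distrr /=; apply: eq_bigr => i _.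
have iL : i < L by apply: leq_trans jL.
set i' := i + _.
have Us0 : uniq (x0 :: s) by move: Us; rewrite -rcons_cons rcons_uniq => /andP[].
have xs : x \notin x0 :: s by move: Us; rewrite -rcons_cons rcons_uniq => /andP[].
have i'L : i' <= L.
  rewrite /i'; case: (odd i == _); rewrite ?addn0 ?addn1 //; exact: ltnW.
have nthL k : k <= size s -> nth x0 (x0 :: rcons s x) k = nth x0 (x0 :: s) k.
  by move=> hk; rewrite -rcons_cons nth_rcons /= ltnS hk.
have -> : word_count (fun i0 => e (nth x0 (x0 :: rcons s x) i0) (nth x0 (rcons s x) i0)) (size s) i' =
          word_count (fun i => e (nth x0 (x0 :: s) i) (nth x0 (x0 :: s) i.+1)) (size s) i'.
  apply: eq_word_count => k hk; rewrite nthL ?(ltnW hk) //.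
  by rewrite -(nthL k.+1).
rewrite -IH //.
rewrite mulnCA; congr muln.
rewrite -(slice (fun g => path (chain e g) x0 s && (g (last x0 s) < i')) x _ iL); last first.
  move=> g l; congr (nat_of_bool (_ && _)); last first.
    rewrite ffunE; case: eqP => // h.
    by move: (mem_last x0 s); rewrite h (negbTE xs).
  apply: eq_path_in => u v us vs; rewrite /chain !ffunE.
  by rewrite (negbTE (memPn xs _ us)) (negbTE (memPn xs _ vs)).
congr muln; apply: eq_card => g; rewrite !inE rcons_path.
case: (path (chain e g) x0 s) => //=.
case gx: (nat_of_ord (g x) == i); rewrite ?andbF ?andbT //.
rewrite /chain compat_step_lt (eqP gx) /i'; congr (_ < _ + (_ == _)).
by rewrite nthL // nth_rcons ltnn eqxx -[size s]/((size (x0 :: s)).-1) nth_last.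
Qed.

Definition image_before (T : finType) (tau : {perm T}) (s : seq T) : rel T :=
  fun x y => before s (tau x) (tau y).

(* The list s is a linear order, along which tau is read as a word. *)
Definition compatible (T : finType) L (tau : {perm T}) (g : {ffun T -> 'I_L}) (s : seq T) :=
  sorted (chain (image_before tau s) g) s.

Definition orders (T : finType) L (tau : {perm T}) (A : {set T}) (g : {ffun T -> 'I_L}) :=
  count (compatible tau g) (permutations (enum A)).

Definition invariant_set (T : finType) (tau : {perm T}) (A : {set T}) :=
  forall x, x \in A -> tau x \in A.

(** * Orders compatible with a labelling *)

Section Compat.
Variables (T : finType) (L : nat) (tau : {perm T}).
Implicit Types (g : {ffun T -> 'I_L}) (s : seq T) (A : {set T}).

Lemma invariant_iter A j x : invariant_set tau A -> x \in A -> iter j tau x \in A.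
Proof. by move=> hA xA; elim: j => //= j; apply: hA. Qed.

Lemma iter_tau_inj j : injective (iter j tau).
Proof. by elim: j => [//|j IH] x y /= /perm_inj/IH. Qed.

Lemma mem_perms A s x : s \in permutations (enum A) -> (x \in s) = (x \in A).
Proof. by rewrite mem_permutations => /perm_mem->; rewrite mem_enum. Qed.

Lemma uniq_perms A s : s \in permutations (enum A) -> uniq s.
Proof. by rewrite mem_permutations => /perm_uniq->; apply: enum_uniq. Qed.

Lemma size_perms A s : s \in permutations (enum A) -> size s = #|A|.
Proof. by rewrite mem_permutations => /perm_size->; rewrite -cardE. Qed.

(** If two consecutive steps keep the label, its parity prescribes the same direction for both
    comparisons of images, and these compose. *)
Lemma chain_trans g s : transitive (chain (image_before tau s) g).
Proof.
move=> y x z; rewrite /chain /compat_step /image_before /before.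
case: (ltngtP (g x) (g y)) => [xy|//|xy] /=;
  case: (ltngtP (g y) (g z)) => [yz|//|yz] //=.
- by rewrite (ltn_trans xy yz).
- by rewrite -yz xy.
- by rewrite xy yz.
rewrite xy yz eqxx ltnn /=.
have e b c : (b == c) = if b then c else ~~ c by case: b; case: c.
rewrite !e; case: (odd (g z)); first exact: ltn_trans.
rewrite -!leqNgt => h1 h2; exact: leq_trans h2 h1.
Qed.

Lemma compatible_chain g s x y : compatible tau g s -> x \in s -> y \in s -> before s x y ->
  chain (image_before tau s) g x y.
Proof. by move=> hs xs ys; apply: (sorted_ltn_index (@chain_trans g s) hs). Qed.

Lemma compatibleI g s : uniq s ->
  {in s &, forall x y, before s x y -> chain (image_before tau s) g x y} -> compatible tau g s.
Proof.
case: s => [//|x0 s] Us h; apply/(sortedP x0) => i Hi.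
apply: h; rewrite ?mem_nth //; first exact: ltnW.
by rewrite /before !index_uniq // ltnW.
Qed.

(** The chain condition holds for (x, y) or for (y, x), according to the order s, and it cannot hold
    for both because x and y have distinct images. *)
Lemma compatible_beforeE A g s x y : invariant_set tau A -> s \in permutations (enum A) ->
  compatible tau g s -> x \in A -> y \in A -> x != y ->
  before s x y = compat_step (before s (tau x) (tau y)) (g x) (g y).
Proof.
move=> hA hs hc xA yA nxy.
have inS u : u \in A -> u \in s by rewrite (mem_perms _ hs).
have [b|nb] := boolP (before s x y).
  by have := compatible_chain hc (inS _ xA) (inS _ yA) b.
have := nb; rewrite -before_total ?inS // => /(compatible_chain hc (inS _ yA) (inS _ xA)).
rewrite /chain /compat_step /image_before (before_total (x := tau x)) ?(inj_eq perm_inj) ?inS ?hA //.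
by case: (ltngtP (g x) (g y)) => //= ->; case: (odd _); case: (before s _ _).
Qed.

(* Equality of the labels of x and y along d steps propagates the order of their
   images back to x and y, reversed at each even label. *)
Fixpoint parity (d : nat) g x : bool :=
  if d is d'.+1 then parity d' g x (+) ~~ odd (g (iter d' tau x)) else false.

Lemma parity_add d d' g x : parity (d + d') g x = parity d g x (+) parity d' g (iter d tau x).
Proof.
elim: d' => [|d' IH]; first by rewrite addn0 addbF.
by rewrite addnS /= IH addbA -iterD addnC.
Qed.

Definition agree g (x y : T) := forall j, g (iter j tau x) = g (iter j tau y).

Lemma eq_parity d g x y : agree g x y -> parity d g x = parity d g y.
Proof. by move=> h; elim: d => //= d ->; rewrite h. Qed.

Lemma agree_iter j g x y : agree g x y -> agree g (iter j tau x) (iter j tau y).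
Proof. by move=> h i; rewrite -!iterD. Qed.

Section One.
Variables (A : {set T}) (g : {ffun T -> 'I_L}) (s : seq T).
Hypotheses (hA : invariant_set tau A) (hs : s \in permutations (enum A)) (hc : compatible tau g s).

Lemma before_iter d x y : x \in A -> y \in A -> x != y ->
  (forall j, j < d -> g (iter j tau x) = g (iter j tau y)) ->
  before s x y = parity d g x (+) before s (iter d tau x) (iter d tau y).
Proof.
move=> xA yA nxy; elim: d => [|d IH] h; first by [].
rewrite {}IH => [|j jd]; last by apply: h; apply: ltnW.
rewrite /= (compatible_beforeE hA hs hc) ?invariant_iter ?(inj_eq (@iter_tau_inj d)) //.
rewrite /compat_step h // ltnn eqxx /=.
by case: (parity _ _ _); case: (odd _); case: (before _ _ _).
Qed.

(* Otherwise the iterates of tau^e on x would form an infinite monotone sequence. *)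
Lemma no_positive_loop e x : x \in A -> agree g x (iter e tau x) -> parity e g x = false ->
  iter e tau x = x.
Proof.
move=> xA ag pe; apply/eqP; apply: contraT => ne.
have par0 i : parity (i * e) g x = false.
  elim: i => [//|i IH]; rewrite mulSn parity_add pe /=.
  by rewrite -(eq_parity _ ag).
have step i : before s (iter (i * e) tau x) (iter (i.+1 * e) tau x) = before s x (iter e tau x).
  rewrite [RHS](@before_iter (i * e)) ?invariant_iter //; last by rewrite eq_sym.
  by rewrite par0 /= -iterD mulSn addnC.
have xs i : iter i tau x \in s by rewrite (mem_perms _ hs) invariant_iter.
have [b|nb] := boolP (before s x (iter e tau x)).
  have inc i : i <= index (iter (i * e) tau x) s.
    elim: i => [//|i IH]; apply: leq_ltn_trans IH _.
    by have := step i; rewrite b.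
  have := inc (size s); rewrite leqNgt index_mem.
  by rewrite xs.
have dec i : index (iter (i * e) tau x) s + i <= index x s.
  elim: i => [|i IH]; first by rewrite addn0.
  apply: leq_trans IH; rewrite addnS ltn_add2r.
  have := step i; rewrite (negbTE nb) => h.
  have : before s (iter (i.+1 * e) tau x) (iter (i * e) tau x).
    rewrite (before_total (x := iter (i * e) tau x)) ?h //.
    by rewrite mulSn addnC iterD (inj_eq (@iter_tau_inj _)) eq_sym.
  by [].
by have := leq_trans (leq_addl _ _) (dec (index x s).+1); rewrite ltnn.
Qed.

(** The second half of a turn by 2d repeats the labels of the first half, so the reversals cancel,
    and a turn without reversal cannot move x. *)
Lemma antipode d x : x \in A -> agree g x (iter d tau x) -> iter (d + d) tau x = x.
Proof.
move=> xA ag; apply: no_positive_loop => //.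
  by move=> j; rewrite iterD -(agree_iter d ag).
by rewrite parity_add -(eq_parity _ ag) addbb.
Qed.
End One.

Lemma porbit_iter x y : y \in porbit tau x -> exists j, y = iter j tau x.
Proof. by case/porbitP => j ->; exists j; rewrite permX. Qed.

Lemma iter_in_porbit j x : iter j tau x \in porbit tau x.
Proof. by rewrite -permX mem_porbit. Qed.

Lemma invariant_porbit x : invariant_set tau (porbit tau x).
Proof. by move=> y /porbit_iter[j ->]; rewrite -iterS iter_in_porbit. Qed.

Lemma iter_mulporbit q x : iter (q * #|porbit tau x|) tau x = x.
Proof. by elim: q => [//|q IH]; rewrite mulSn iterD IH iter_porbit. Qed.

Lemma iter_fixE x m : (iter m tau x == x) = (#|porbit tau x| %| m).
Proof.
set k := #|_|.
have k0 : 0 < k by apply/card_gt0P; exists x; apply: porbit_id.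
rewrite {1}(divn_eq m k) addnC iterD iter_mulporbit /dvdn.
have mk : m %% k < k by rewrite ltn_mod.
have := nth_uniq x (i := m %% k) (j := 0) _ _ (uniq_traject_porbit tau x).
by rewrite size_traject -/k mk k0 !nth_traject // => ->.
Qed.

(** The point half-way along the orbit of x; the value x stands for its absence when the orbit has
    odd length. *)
Definition antipodal (x : T) :=
  if [pick j : 'I_#|porbit tau x| | (iter j tau x != x) && (iter (j + j) tau x == x)]
  is Some j then iter j tau x else x.

(** The orbit length k divides 2d but not d, so k = 2j and d is an odd multiple of j. *)
Lemma antipodalE d x : iter d tau x != x -> iter (d + d) tau x = x ->
  iter d tau x = antipodal x.
Proof.
move=> h1 h2; rewrite /antipodal; case: pickP => [j /andP[]|/= h].
  rewrite !iter_fixE => k1 k2; move: h1 (introT eqP h2); rewrite !iter_fixE.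
  have jk := ltn_ord j; move: k1 k2 jk (iter_mulporbit (d %/ j)./2 x).
  set k := #|_| => k1 k2 jk hq h1 h2'.
  have kE : k = j + j.
    case/dvdnP: k2 => q hq2.
    have q0 : q != 0 by apply/eqP => q0; move: hq2 k1; rewrite q0 mul0n => /eqP; rewrite addn_eq0 => /andP[/eqP-> _]; rewrite dvdn0.
    have q2 : q < 2 by rewrite -(ltn_pmul2r (leq_ltn_trans (leq0n j) jk)) -hq2; lia.
    by case: q hq2 q0 q2 => [|[|q]] // hq2 _ _; rewrite hq2 mul1n.
  have jd : j %| d.
    move: h2'; rewrite kE !addnn -!mul2n => h3.
    by rewrite dvdn_pmul2l in h3.
  have dE : d = j * (d %/ j) by rewrite mulnC divnK.
  have oq : odd (d %/ j).
    apply: contraR h1 => ev; rewrite kE addnn -muln2 dE dvdn_mul // dvdn2 //.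
  have -> : iter d tau x = iter j tau (iter ((d %/ j)./2 * k) tau x); last by rewrite hq.
  rewrite -iterD; congr iter; rewrite kE {1}dE.
  by have := odd_double_half (d %/ j); rewrite oq -addnn; nia.
set k := #|porbit tau x| in h.
have k0 : 0 < k by apply/card_gt0P; exists x; apply: porbit_id.
have := h (Ordinal (ltn_pmod d k0)); rewrite /= !iter_fixE -/k.
move: h1 (introT eqP h2); rewrite !iter_fixE -/k => h1.
by rewrite /dvdn modn_mod modnDm => ->; rewrite h1.
Qed.

End Compat.

Section Extension.
Variables (T : finType) (L : nat) (tau : {perm T}).
Implicit Types (g : {ffun T -> 'I_L}) (s : seq T) (A : {set T}).

Lemma filter_perms A A' s : A \subset A' -> s \in permutations (enum A') ->
  filter [in A] s \in permutations (enum A).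
Proof.
move=> sA hs; rewrite mem_permutations; apply: uniq_perm.
- by rewrite filter_uniq // (uniq_perms hs).
- exact: enum_uniq.
- move=> x; rewrite mem_filter mem_enum (mem_perms _ hs) /=.
  by case xA: (x \in A) => //=; apply: (subsetP sA).
Qed.

Lemma before_filter A s x y : uniq s -> x \in s -> y \in s -> x \in A -> y \in A ->
  before (filter [in A] s) x y = before s x y.
Proof.
move=> Us xs ys xA yA; apply: before_subseq => //; first exact: filter_subseq.
- by rewrite mem_filter /= xA.
- by rewrite mem_filter /= yA.
Qed.

Lemma compatible_filter A A' g s : A \subset A' -> invariant_set tau A -> invariant_set tau A' ->
  s \in permutations (enum A') -> compatible tau g s -> compatible tau g (filter [in A] s).
Proof.
move=> sA hA hA' hs hc; have Us := uniq_perms hs.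
have inS u : u \in A -> u \in s by rewrite (mem_perms _ hs); apply: (subsetP sA).
apply: compatibleI; first exact: filter_uniq.
move=> x y; rewrite !mem_filter /= => /andP[xA xs] /andP[yA ys].
rewrite before_filter // => b; have := compatible_chain hc xs ys b.
by rewrite /chain /image_before before_filter ?inS ?hA.
Qed.

Lemma orders_indep A x : x \notin A -> indep x (@orders T L tau A).
Proof.
move=> xA g l; apply: eq_in_count => s hs; rewrite /compatible.
case: s hs => [//|y s] hs /=; apply: eq_path_in => u v us vs.
rewrite /chain !ffunE.
have ne w : w \in y :: s -> (w == x) = false.
  by rewrite (mem_perms _ hs) => wA; apply: contraNF xA => /eqP <-.
by rewrite !ne.
Qed.

Lemma iter_modorder k z : iter k tau z = iter (k %% #[tau]%g) tau z.
Proof.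
by rewrite -!permX {1}(divn_eq k #[tau]%g) expgD mulnC expgM expg_order expg1n mul1g.
Qed.

Lemma agree_dec g x y :
  reflect (agree tau g x y) [forall j : 'I_#[tau]%g, g (iter j tau x) == g (iter j tau y)].
Proof.
apply: (iffP forallP) => h k; last by rewrite h.
rewrite iter_modorder [in RHS]iter_modorder.
exact/eqP/(h (Ordinal (ltn_pmod k (order_gt0 tau)))).
Qed.

Section Two.
Variables (A : {set T}) (g : {ffun T -> 'I_L}) (s s' : seq T).
Hypotheses (hA : invariant_set tau A).
Hypotheses (hs : s \in permutations (enum A)) (hc : compatible tau g s).
Hypotheses (hs' : s' \in permutations (enum A)) (hc' : compatible tau g s').

(** Up to the first disagreement of the labels both orders propagate the comparison with the same
    parity, and at the disagreement the labels decide. *)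
Lemma before_disagree x y : x \in A -> y \in A -> x != y ->
  ~~ [forall j : 'I_#[tau]%g, g (iter j tau x) == g (iter j tau y)] ->
  before s x y = before s' x y.
Proof.
move=> xA yA nxy; rewrite negb_forall => /existsP[j0 hj0].
have exj : exists j, g (iter j tau x) != g (iter j tau y) by exists j0.
case: (ex_minnP exj) => j hj jmin.
have below i : i < j -> g (iter i tau x) = g (iter i tau y).
  by move=> ij; apply/eqP; apply: contraTT ij => /jmin; rewrite -leqNgt.
rewrite (before_iter hA hs hc xA yA nxy below) (before_iter hA hs' hc' xA yA nxy below).
congr addb.
have nj : iter j tau x != iter j tau y by apply: contraNneq hj => ->.
rewrite (compatible_beforeE hA hs hc (invariant_iter j hA xA) (invariant_iter j hA yA) nj).
rewrite (compatible_beforeE hA hs' hc' (invariant_iter j hA xA) (invariant_iter j hA yA) nj).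
have ne : (g (iter j tau x) == g (iter j tau y) :> nat) = false by apply/negbTE.
by rewrite /compat_step ne !orbF.
Qed.

Lemma before_agree_iter j x y : x \in A -> y \in A -> x != y -> agree tau g x y ->
  before s (iter j tau x) (iter j tau y) = before s' (iter j tau x) (iter j tau y) ->
  before s x y = before s' x y.
Proof.
move=> xA yA nxy ag h.
by rewrite (before_iter (d := j) hA hs hc) // (before_iter (d := j) hA hs' hc') // h.
Qed.

End Two.

(** Agreement with x0 for ever implies these two coincidences, and two already have the probability
    1/L^2 that is needed. *)
Definition twins A x0 g := [set y in A | (g y == g x0) && (g (tau y) == g (tau x0))].

Definition twist x0 g := (antipodal tau x0 != x0) && (g x0 == g (antipodal tau x0)).

(* The order of A and a new cycle is determined by the order of A, the rank of x0
   among the elements of A sharing its first two labels, and the order of x0 and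
   its antipode. *)
Definition ext_code A x0 g s :=
  (filter [in A] s, (count (fun y => before s y x0) (enum (twins A x0 g)),
   twist x0 g && before s x0 (antipodal tau x0))).

(** Pairs whose labels disagree somewhere are decided by the labels. An agreeing pair may be moved
    along the orbits: a pair in A is seen in the restricted order; a mixed pair is moved until its
    element of the cycle is x0, and its partner is then a twin; two agreeing elements of the cycle
    are antipodes, and are moved to x0 and its antipode. *)
Lemma ext_code_inj A x0 g : invariant_set tau A -> x0 \notin A ->
  let A' := A :|: porbit tau x0 in
  {in [seq s <- permutations (enum A') | compatible tau g s] &, injective (ext_code A x0 g)}.
Proof.
move=> hA x0A A'.
have hA' : invariant_set tau A'.
  move=> x; rewrite !inE => /orP[/hA->//|h]; by rewrite [_ \in porbit _ _]invariant_porbit // orbT.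
have sA : A \subset A' by apply: subsetUl.
have cA' x : x \in porbit tau x0 -> x \in A' by rewrite inE orbC => ->.
have AA' x : x \in A -> x \in A' by move/(subsetP sA).
have dis x : x \in porbit tau x0 -> x \notin A.
  rewrite porbit_sym => /porbit_iter[j x0E]; apply: contra x0A => xA.
  by rewrite x0E invariant_iter.
move=> s s'; rewrite !mem_filter => /andP[hc hs] /andP[hc' hs'] [eqf eqn eqb].
have Us := uniq_perms hs; have Us' := uniq_perms hs'.
have inS x : x \in A' -> x \in s by rewrite (mem_perms _ hs).
have inS' x : x \in A' -> x \in s' by rewrite (mem_perms _ hs').
have inAA x y : x \in A -> y \in A -> before s x y = before s' x y.
  move=> xA yA; rewrite -(before_filter Us _ _ xA yA) ?inS ?AA' // eqf.
  by rewrite before_filter ?inS' ?AA'.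
have sym x y : x \in A' -> y \in A' -> before s y x = before s' y x -> before s x y = before s' x y.
  move=> xA yA; have [->|nxy] := eqVneq y x; first by rewrite !before_irr.
  by move=> h; rewrite !(before_total (x := y)) ?inS ?inS' // h.
(* Both orders agree on A, and the twins before x0 form an initial segment of the twins there, so
   their number determines them. *)
have twinx0 y : y \in twins A x0 g -> before s y x0 = before s' y x0.
  have gen u u' : uniq u -> (forall x, x \in A' -> x \in u) -> (forall x, x \in A' -> x \in u') ->
      (forall x y, x \in A -> y \in A -> before u x y = before u' x y) ->
      count (fun y => before u y x0) (enum (twins A x0 g)) <=
      count (fun y => before u' y x0) (enum (twins A x0 g)) ->
      y \in twins A x0 g -> before u y x0 -> before u' y x0.
    move=> Uu iu iu' inuu le yE b; apply: contraTT le => nb.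
    have yA : y \in A by move: yE; rewrite inE => /andP[].
    have b' : before u' x0 y.
      rewrite (before_total (x := y)) ?nb ?iu' ?AA' //.
      by apply: contraNneq x0A => <-.
    rewrite -ltnNge -!size_filter.
    have U1 : uniq (y :: [seq z <- enum (twins A x0 g) | before u' z x0]).
      by rewrite /= mem_filter (negbTE nb) /= filter_uniq ?enum_uniq.
    apply: (uniq_leq_size U1) => z; rewrite inE mem_filter.
    case/orP => [/eqP->|/andP[bz zE]]; first by rewrite mem_filter b mem_enum.
    rewrite mem_filter zE andbT; move: zE; rewrite mem_enum inE => /andP[zA _].
    by apply: before_trans b; rewrite inuu //; apply: before_trans b' .
  move=> yE; apply/idP/idP; apply: gen => //; rewrite ?eqn //.
  by move=> a b aA bA; rewrite inAA.
have agree_tw y : agree tau g x0 y -> y \in A -> y \in twins A x0 g.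
  by move=> ag yA; rewrite inE yA /= -[g y](ag 0) -[g (tau y)](ag 1) /= !eqxx.
apply: (eq_before Us); first by move: hs hs'; rewrite !mem_permutations => h1 /[1!perm_sym]; apply: perm_trans h1.
move=> x y; rewrite !(mem_perms _ hs) => xA' yA'.
have [->|nxy] := eqVneq x y; first by rewrite !before_irr.
have [/agree_dec ag|] := boolP [forall j : 'I_#[tau]%g, g (iter j tau x) == g (iter j tau y)];
  last by apply: (before_disagree hA').
have mixed u v : u \in porbit tau x0 -> v \in A -> u != v -> agree tau g u v ->
    before s u v = before s' u v.
  move=> uc vA nuv aguv.
  have [j x0E] : exists j, x0 = iter j tau u by move: uc; rewrite porbit_sym => /porbit_iter.
  apply: (before_agree_iter hA' hs hc hs' hc' (j := j)) => //; [exact: cA'|exact: AA'|rewrite -x0E].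
  have vjA : iter j tau v \in A by rewrite invariant_iter.
  apply: sym; [exact/cA'/porbit_id|exact: AA'|apply: twinx0].
  apply: agree_tw => //; rewrite [X in agree _ _ X _]x0E; exact: agree_iter.
have agC u v : agree tau g u v -> agree tau g v u by move=> h j; rewrite h.
move: (xA') (yA'); rewrite !inE => /orP[xA|xc] /orP[yA|yc].
- exact: inAA.
- by apply: sym => //; apply: mixed; rewrite 1?eq_sym //; apply: agC.
- exact: mixed.
have [d yE] : exists d, y = iter d tau x.
  by apply: porbit_iter; move: xc yc; rewrite -!eq_porbit_mem => /eqP-> /eqP->.
have x2 : iter (d + d) tau x = x by apply: (antipode hA' hs hc) => //; rewrite -yE.
have [j x0E] : exists j, x0 = iter j tau x by move: xc; rewrite porbit_sym => /porbit_iter.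
have comm i : iter i tau (iter j tau x) = iter j tau (iter i tau x) by rewrite -!iterD addnC.
apply: (before_agree_iter hA' hs hc hs' hc' (j := j)) => //.
have ne0 : iter d tau x0 != x0.
  by rewrite x0E comm (inj_eq (@iter_tau_inj _ _ j)) -yE eq_sym.
have -> : iter j tau y = antipodal tau x0.
  by rewrite -(antipodalE ne0) ?x0E ?comm -?yE // x2.
rewrite -x0E; move: eqb; rewrite /twist.
have -> : antipodal tau x0 = iter j tau y.
  by rewrite -(antipodalE ne0) ?x0E ?comm -?yE // x2.
have -> : iter j tau y != x0 by rewrite yE -comm -x0E.
by rewrite {1 3}x0E (ag j) eqxx.
Qed.
End Extension.

Lemma leq_expl m n e : m <= n -> m ^ e <= n ^ e.
Proof. by case: e => // e mn; rewrite leq_exp2r. Qed.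

Lemma indep_coord (T : finType) (B : Type) (x y : T) : y != x ->
  indep x (fun g : {ffun T -> B} => g y).
Proof. by move=> /negbTE yx g l; rewrite ffunE yx. Qed.

(** The label of x1 is resampled first; x2 and y2 differ from x1, so the second equation does not
    see this. *)
Lemma resample2 (T : finType) (L : nat) (x1 y1 x2 y2 : T)
    (phi : {ffun T -> 'I_L} -> nat) :
  indep x1 phi -> indep x2 phi -> y1 != x1 -> y2 != x2 -> x2 != x1 -> y2 != x1 ->
  L ^ 2 * (\sum_(g : {ffun T -> 'I_L} | (g x1 == g y1) && (g x2 == g y2)) phi g)
  = \sum_g phi g.
Proof.
move=> h1 h2 n11 n22 nx21 ny21.
rewrite -(resample h2 (indep_coord n22)) expnS expn1 -mulnA; congr muln.
rewrite big_mkcondr [RHS]big_mkcond /=.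
rewrite -(resample (x := x1) (psi := fun g => g y1)) //; last exact: indep_coord.
by move=> g l; rewrite (indep_coord nx21) (indep_coord ny21) h1.
Qed.

(** * Comparison with the fixed points *)

Section Upper.
Variables (T : finType) (L : nat) (tau : {perm T}).
Implicit Types (g : {ffun T -> 'I_L}) (s : seq T) (A : {set T}).

(** Over each order of A there are at most (1 + k)(1 + w) codes, for k twins and w the value 0 or 1
    of [twist], and this is at most 1 + w + 2k. *)
Lemma orders_extend A x0 g : invariant_set tau A -> x0 \notin A ->
  orders tau (A :|: porbit tau x0) g
  <= orders tau A g * (1 + twist tau x0 g + 2 * #|twins tau A x0 g|).
Proof.
move=> hA x0A; set A' := A :|: _.
have hA' : invariant_set tau A'.
  move=> x; rewrite !inE => /orP[/hA->//|h]; by rewrite [_ \in porbit _ _]invariant_porbit // orbT.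
have sA : A \subset A' by apply: subsetUl.
pose S := [seq s <- permutations (enum A') | compatible tau g s].
pose codes := [seq (f, p) | f <- [seq s <- permutations (enum A) | compatible tau g s],
   p <- [seq (i, b) | i <- iota 0 (#|twins tau A x0 g|).+1,
                      b <- if twist tau x0 g then [:: false; true] else [:: false]]].
have hsz : size [seq ext_code tau A x0 g s | s <- S] <= size codes.
  apply: uniq_leq_size.
    rewrite map_inj_in_uniq; first by rewrite filter_uniq ?permutations_uniq.
    exact: ext_code_inj.
  move=> _ /mapP[s + ->]; rewrite mem_filter => /andP[hc hs].
  apply: allpairs_f.
    by rewrite mem_filter (filter_perms sA hs) (compatible_filter sA hA hA' hs hc).
  apply: allpairs_f.
    rewrite mem_iota add0n ltnS; apply: leq_trans (count_size _ _) _.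
    by rewrite -cardE.
  by case: (twist _ _ _) => //=; case: (before _ _ _).
rewrite /orders -!size_filter; move: hsz; rewrite size_map => /leq_trans; apply.
rewrite /codes !size_allpairs size_iota leq_mul2l; apply/orP; right.
by case: (twist _ _ _) => /=; lia.
Qed.

Lemma porbit_notin A x0 x : invariant_set tau A -> x0 \notin A -> x \in porbit tau x0 -> x \notin A.
Proof.
move=> hA x0A; rewrite porbit_sym => /porbit_iter[j x0E]; apply: contra x0A => xA.
by rewrite x0E invariant_iter.
Qed.

Lemma sum_twist A x0 : invariant_set tau A -> x0 \notin A ->
  L * (\sum_g orders (L := L) tau A g * twist tau x0 g) <= \sum_g orders (L := L) tau A g.
Proof.
move=> hA x0A; rewrite /twist.
have [e|ne] := eqVneq (antipodal tau x0) x0.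
  by rewrite big1 ?muln0 // => g _; rewrite muln0.
rewrite -(resample (orders_indep tau x0A) (indep_coord ne)) leq_mul2l; apply/orP; right.
rewrite [leqRHS]big_mkcond; apply: leq_sum => g _ /=.
by case: (g x0 == _); rewrite ?muln0 ?muln1.
Qed.

(** The points x0 and tau x0 are distinct and outside A, so the two equations are independent of
    each other and of the orders of A. *)
Lemma sum_twins A x0 : invariant_set tau A -> x0 \notin A -> tau x0 != x0 ->
  L ^ 2 * (\sum_g orders (L := L) tau A g * #|twins tau A x0 g|)
  <= #|T| * \sum_g orders (L := L) tau A g.
Proof.
move=> hA x0A tx0.
have tx0A : tau x0 \notin A by apply: (porbit_notin hA x0A); apply: (iter_in_porbit tau 1).
rewrite (eq_bigr (fun g => \sum_(y in A) orders tau A g * ((g x0 == g y) && (g (tau x0) == g (tau y))))); last first.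
  move=> g _; rewrite -big_distrr /=; congr muln.
  rewrite -sum1_card big_mkcond [RHS]big_mkcond; apply: eq_bigr => y _.
  rewrite inE; case: (y \in A) => //=.
  by rewrite [g x0 == _]eq_sym [g (tau x0) == _]eq_sym; case: (_ && _).
rewrite exchange_big /= big_distrr /=.
set S := \sum_g orders tau A g.
apply: (@leq_trans (\sum_(y in A) S)).
  apply: leq_sum => y yA.
  have ne (u v : T) : u \in A -> v \notin A -> u != v by move=> uA; apply: contraNneq => <-.
  rewrite /S -(resample2 (orders_indep tau x0A) (orders_indep tau tx0A) 
    (ne _ _ yA x0A) (ne _ _ (hA _ yA) tx0A) tx0 (ne _ _ (hA _ yA) x0A)).
  rewrite leq_mul2l; apply/orP; right.
  rewrite [leqRHS]big_mkcond; apply: leq_sum => g _ /=.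
  by case: (_ && _); rewrite ?muln0 ?muln1.
by rewrite sum_nat_const leq_mul2r max_card orbT.
Qed.

Lemma sum_orders_extend A x0 : invariant_set tau A -> x0 \notin A -> tau x0 != x0 ->
  L ^ 2 * (\sum_g orders (L := L) tau (A :|: porbit tau x0) g)
  <= (L ^ 2 + L + 2 * #|T|) * \sum_g orders (L := L) tau A g.
Proof.
move=> hA x0A tx0.
apply: (@leq_trans (L ^ 2 * \sum_g (orders (L := L) tau A g + orders tau A g * twist tau x0 g
    + 2 * (orders tau A g * #|twins tau A x0 g|)))).
  rewrite leq_mul2l leq_sum ?orbT // => g _; apply: leq_trans (orders_extend g hA x0A) _.
  by rewrite 2!mulnDr muln1 [in leqRHS]mulnCA.
have -> : \sum_g (orders (L := L) tau A g + orders tau A g * twist tau x0 g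
    + 2 * (orders tau A g * #|twins tau A x0 g|)) = \sum_g orders (L := L) tau A g
    + \sum_g orders (L := L) tau A g * twist tau x0 g
    + 2 * \sum_g orders (L := L) tau A g * #|twins tau A x0 g|.
  by rewrite 2!big_split big_distrr.
move: (sum_twist hA x0A) (sum_twins hA x0A tx0).
set S := \sum_g orders tau A g; set X := \sum_g _; set Y := \sum_g _ => hX hY.
rewrite [L ^ 2 * _]mulnDr [L ^ 2 * (S + X)]mulnDr !mulnDl !leq_add //.
  by rewrite expnS expn1 -mulnA leq_mul2l hX orbT.
by rewrite mul0n addn0 addnn -mul2n mulnCA leq_mul2l hY orbT.
Qed.

(** Nontrivial cycles are removed one at a time. The exponent [#|A|] overestimates their number,
    which does not change the order of the error. *)
Lemma sum_orders_le A B : invariant_set tau A -> invariant_set tau B -> B \subset A ->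
  (forall x, x \in A -> tau x = x -> x \in B) ->
  (L ^ 2) ^ #|A| * (\sum_g orders (L := L) tau A g)
  <= (L ^ 2 + L + 2 * #|T|) ^ #|A| * \sum_g orders (L := L) tau B g.
Proof.
move=> + hB; have [n] := ubnP #|A|; elim: n A => // n IH A le hA sBA fB.
have [->|nAB] := eqVneq A B.
  by rewrite leq_mul2r leq_expl ?orbT // -addnA leq_addr.
have /subsetPn[x0 x0A x0B] : ~~ (A \subset B).
  by apply: contra nAB => sAB; rewrite eqEsubset sAB sBA.
pose c := porbit tau x0; pose A1 := A :\: c.
have cA x : x \in c -> x \in A by move/porbit_iter => [j ->]; apply: invariant_iter.
have cB x : x \in c -> x \notin B by apply: porbit_notin.
have AE : A = A1 :|: c.
  apply/setP => x; rewrite !in_setU in_setD.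
  by have [/cA->|] := boolP (x \in c); rewrite ?orbT ?orbF.
have hA1 : invariant_set tau A1.
  move=> x; rewrite !inE => /andP[xc xA]; rewrite hA // andbT; apply: contra xc.
  by rewrite -!eq_porbit_mem -[porbit tau x](porbit_perm tau 1 x) expg1.
have x0A1 : x0 \notin A1 by rewrite !inE porbit_id.
have cardA : #|A1| < #|A|.
  by apply/proper_card/properP; split; [apply: subsetDl|exists x0].
have sBA1 : B \subset A1.
  by apply/subsetP => x xB; rewrite !inE (subsetP sBA) // andbT; apply: contraTN xB; apply: cB.
have tx0 : tau x0 != x0 by apply: contraNneq x0B => /fB->.
have fB1 x : x \in A1 -> tau x = x -> x \in B.
  by rewrite inE => /andP[_ xA]; apply: fB.
have {}IH := IH A1 (leq_trans cardA le) hA1 sBA1 fB1.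
have ext := sum_orders_extend hA1 x0A1 tx0.
move: cardA; case: #|A| => // k; rewrite ltnS => A1k.
rewrite expnSr -mulnA AE -/c.
set a := _ + 2 * _ in IH ext *; set S := \sum_g _ in IH *.
apply: leq_trans (leq_mul (leqnn _) ext) _.
set S' := \sum_g orders tau B g in IH *.
have -> : a ^ k.+1 * S' = a * (a ^ (k - #|A1|) * (a ^ #|A1| * S')).
  by rewrite [a ^ (k - _) * _]mulnA -expnD subnK // mulnA -expnS.
rewrite [leqLHS]mulnCA leq_mul2l -[X in (L ^ 2) ^ X](subnK A1k) expnD -mulnA.
apply/orP; right; apply: leq_mul IH; apply: leq_expl.
by rewrite /a -addnA leq_addr.
Qed.
End Upper.

(** * Lower bound by labellings under which no moved point agrees with another point *)

Section Lower.
Variables (T : finType) (L : nat) (tau : {perm T}).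
Implicit Types (g : {ffun T -> 'I_L}) (s : seq T) (A : {set T}).

Definition fixset := [set x | tau x == x].

Lemma invariant_fixset : invariant_set tau fixset.
Proof. by move=> x; rewrite !inE (inj_eq perm_inj). Qed.

Definition agreeb g x y :=
  [forall j : 'I_#[tau]%g, g (iter j tau x) == g (iter j tau y)].

(* Comparison of the sequences of labels along the orbits, cut after j steps. *)
Fixpoint label_lt g (j : nat) (x y : T) : bool :=
  if j is j'.+1 then (g x < g y) || ((g x == g y) &&
    (if odd (g x) then label_lt g j' (tau x) (tau y) else label_lt g j' (tau y) (tau x)))
  else false.

Lemma label_lt_trans g j : transitive (label_lt g j).
Proof.
elim: j => [//|j IH] y x z /=.
rewrite -!val_eqE /=; case: (ltngtP (g x) (g y)) => [xy|//|xy] /=;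
  case: (ltngtP (g y) (g z)) => [yz|//|yz] //=.
- by rewrite (ltn_trans xy yz).
- by rewrite -yz xy.
- by rewrite xy yz.
rewrite xy yz ltnn eqxx /=; case: (odd _); first exact: IH.
by move=> h1 h2; apply: IH h2 h1.
Qed.

Lemma label_lt_agreel g j x y z : agree tau g x y -> label_lt g j x z = label_lt g j y z.
Proof.
have gen i u v : (forall w, agree tau g u v -> label_lt g i u w = label_lt g i v w) /\
   (forall w, agree tau g u v -> label_lt g i w u = label_lt g i w v).
  elim: i u v => [//|i IH] u v; split=> w ag /=; have e := ag 0; rewrite /= in e;
    have agt := agree_iter 1 ag; rewrite /= in agt.
    by rewrite e; case: (odd _); rewrite ?((IH _ _).1 _ agt) ?((IH _ _).2 _ agt).
  by rewrite e; case: (odd _); rewrite ?((IH _ _).1 _ agt) ?((IH _ _).2 _ agt).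
by move=> ag; apply: (gen _ _ _).1.
Qed.

Lemma label_lt_agreer g j x y z : agree tau g x y -> label_lt g j z x = label_lt g j z y.
Proof.
elim: j x y z => [//|j IH] x y z ag /=; have e := ag 0; rewrite /= in e.
have agt := agree_iter 1 ag; rewrite /= in agt.
by rewrite e; case: (odd _); rewrite ?(IH _ _ _ agt) ?(label_lt_agreel _ _ agt).
Qed.

Lemma label_lt_irr g j : irreflexive (label_lt g j).
Proof. by elim: j => [//|j IH] x /=; rewrite ltnn IH; case: ifP => _; rewrite andbF. Qed.

Lemma label_lt_mono g j x y : label_lt g j x y -> label_lt g j.+1 x y.
Proof.
elim: j x y => [//|j IH] x y /= /orP[->//|/andP[-> h]].
by apply/orP; right; move: h; case: (odd _) => /= h; apply: IH h.
Qed.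

Lemma label_lt_total g j x y : ~~ label_lt g j x y -> ~~ label_lt g j y x ->
  forall i, i < j -> g (iter i tau x) = g (iter i tau y).
Proof.
elim: j x y => [//|j IH] x y /=; rewrite -!val_eqE /=.
case: (ltngtP (g x) (g y)) => //= e h1 h2.
have e' : g x = g y by apply: val_inj.
case=> [//|i] ij; rewrite !iterSr.
move: h1 h2; rewrite e; case: (odd _) => h1 h2; first exact: IH.
exact: IH.
Qed.

Section Build.
Variables (g : {ffun T -> 'I_L}) (s : seq T).
Hypotheses (hs : s \in permutations (enum fixset)) (hc : compatible tau g s).
Hypothesis gen : forall x y, x \notin fixset -> x != y -> ~~ agreeb g x y.

Let M := #[tau]%g.
(** Labels along the orbits come first, and ties are broken by the given order s of the fixed
    points. As M is the order of tau, comparing M labels is comparing all of them. *)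
Definition label_le x y := label_lt g M x y || (agreeb g x y && (index x s <= index y s)).

Lemma agreebC x y : agreeb g x y = agreeb g y x.
Proof. by apply: eq_forallb => j; rewrite eq_sym. Qed.

Lemma agree_fix x y : agreeb g x y -> x != y -> (x \in fixset) /\ (y \in fixset).
Proof.
move=> ag ne; split; apply: contraLR ag => h; first exact: gen.
by rewrite agreebC gen // eq_sym.
Qed.

Lemma label_lt_agreeF x y : label_lt g M x y -> agreeb g x y -> False.
Proof. by move=> h /agree_dec/(label_lt_agreel M y); rewrite h label_lt_irr. Qed.

Lemma label_le_total : total label_le.
Proof.
move=> x y; rewrite /label_le agreebC.
have [//|h1] := boolP (label_lt g M x y); have [|h2] := boolP (label_lt g M y x); first by rewrite orbT.
have -> : agreeb g y x.
  by apply/forallP => j; rewrite (label_lt_total h2 h1 (ltn_ord j)).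
exact: leq_total.
Qed.

Lemma label_le_trans : transitive label_le.
Proof.
move=> y x z /orP[h1|/andP[/agree_dec a1 i1]] /orP[h2|/andP[/agree_dec a2 i2]].
- by rewrite /label_le (label_lt_trans h1 h2).
- by rewrite /label_le -(label_lt_agreer _ _ a2) h1.
- by rewrite /label_le (label_lt_agreel _ _ a1) h2.
rewrite /label_le (leq_trans i1 i2) andbT; apply/orP; right; apply/agree_dec => j.
by rewrite a1 a2.
Qed.

Let s' := sort label_le (enum [set: T]).

Lemma built_perm : s' \in permutations (enum [set: T]).
Proof. by rewrite mem_permutations perm_sort. Qed.

Lemma built_before x y : before s' x y -> label_le x y.
Proof.
have inS u : u \in s' by rewrite (mem_perms _ built_perm) inE.
apply: (sorted_ltn_index label_le_trans) => //.
exact: sort_sorted label_le_total _.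
Qed.

Lemma built_lt x y : label_lt g M x y -> before s' x y.
Proof.
move=> h; have ne : x != y by apply: contraTneq h => ->; rewrite label_lt_irr.
have inS u : u \in s' by rewrite (mem_perms _ built_perm) inE.
rewrite (before_total (x := y)) 1?eq_sym //; apply/negP => /built_before/orP[h'|/andP[h' _]].
  by move: (label_lt_trans h h'); rewrite label_lt_irr.
by apply: (label_lt_agreeF h); rewrite agreebC.
Qed.

Lemma built_cpt : compatible tau g s'.
Proof.
apply: compatibleI; first exact: uniq_perms built_perm.
move=> x y _ _ b; have ne : x != y by apply: contraTneq b => ->; rewrite before_irr.
have inS u : u \in s' by rewrite (mem_perms _ built_perm) inE.
have inF u : u \in fixset -> u \in s by rewrite (mem_perms _ hs).
case/orP: (built_before b) => [h|/andP[ag ind]].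
  (* Depth M+1 unfolds to the first label and a comparison of the images at depth M, which is the
     shape of [compat_step]. *)
  have : label_lt g M.+1 x y by apply: label_lt_mono.
  rewrite /= /chain /compat_step -val_eqE /image_before => /orP[->//|/andP[-> h']].
  apply/orP; right; apply/eqP.
  case: ifP h' => _ /built_lt; first by move->.
  by rewrite (before_total (x := tau x)) ?(inj_eq perm_inj) // => /negbTE->.
have [xF yF] := agree_fix ag ne.
have b' : before s x y.
  rewrite /before ltn_neqAle ind andbT; apply: contraNneq ne => e.
  by rewrite -(nth_index x (inF x xF)) e nth_index ?inF.
have := compatible_chain hc (inF _ xF) (inF _ yF) b'.
rewrite /chain /compat_step /image_before; move: (xF) (yF); rewrite !inE => /eqP-> /eqP->.
by rewrite b b'.
Qed.

(** Restriction to the fixed points undoes the construction, so distinct orders of the fixed points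
    extend to distinct orders of T. *)
Lemma built_filter : filter [in fixset] s' = s.
Proof.
have Us := uniq_perms hs; have Us' := uniq_perms built_perm.
have hf : filter [in fixset] s' \in permutations (enum fixset).
  exact: filter_perms (subsetT _) built_perm.
have inS u : u \in s' by rewrite (mem_perms _ built_perm) inE.
have imp x y : x \in fixset -> y \in fixset -> x != y -> before s' x y -> before s x y.
  move=> xF yF ne /built_before/orP[h|/andP[_]]; last first.
    rewrite leq_eqVlt => /orP[/eqP e|//]; case/eqP: ne.
    by rewrite -(nth_index x (_ : x \in s)) ?(mem_perms _ hs) // e nth_index ?(mem_perms _ hs).
  rewrite (compatible_beforeE invariant_fixset hs hc) //.
  have : label_lt g M.+1 x y by apply: label_lt_mono.
  rewrite /= /compat_step => /orP[->//|/andP[/eqP gxy _]].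
  case: (label_lt_agreeF h); apply/forallP => j.
  have itF i z : z \in fixset -> iter i tau z = z.
    by rewrite inE => /eqP tz; elim: i => //= i ->.
  by rewrite !itF // gxy.
apply: eq_before; first by rewrite filter_uniq.
  by move: hf hs; rewrite !mem_permutations => h1 /[1!perm_sym]; apply: perm_trans h1.
move=> x y; rewrite !mem_filter => /andP[xF _] /andP[yF _].
rewrite before_filter //; have [->|ne] := eqVneq x y; first by rewrite !before_irr.
apply/idP/idP; first exact: imp.
apply: contraTT; rewrite -!before_total ?(mem_perms _ hs) //.
by apply: imp; rewrite 1?eq_sym.
Qed.
End Build.

Lemma orders_generic g : (forall x y, x \notin fixset -> x != y -> ~~ agreeb g x y) ->
  orders tau fixset g <= orders tau [set: T] g.
Proof.
move=> gen; rewrite /orders -!size_filter.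
rewrite -(size_map (filter [in fixset]) [seq s <- permutations (enum [set: T]) | compatible tau g s]).
apply: uniq_leq_size; first by rewrite filter_uniq ?permutations_uniq.
move=> s; rewrite mem_filter => /andP[hc hs].
rewrite -(built_filter hs hc); apply: map_f.
by rewrite mem_filter built_cpt // built_perm.
Qed.

(** Only the equations g x = g y and g (tau x) = g (tau y) are used. For y = tau x they may
    coincide, as in a 2-cycle, and only the first is kept; this loses a factor L. *)
Lemma sum_orders_agree x y : x \notin fixset -> x != y ->
  L ^ 2 * (\sum_(g : {ffun T -> 'I_L} | agreeb g x y) orders tau fixset g)
  <= (1 + L * (y == tau x)) * \sum_g orders (L := L) tau fixset g.
Proof.
move=> xF nxy.
have tx : tau x != x by move: xF; rewrite inE.
have txF : tau x \notin fixset by rewrite inE (inj_eq perm_inj).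
have ag1 g i : agreeb g x y -> g (iter i tau x) == g (iter i tau y) by move/agree_dec->.
have sub (P Q : pred {ffun T -> 'I_L}) : (forall g, P g -> Q g) ->
    \sum_(g | P g) orders tau fixset g <= \sum_(g | Q g) orders tau fixset g.
  move=> h; rewrite big_mkcond [leqRHS]big_mkcond; apply: leq_sum => g _.
  by case: (boolP (P g)) => [/h->|].
have [yE|ny] := eqVneq y (tau x).
  rewrite muln1 mulnDl mul1n; apply: leq_trans (leq_addl _ _).
  rewrite expnS expn1 -mulnA leq_mul2l; apply/orP; right.
  rewrite -(resample (orders_indep tau xF) (indep_coord (_ : y != x))) 1?eq_sym //.
  by rewrite leq_mul2l sub ?orbT // => g ag; apply: (ag1 g 0 ag).
rewrite muln0 addn0 mul1n.
have nyx : y != x by rewrite eq_sym.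
have tytx : tau y != tau x by rewrite (inj_eq perm_inj).
have [tyE|nty] := eqVneq (tau y) x; last first.
  rewrite -(resample2 (orders_indep tau xF) (orders_indep tau txF) nyx tytx tx nty).
  rewrite leq_mul2l sub ?orbT // => g ag; apply/andP; split.
    exact: (ag1 g 0 ag).
  exact: (ag1 g 1 ag).
have xtx : x != tau x by rewrite eq_sym.
(* Here tau y = x, so the second equation involves the label of x; therefore tau x is resampled
   before x. *)
rewrite -(resample2 (orders_indep tau txF) (orders_indep tau xF) xtx nyx xtx ny).
rewrite leq_mul2l sub ?orbT // => g ag; apply/andP; split.
  by have := ag1 g 1 ag; rewrite /= tyE.
exact: (ag1 g 0 ag).
Qed.

(** Union bound over the agreeing pairs (x, y) with x moved; for each x the partner y = tau x is
    responsible for the summand L. *)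
Lemma sum_orders_ge :
  L ^ 2 * (\sum_g orders (L := L) tau fixset g)
  <= L ^ 2 * (\sum_g orders (L := L) tau [set: T] g)
     + #|~: fixset| * (#|T| + L) * \sum_g orders (L := L) tau fixset g.
Proof.
set S := \sum_g orders tau fixset g.
have pt g : orders tau fixset g <= orders tau [set: T] g +
   \sum_(x in ~: fixset) \sum_(y | x != y) (if agreeb g x y then orders tau fixset g else 0).
  have [/existsP[x /existsP[y /and3P[xF ne ag]]]|nex] :=
     boolP [exists x, exists y, [&& x \notin fixset, x != y & agreeb g x y]].
    apply: leq_trans (leq_addl _ _).
    rewrite (bigD1 x) ?in_setC //= (bigD1 y) //= ag -addnA; exact: leq_addr.
  apply: leq_trans (orders_generic _) (leq_addr _ _) => x y xF ne.
  apply: contra nex => ag; apply/existsP; exists x; apply/existsP; exists y.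
  by rewrite xF ne.
have le : S <= \sum_g (orders tau [set: T] g +
   \sum_(x in ~: fixset) \sum_(y | x != y) (if agreeb g x y then orders tau fixset g else 0)).
  by apply: leq_sum => g _; apply: pt.
apply: leq_trans (leq_mul (leqnn _) le) _.
rewrite big_split /= mulnDr leq_add2l exchange_big /= big_distrr /=.
rewrite -mulnA -sum_nat_const; apply: leq_sum => x xF.
rewrite exchange_big /= big_distrr /=.
apply: (@leq_trans (\sum_y (1 + L * (y == tau x)) * S)).
  rewrite big_mkcond; apply: leq_sum => y _; case: ifP => // ne.
  by rewrite -big_mkcond; apply: sum_orders_agree => //; move: xF; rewrite in_setC.
rewrite -big_distrl /= leq_mul2r; apply/orP; right.
rewrite big_split /= sum1_card leq_add2l -big_distrr /= (bigD1 (tau x)) //= eqxx big1 ?addn0 ?muln1 //.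
by move=> y /negbTE->.
Qed.
End Lower.

(** * From orders to words of conjugates *)

Section Counts.
Variables (T : finType) (L : nat) (tau : {perm T}).
Implicit Types (g : {ffun T -> 'I_L}) (s : seq T) (A : {set T}).

Lemma sum_orders_swap A :
  \sum_g orders (L := L) tau A g
  = \sum_(s <- permutations (enum A)) #|[set g : {ffun T -> 'I_L} | compatible tau g s]|.
Proof.
rewrite (eq_bigr (fun g => \sum_(s <- permutations (enum A)) (compatible tau g s : nat))); last first.
  by move=> g _; rewrite /orders -sum1_count big_mkcond.
rewrite exchange_big; apply: eq_bigr => s _ /=.
by rewrite -sum1dep_card [RHS]big_mkcond.
Qed.

Definition order_ascent (x0 : T) s (i : nat) := image_before tau s (nth x0 s i) (nth x0 s i.+1).

Lemma count_compatible x0 s : uniq s -> 0 < size s ->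
  L ^ size s * #|[set g : {ffun T -> 'I_L} | compatible tau g s]|
  = L ^ #|T| * word_count (order_ascent x0 s) (size s).-1 L.
Proof.
case: s => [//|x s] Us _; rewrite /= -[RHS]/(_ * word_count (order_ascent x0 (x :: s)) (size s) L).
rewrite (@eq_word_count _ (fun i => image_before tau (x :: s) (nth x (x :: s) i) (nth x (x :: s) i.+1))); last first.
  by move=> i Hi; rewrite /order_ascent; congr image_before; apply: set_nth_default => //=; rewrite ltnS ltnW.
rewrite -(count_chain_lt (L := L)) //; congr muln; apply: eq_card => g.
by rewrite !inE ltn_ord andbT.
Qed.

(** On fixed points the order of the images is the order itself, so that every step is an ascent,
    whichever order is chosen. *)
Lemma sum_orders_fix :
  L ^ #|fixset tau| * (\sum_g orders (L := L) tau (fixset tau) g)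
  = (#|fixset tau|)`! * L ^ #|T| *
    (if #|fixset tau| is k.+1 then word_count (fun=> true) k L else 1).
Proof.
rewrite sum_orders_swap big_distrr /=.
rewrite (eq_big_seq (fun=> L ^ #|T| *
    (if #|fixset tau| is k.+1 then word_count (fun=> true) k L else 1))).
  rewrite big_const_seq count_predT size_permutations ?enum_uniq // -cardE.
  by rewrite iter_addn_0 mulnC mulnA.
move=> s hs; have sz := size_perms hs; rewrite -{1}sz.
case: s hs sz => [|x s] hs sz.
  have -> : [set g : {ffun T -> 'I_L} | compatible tau g [::]] = [set: {ffun T -> 'I_L}].
    by apply/setP => g; rewrite !inE.
  by rewrite -sz /= mul1n muln1 cardsT card_ffun card_ord.
rewrite (count_compatible x (uniq_perms hs)) // -sz /=; congr muln.
apply: eq_word_count => i Hi; rewrite /order_ascent /image_before.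
have fx y : y \in x :: s -> tau y = y by rewrite (mem_perms _ hs) inE => /eqP.
have m0 : nth x (x :: s) i \in x :: s by rewrite mem_nth //= ltnS ltnW.
have m1 : nth x (x :: s) i.+1 \in x :: s by rewrite mem_nth.
rewrite (fx _ m0) (fx _ m1).
have U := uniq_perms hs.
have H0 : i < size (x :: s) by apply: ltnW.
have H1 : i.+1 < size (x :: s) by [].
by rewrite /before (index_uniq _ H0 U) (index_uniq _ H1 U) ltnSn.
Qed.

Lemma sum_orders_full x0 : 0 < L ->
  \sum_g orders (L := L) tau [set: T] g
  = \sum_(s <- permutations (enum [set: T])) word_count (order_ascent x0 s) #|T|.-1 L.
Proof.
move=> L0; rewrite sum_orders_swap; apply: eq_big_seq => s hs.
have sz := size_perms hs; rewrite cardsT in sz.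
apply/eqP; rewrite -(eqn_pmul2l (_ : 0 < L ^ #|T|)) ?expn_gt0 ?L0 // -{1}sz.
rewrite (count_compatible x0 (uniq_perms hs)) ?sz //.
by apply/card_gt0P; exists x0.
Qed.
End Counts.

Definition ascent n (pi : 'S_n) (i : nat) : bool := Defs.pval pi i < Defs.pval pi i.+1.

Lemma pvalE n (pi : 'S_n) i (Hi : i < n) : Defs.pval pi i = pi (Ordinal Hi) :> nat.
Proof. by rewrite /Defs.pval insubT. Qed.

(** An order of [n] lists the values of a permutation. If sg is the inverse of that permutation, sg
    x is the rank of x, and tau read along the order is the word of [tau ^ sg]. *)
Lemma sum_orders_perm n (L : nat) (tau : 'S_n) : 0 < n -> 0 < L ->
  \sum_g orders (L := L) tau [set: 'I_n] g = \sum_(sg : 'S_n) word_count (ascent (tau ^ sg)%g) n.-1 L.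
Proof.
move=> n0 L0; rewrite (sum_orders_full tau (Ordinal n0) L0) card_ord.
pose lst (sg : 'S_n) := [seq sg i | i <- enum 'I_n].
have nthl sg i (Hi : i < n) : nth (Ordinal n0) (lst sg) i = sg (Ordinal Hi).
  rewrite (nth_map (Ordinal n0)) ?size_enum_ord //; congr (sg _); apply: val_inj.
  by rewrite /= nth_enum_ord.
have Ul sg : uniq (lst sg) by rewrite map_inj_uniq ?enum_uniq //; apply: perm_inj.
have pe : perm_eq (permutations (enum [set: 'I_n])) [seq lst sg | sg <- enum 'S_n].
  apply: uniq_perm; first exact: permutations_uniq.
    rewrite map_inj_uniq ?enum_uniq // => s t h; apply/permP => i.
    by case: i => i Hi; rewrite -!nthl h.
  move=> s; apply/idP/mapP => [hs|[sg _ ->]]; last first.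
    rewrite mem_permutations; apply: uniq_perm; rewrite ?enum_uniq // => x.
    rewrite mem_enum inE; apply/mapP; exists ((sg^-1)%g x); rewrite ?mem_enum //.
    by rewrite permKV.
  have Us := uniq_perms hs; have sz := size_perms hs; rewrite cardsT card_ord in sz.
  have inj : injective (fun i : 'I_n => nth (Ordinal n0) s i).
    by move=> i j /eqP; rewrite nth_uniq ?sz // => /eqP/val_inj.
  exists (perm inj); first by rewrite mem_enum.
  apply: (@eq_from_nth _ (Ordinal n0)); first by rewrite size_map size_enum_ord.
  by move=> i; rewrite sz => Hi; rewrite nthl permE.
rewrite (perm_big _ pe) big_map big_enum /= (reindex_inj invg_inj) /=.
apply: eq_bigr => sg _; apply: eq_word_count => i Hi.
have Hi1 : i.+1 < n by rewrite -(prednK n0) ltnS.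
have idx x : index x (lst (sg^-1)%g) = sg x.
  rewrite -[x in LHS](permK sg) (index_map (@perm_inj _ _)).
  by rewrite index_enum_ord.
rewrite /order_ascent /image_before /before !idx (nthl _ _ (ltnW Hi1)) (nthl _ _ Hi1) /ascent.
rewrite (pvalE _ (ltnW Hi1)) (pvalE _ Hi1) /conjg !permM.
by [].
Qed.

(** * Peaks, and the words of an increasing pattern *)

Fixpoint peak_count (asc : nat -> bool) (k : nat) : nat :=
  if k is k'.+1 then peak_count asc k' + ((0 < k') && asc k'.-1 && ~~ asc k') else 0.

Lemma peaksE n (pi : 'S_n) : peaks pi = peak_count (ascent pi) n.-1.
Proof.
case: n pi => [|n] pi; first by [].
have gen k : k <= n -> count (is_peak pi) (iota 0 k) = peak_count (ascent pi) k.
  elim: k => [//|k IH] kn; rewrite -[k.+1]addn1 iotaD count_cat IH 1?ltnW //= addn1 /=.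
  congr addn; rewrite addn0 add0n /is_peak; case: k kn {IH} => [//|k] kn /=.
  rewrite ltnS kn /= /ascent; congr (nat_of_bool (_ && _)).
  rewrite -leqNgt ltn_neqAle andb_idl // => _.
  rewrite (pvalE _ (ltn_trans kn (ltnSn n))) (pvalE _ (kn : k.+2 < n.+1)).
  rewrite val_eqE (inj_eq perm_inj) -val_eqE /=.
  by rewrite neq_ltn ltnSn orbT.
have -> : peaks pi = count (is_peak pi) (iota 0 (n + 1)) by rewrite /peaks addn1.
by rewrite iotaD count_cat gen //= /is_peak add0n ltnn /= andbF !addn0.
Qed.

(* The coefficient of x^m in ((1 + x) / (1 - x))^a, i.e. the number of points of
   l1-norm m in Z^a. *)
Fixpoint sphere_count (m a : nat) : nat :=
  if m is m'.+1 then \sum_(v < a) (sphere_count m' v + sphere_count m' v.+1) else 1.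

Lemma sphere_countS m a : sphere_count m.+1 a.+1 = sphere_count m.+1 a + (sphere_count m a + sphere_count m a.+1).
Proof. by rewrite /= big_ord_recr. Qed.

Lemma sphere_count0 m : sphere_count m.+1 0 = 0. Proof. by rewrite /= big_ord0. Qed.

Lemma word_countS asc k j : word_count asc k.+1 j.+1 = word_count asc k.+1 j + word_count asc k (j + (odd j == asc k)).
Proof. by rewrite /= big_ord_recr. Qed.

Lemma word_count0 asc k : word_count asc k 0 = 0.
Proof. by case: k => //= k; rewrite big_ord0. Qed.

(** At ascents only odd letters may be repeated. The letters 2v and 2v+1 thus leave the bounds 2v
    and 2(v+1) to the letter before them, which is the recursion of [sphere_count]. *)
Lemma word_count_true k a : word_count (fun=> true) k (2 * a) = sphere_count k.+1 a.
Proof.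
elim: k a => [|k IH] a; first by rewrite /= sum_nat_const card_ord mulnC.
elim: a => [|a IHa]; first by rewrite muln0 word_count0 sphere_count0.
rewrite mulnS !addSn add0n word_countS word_countS IHa sphere_countS -addnA; congr addn.
rewrite -!IH; have o : odd (2 * a) = false by rewrite oddM.
by congr (word_count _ _ _ + word_count _ _ _); rewrite /= ?add0n o /=; lia.
Qed.

(* Coefficients of (1 - x^2) F' = 2 a F for F = ((1 + x) / (1 - x))^a. *)
Lemma sphere_count_rec m a : m.+2 * sphere_count m.+2 a = 2 * a * sphere_count m.+1 a + m * sphere_count m a.
Proof.
elim: a m => [|a IH] m.
  by rewrite !sphere_count0 !muln0 add0n; case: m => // m; rewrite sphere_count0 muln0.
elim: m => [|m IHm].
  have := IH 0; rewrite !sphere_countS; have -> : sphere_count 0 a = 1 by []. have -> : sphere_count 0 a.+1 = 1 by [].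
  have -> : sphere_count 1 a = 2 * a by rewrite /= sum_nat_const card_ord mulnC.
  nia.
have := IH m.+1; have := IH m; move: IHm; rewrite !sphere_countS.
move: (sphere_count m.+3 a) (sphere_count m.+2 a) (sphere_count m.+1 a) (sphere_count m a) (sphere_count m a.+1) => c3 c2 c1 c0 d0.
by clear; nia.
Qed.

Lemma geq_total : total geq. Proof. by move=> x y; apply: leq_total. Qed.
Lemma geq_trans : transitive geq. Proof. by move=> y x z /= h1 h2; apply: leq_trans h2 h1. Qed.
Lemma geq_anti : antisymmetric geq. Proof. by move=> x y /= h; apply/eqP; rewrite eqn_leq andbC. Qed.

(** * Cycle types and conjugacy classes *)

Section CycleType.
Variable n : nat.
Implicit Types (pi sg : 'S_n).

Lemma porbit_conjg pi sg x : porbit (pi ^ sg)%g (sg x) = [set sg y | y in porbit pi x].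
Proof.
have it j : iter j (pi ^ sg)%g (sg x) = sg (iter j pi x).
  elim: j => //= j ->; by rewrite /conjg !permM permK.
apply/setP => y; apply/idP/imsetP => [/porbit_iter[j ->]|[z /porbit_iter[j ->] ->]].
  by rewrite it; exists (iter j pi x) => //; apply: iter_in_porbit.
by rewrite -it iter_in_porbit.
Qed.

Lemma cycle_type_conj pi sg : cycle_type (pi ^ sg)%g = cycle_type pi.
Proof.
apply/(perm_sortP geq_total geq_trans geq_anti).
have inj : injective (fun X : {set 'I_n} => [set sg y | y in X]) by apply/imset_inj/perm_inj.
rewrite (_ : map (fun X => #|pred_of_set X|) (enum (porbits pi)) =
  map (fun X : {set 'I_n} => #|X|) [seq [set sg y | y in X] | X : {set 'I_n} <- enum (porbits pi)]); last first.
  by rewrite -map_comp; apply: eq_map => X /=; rewrite card_imset //; apply: perm_inj.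
apply: perm_map; apply: uniq_perm; rewrite ?enum_uniq ?map_inj_uniq ?enum_uniq //.
move=> Y; rewrite mem_enum; apply/imsetP/mapP => [[x _ ->]|[X]].
  exists (porbit pi ((sg^-1)%g x)); last by rewrite -porbit_conjg permKV.
  by rewrite mem_enum imset_f.
by rewrite mem_enum => /imsetP[x _ ->] ->; exists (sg x); rewrite // porbit_conjg.
Qed.

Lemma conj_class_conj lam pi sg : ((pi ^ sg)%g \in conj_class n lam) = (pi \in conj_class n lam).
Proof. by rewrite !inE cycle_type_conj. Qed.

Lemma fixset_card pi : #|fixset pi| = mult_part (cycle_type pi) 1.
Proof.
have -> : mult_part (cycle_type pi) 1 = #|[set X in porbits pi | #|X| == 1]|.
  rewrite /mult_part /cycle_type (seq.permP (permEl (perm_sort geq _))) count_map.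
  by rewrite -sum1_count big_enum_cond /= sum1dep_card.
rewrite -(card_imset _ (@set1_inj _)); apply: eq_card => X.
rewrite !inE; apply/imsetP/andP => [[x + ->]|[/imsetP[x _ ->] /cards1P[y e]]].
  rewrite inE => /eqP fx; rewrite cards1; split=> //; apply/imsetP; exists x => //.
  apply/setP => y; rewrite inE; apply/eqP/idP => [->|/porbit_iter[j ->]].
    exact: porbit_id.
  by elim: j => //= j ->.
have xy : x = y by apply/set1P; rewrite -e porbit_id.
exists x; last by rewrite e xy.
rewrite inE; apply/eqP; rewrite [RHS]xy; apply/set1P; rewrite -e.
exact: (iter_in_porbit pi 1).
Qed.

(** Without this the expectation could be the default value 0 / 0 = 0. *)
Lemma conj_class_neq0 lam : is_partition n lam -> exists pi, pi \in conj_class n lam.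
Proof.
case/and3P => srt pos /eqP sm.
(* [n] is cut into consecutive blocks of sizes lam, which pi rotates. *)
pose bs := reshape lam (enum 'I_n).
have fl : flatten bs = enum 'I_n by apply: reshapeKr; rewrite size_enum_ord sm.
have sh : shape bs = lam by apply: reshapeKl; rewrite size_enum_ord sm.
have Ufl : uniq (flatten bs) by rewrite fl enum_uniq.
pose blk (x : 'I_n) := nth [::] bs (find (fun b => x \in b) bs).
have hasx x : has (fun b => x \in b) bs.
  have : x \in flatten bs by rewrite fl mem_enum.
  by case/flattenP => b bb xb; apply/hasP; exists b.
have xblk x : x \in blk x by apply: (@nth_find _ [::] (fun b => x \in b)).
have blk_in x : blk x \in bs by rewrite mem_nth // -has_find.
have same : forall b b' x, b \in bs -> b' \in bs -> x \in b -> x \in b' -> b = b'.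
  move: Ufl; elim: (bs) => //= b0 bs0 IH; rewrite cat_uniq => /and3P[_ dj U] b b' x.
  rewrite !inE => /orP[/eqP->|b1] /orP[/eqP->|b2] // xb xb'; last exact: IH xb xb'.
    by case/hasP: dj; exists x => //; apply/flattenP; exists b'.
  by case/hasP: dj; exists x => //; apply/flattenP; exists b.
have Ub b : b \in bs -> uniq b.
  move: Ufl; elim: (bs) => //= b0 bs0 IH; rewrite cat_uniq => /and3P[U0 _ U].
  by rewrite inE => /orP[/eqP->|/IH->].
have blkE b x : b \in bs -> x \in b -> blk x = b.
  by move=> bb xb; apply: (same _ _ x).
pose f x := next (blk x) x.
have fin x : f x \in blk x by rewrite mem_next.
have finj : injective f.
  move=> x y e; have bxy : blk x = blk y.
    by apply: (same _ _ (f x)) => //; rewrite e.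
  by move: e; rewrite /f bxy => /(can_inj (prev_next (Ub _ (blk_in y)))).
pose pi : 'S_n := perm finj.
exists pi; rewrite inE; apply/eqP.
have orb x : porbit pi x = [set y in blk x].
  have fc : fcycle pi (blk x).
    have -> : fcycle pi (blk x) = fcycle (next (blk x)) (blk x).
      case: (blk x) (blkE _ ^~ (blk_in x)) => //= z s h.
      apply: eq_path_in => u v us vs /=; rewrite permE /f h //.
        by move: us; rewrite -rcons_cons mem_rcons !inE orbA orbb.
    exact/cycle_next/Ub/blk_in.
  have con := fconnect_cycle fc (xblk x).
  apply/setP => y; rewrite inE -con; apply/idP/idP => [/porbit_iter[j ->]|/iter_findex <-].
    exact: fconnect_iter.
  exact: iter_in_porbit.
rewrite -(sorted_sort geq_trans srt); apply/(perm_sortP geq_total geq_trans geq_anti).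
rewrite -[X in perm_eq _ X]sh /shape.
have -> : map size bs = map (fun X : {set 'I_n} => #|X|) (map (fun b => [set y in b]) bs).
  rewrite -map_comp; apply/eq_in_map => b bb /=.
  by rewrite cardsE; apply/esym/card_uniqP/Ub.
apply: perm_map; apply: uniq_perm; rewrite ?enum_uniq //.
  have nb b : b \in bs -> exists x, x \in b.
    move=> bb; have : size b \in lam by rewrite -sh map_f.
    by move/(allP pos); case: (b) => // x s _; exists x; rewrite inE eqxx.
  rewrite map_inj_in_uniq.
    move: Ufl nb; elim: (bs) => //= b0 bs0 IH; rewrite cat_uniq => /and3P[U0 dj U] nb.
    rewrite IH // ?andbT; last by move=> b bb; apply: nb; rewrite inE bb orbT.
    apply/negP => b0i; case/hasP: dj; have [|x xb] := nb b0; first by rewrite inE eqxx.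
    by exists x => //; apply/flattenP; exists b0.
  move=> b b' bb bb' e; have [x xb] := nb b bb.
  have : x \in [set y in b] by rewrite inE.
  by rewrite e inE => xb'; apply: (same _ _ x).
move=> X; rewrite mem_enum; apply/imsetP/mapP => [[x _ ->]|[b bb ->]].
  by exists (blk x).
have : size b \in lam by rewrite -sh map_f.
move/(allP pos); case: b bb => // x s bb _; exists x => //.
by rewrite orb (blkE _ x bb) // inE eqxx.
Qed.
End CycleType.

From mathcomp Require Import all_order all_algebra.
From mathcomp Require Import all_classical all_reals all_analysis.
From mathcomp Require Import ring lra.
Import Order.TTheory GRing.Theory Num.Theory numFieldNormedType.Exports.
Local Open Scope classical_set_scope.
Local Open Scope ring_scope.

(** * Generating functions *)

Section GF.
Variable R : realType.
Implicit Types (u x : nat -> R) (t l : R).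

Definition gf u t l := series (fun v => u v * t ^+ v) @ \oo --> l.

Lemma gf_eq u x t l l' : u =1 x -> l = l' -> gf u t l -> gf x t l'.
Proof. by move=> /funext-> ->. Qed.

Lemma seriesS u n : series u n.+1 = series u n + u n.
Proof. by rewrite /series /= big_nat_recr. Qed.

Lemma series0 u : series u 0%N = 0.
Proof. by rewrite /series /= big_geq. Qed.

Lemma gfD u x t l l' : gf u t l -> gf x t l' -> gf (fun v => u v + x v) t (l + l').
Proof.
move=> h h'; rewrite /gf.
rewrite (_ : series (fun v => (u v + x v) * t ^+ v) =
  series (fun v => u v * t ^+ v) + series (fun v => x v * t ^+ v)); first exact: cvgD.
apply/funext; elim=> [|n IH]; first by rewrite /= fctE !series0 addr0.
by move: IH; rewrite /= !fctE !seriesS => ->; ring.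
Qed.

Lemma gfZ (c : R) u t l : gf u t l -> gf (fun v => c * u v) t (c * l).
Proof.
move=> h; rewrite /gf.
rewrite (_ : series (fun v => (c * u v) * t ^+ v) = c \*: series (fun v => u v * t ^+ v)); first exact: cvgZl_tmp.
apply/funext; elim=> [|n IH]; first by rewrite /= !series0 scaler0.
by move: IH; rewrite /= !seriesS => ->; rewrite scalerDr /GRing.scale /=; ring.
Qed.

Lemma gf_sum (I : Type) (r : seq I) (F : I -> nat -> R) (l : I -> R) t :
  (forall i, gf (F i) t (l i)) -> gf (fun v => \sum_(i <- r) F i v) t (\sum_(i <- r) l i).
Proof.
move=> h; elim: r => [|i r IH].
  rewrite big_nil /gf.
  rewrite (_ : series _ = fun=> 0); first exact: cvg_cst.
  apply/funext; elim => [|n IH]; first by rewrite series0.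
  by rewrite seriesS IH big_nil mul0r addr0.
rewrite big_cons; apply: gf_eq (gfD (h i) IH) => // v; by rewrite big_cons.
Qed.

Lemma gf_shift u t l : 0 < t -> gf u t l -> gf (fun v => u v.+1) t ((l - u 0%N) / t).
Proof.
move=> t0 h; rewrite /gf.
have e n : series (fun v => u v.+1 * t ^+ v) n = (series (fun v => u v * t ^+ v) n.+1 - u 0%N) / t.
  elim: n => [|n IH]; first by rewrite seriesS !series0 expr0; field; rewrite gt_eqF.
  rewrite seriesS IH [in RHS]seriesS [t ^+ n.+1]exprS; field; by rewrite gt_eqF.
rewrite (_ : series _ = fun n => (series (fun v => u v * t ^+ v) n.+1 - u 0%N) / t); last exact/funext.
apply: cvgMl; apply: cvgB; last exact: cvg_cst.
by rewrite (cvg_shiftS (series (fun v => u v * t ^+ v))).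
Qed.

Lemma gf_partial_le u t l n : 0 < t -> (forall v, 0 <= u v) -> gf u t l ->
  series (fun v => u v * t ^+ v) n <= l.
Proof.
move=> t0 u0 h; rewrite -(cvg_lim _ h) //.
apply: nondecreasing_cvgn_le; last by apply/cvg_ex; exists l.
apply/nondecreasing_seqP => k; rewrite seriesS lerDl mulr_ge0 // exprn_ge0 //; exact: ltW.
Qed.

Lemma gf_cvg_bounded u t B : 0 < t -> (forall v, 0 <= u v) ->
  (forall n, series (fun v => u v * t ^+ v) n <= B) -> exists l, gf u t l.
Proof.
move=> t0 u0 hB; suff : cvgn (series (fun v => u v * t ^+ v)) by move/cvg_ex.
apply: nondecreasing_is_cvgn.
  apply/nondecreasing_seqP => k; rewrite seriesS lerDl mulr_ge0 // exprn_ge0 //; exact: ltW.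
by exists B => _ [n _ <-].
Qed.

(** Partial summation multiplies a generating function by 1/(1-t). The identity [e] for finite sums
    bounds them, so the series of u converges; then the boundary term of [e] tends to 0. *)
Lemma gf_acc u x t l : 0 < t < 1 -> 0 <= u 0%N -> (forall v, 0 <= x v) ->
  (forall v, u v.+1 = u v + x v) -> gf x t l -> gf u t ((u 0%N + t * l) / (1 - t)).
Proof.
case/andP=> t0 t1 u00 x0 uS hx.
have u0 v : 0 <= u v by elim: v => // v IH; rewrite uS addr_ge0.
have t1' : 0 < 1 - t by rewrite subr_gt0.
have e n : series (fun v => u v * t ^+ v) n.+1 * (1 - t) + t * (u n * t ^+ n) =
   u 0%N + t * series (fun v => x v * t ^+ v) n.
  elim: n => [|n IH]; first by rewrite !seriesS !series0 expr0; ring.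
  rewrite seriesS (seriesS (fun v => x v * t ^+ v)).
  transitivity ((u 0%N + t * series (fun v => x v * t ^+ v) n) + t * (x n * t ^+ n)); last by ring.
  rewrite -IH uS [t ^+ n.+1]exprS; ring.
have tn0 n : 0 <= t ^+ n by rewrite exprn_ge0 // ltW.
have [L hL] : exists L, gf u t L.
  apply: (@gf_cvg_bounded _ _ ((u 0%N + t * l) / (1 - t))) => // n.
  apply: (@le_trans _ _ (series (fun v => u v * t ^+ v) n.+1)).
    by rewrite seriesS lerDl mulr_ge0.
  rewrite ler_pdivlMr // -(lerD2r (t * (u n * t ^+ n))) e.
  rewrite -[leLHS]addr0 lerD ?mulr_ge0 //; last exact: ltW.
  rewrite lerD2l ler_pM2l //; exact: gf_partial_le.
have c0 : (fun n => u n * t ^+ n) @ \oo --> 0 by apply: cvg_series_cvg_0; apply/cvg_ex; exists L.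
rewrite /gf -(cvg_shiftS (series (fun v => u v * t ^+ v))).
rewrite (_ : [sequence _]_n = fun n => (u 0%N + t * series (fun v => x v * t ^+ v) n - t * (u n * t ^+ n)) / (1 - t)).
  apply: cvgMl; rewrite -[X in _ --> X]subr0 -[X in _ - X](mulr0 t).
  apply: cvgB; last exact: cvgMr.
  by apply: cvgD; [exact: cvg_cst|exact: cvgMr].
by apply/funext => n; rewrite /= -e addrK mulfK // gt_eqF.
Qed.

End GF.

Lemma gf_accE (R : realType) (u x : nat -> R) (t l l' : R) : 0 < t < 1 -> gf x t l ->
  0 <= u 0%N -> (forall v, 0 <= x v) -> (forall v, u v.+1 = u v + x v) ->
  l' = (u 0%N + t * l) / (1 - t) -> gf u t l'.
Proof. by move=> t01 hx u0 x0 uS ->; apply: gf_acc. Qed.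

(** * The generating function of the words compatible with one pattern *)

Section PeakGF.
Variable R : realType.
Variables (t : R) (t01 : 0 < t < 1).

Let t0 : 0 < t. Proof. by case/andP: t01. Qed.
Let t1 : 0 < 1 - t. Proof. by rewrite subr_gt0; case/andP: t01. Qed.
Let tp : 0 < 1 + t. Proof. by rewrite addr_gt0. Qed.
Let zr : R := (1 + t) / (1 - t).
Let wr : R := 4 * t / (1 + t) ^+ 2.

Lemma gf_const (c : R) : 0 <= c -> gf (fun=> c) t (c / (1 - t)).
Proof.
move=> c0; have z : gf (fun=> 0 : R) t 0.
  rewrite /gf (_ : series _ = fun=> 0); first exact: cvg_cst.
  by apply/funext; elim => [|n IH]; rewrite ?series0 // seriesS IH mul0r addr0.
have := @gf_acc R (fun=> c) (fun=> 0) t 0 t01 c0 (fun=> lexx 0) (fun=> esym (addr0 c)) z.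
by rewrite mulr0 addr0.
Qed.

Local Arguments word_count : simpl never.

(** Odd cut-offs are carried along to close the induction. Their quotient by the even ones is
    2/(1+t) after an ascent and (1+t)/(2t) otherwise. Each step contributes a factor z; a descent
    right after an ascent also contributes the ratio of these quotients, 4t/(1+t)^2 = w, which is
    the peak. *)
Lemma gf_peak (asc : nat -> bool) k :
  let H := 2^-1 * zr ^+ k.+2 * wr ^+ (peak_count asc k).+1 in
  gf (fun v => (word_count asc k (2 * v))%:R) t H /\
  gf (fun v => (word_count asc k (2 * v).+1)%:R) t
     (if (0 < k)%N && asc k.-1 then 2 / (1 + t) * H else (1 + t) / (2 * t) * H).
Proof.
have nt0 : t != 0 by rewrite gt_eqF.
have nt1 : 1 - t != 0 by rewrite gt_eqF.
have ntp : 1 + t != 0 by rewrite gt_eqF.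
elim: k => [|k [IHh IHl]] /=.
  have c2 := gf_const (ler0n R 2).
  split; apply: (gf_accE t01 c2) => //=.
  - by move=> v; rewrite /word_count mulnS natrD addrC.
  - by rewrite /word_count ?muln0 ?mul0n /zr /wr; field; rewrite nt1 ntp.
  - by move=> v; rewrite /word_count mulnS -addnS natrD addrC.
  - by rewrite /word_count ?muln0 ?mul0n /zr /wr; field; rewrite nt0 nt1 ntp.
set H := 2^-1 * zr ^+ k.+2 * wr ^+ (peak_count asc k).+1 in IHh IHl.
have ev v : odd (2 * v) = false by rewrite oddM.
have IHh' := gf_shift t0 IHh; rewrite muln0 word_count0 subr0 in IHh'.
have IHl' := gf_shift t0 IHl; rewrite muln0 in IHl'.
have hS v : word_count asc k.+1 (2 * v.+1) = (word_count asc k.+1 (2 * v) +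
   (if asc k then word_count asc k (2 * v) + word_count asc k (2 * v.+1) else 2 * word_count asc k (2 * v).+1))%N.
  rewrite [in LHS]mulnS [in LHS]addSn add1n word_countS word_countS /= ev /= -addnA; congr addn.
  case: (asc k); rewrite /= ?addn0 ?addn1 ?mulnS ?addSn ?add0n; lia.
have lS v : word_count asc k.+1 (2 * v.+1).+1 = (word_count asc k.+1 (2 * v).+1 +
   (if asc k then 2 * word_count asc k (2 * v.+1) else word_count asc k (2 * v).+1 + word_count asc k (2 * v.+1).+1))%N.
  rewrite [in LHS]mulnS [in LHS]addSn add1n word_countS word_countS /= ev /= -addnA; congr addn.
  case: (asc k); rewrite /= ?addn0 ?addn1 ?mulnS ?addSn ?add0n; lia.
have l0 : word_count asc k.+1 1 = if asc k then 0%N else word_count asc k 1.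
  by rewrite word_countS word_count0 /=; case: (asc k) => /=; rewrite ?word_count0.
have HE1 : 2^-1 * zr ^+ k.+3 * wr ^+ (peak_count asc k).+1 = zr * H by rewrite /H !exprS; ring.
have HE2 : 2^-1 * zr ^+ k.+3 * wr ^+ (peak_count asc k).+2 = zr * wr * H by rewrite /H !exprS; ring.
case ak: (asc k) in hS lS l0 *; rewrite /= ?andbF ?andbT ?addn0 ?HE1.
- split; [apply: (gf_accE t01 (gfD IHh IHh'))|apply: (gf_accE t01 (gfZ (c := 2) IHh'))].
  + by [].
  + by move=> v; rewrite addr_ge0.
  + by move=> v; rewrite hS !natrD.
  + by rewrite muln0 word_count0 /zr; field; rewrite nt0 nt1.
  + by [].
  + by move=> v; rewrite mulr_ge0.
  + by move=> v; rewrite lS natrD natrM.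
  + by rewrite muln0 l0 /zr; field; rewrite nt0 nt1 ntp.
split; [apply: (gf_accE t01 (gfZ (c := 2) IHl))|apply: (gf_accE t01 (gfD IHl IHl'))].
- by [].
- by move=> v; rewrite mulr_ge0.
- by move=> v; rewrite hS natrD natrM.
- rewrite muln0 word_count0; case: ifP => _; rewrite ?addn1 ?addn0 ?HE1 ?HE2 /zr /wr; field; rewrite ?nt0 ?nt1 ?ntp //.
- by [].
- by move=> v; rewrite addr_ge0.
- by move=> v; rewrite lS !natrD.
- rewrite muln0 l0; case: ifP => _; rewrite ?addn1 ?addn0 ?HE1 ?HE2 /zr /wr; field; rewrite ?nt0 ?nt1 ?ntp //.
Qed.

End PeakGF.

(** * Sub- and supersolutions of the recursion *)

Section Calculus.
Variable R : realType.
Implicit Types (f df : R -> R) (a b x : R).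

Lemma MVT_global f df a b : a <= b ->
  (forall x, a <= x <= b -> is_derive x 1 f (df x)) ->
  exists2 c, a <= c <= b & f b - f a = df c * (b - a).
Proof.
move=> ab hd.
have [||c cab e] := @MVT_segment R f df a b ab.
- by move=> x; rewrite in_itv /= => /andP[h1 h2]; apply: hd; rewrite !ltW.
- apply: derivable_within_continuous => x; rewrite in_itv /= => /hd h.
  exact: ex_derive.
by exists c => //; move: cab; rewrite in_itv.
Qed.

Lemma le_of_derive f df a b : a <= b ->
  (forall x, a <= x <= b -> is_derive x 1 f (df x)) ->
  (forall x, a <= x <= b -> 0 <= df x) -> f a <= f b.
Proof.
move=> ab hd h0; have [c cab e] := MVT_global ab hd.
by rewrite -subr_ge0 e mulr_ge0 ?h0 // subr_ge0.
Qed.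

Lemma is_derive_expN x : is_derive x 1 (fun y : R => expR (- y)) (- expR (- x)).
Proof.
have h : is_derive x 1 (fun y : R => - y) (-1) by apply: is_derive_eq.
have := is_derive1_comp (is_derive_expR (- x)) h.
by move=> h'; apply: is_derive_eq h' _; rewrite mulrN1.
Qed.

Lemma expR_ge2 x : 0 <= x -> 1 + x + x ^+ 2 / 2 <= expR x.
Proof.
move=> x0; rewrite -subr_ge0.
have := @le_of_derive (fun y => expR y - (1 + y + y ^+ 2 / 2)) (fun y => expR y - (1 + y)) 0 x x0.
rewrite expR0 expr0n /= mul0r !addr0 subrr; apply.
  by move=> y _; apply: is_derive_eq; rewrite /GRing.scale /=; field.
by move=> y _; rewrite subr_ge0 expR_ge1Dx.
Qed.

Lemma expRN_le2 x : 0 <= x -> expR (- x) <= 1 - x + x ^+ 2 / 2.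
Proof.
move=> x0; rewrite -subr_ge0.
have := @le_of_derive (fun y => 1 - y + y ^+ 2 / 2 - expR (- y)) (fun y => - 1 + y + expR (- y)) 0 x x0.
rewrite expr0n /= !(oppr0, expR0, addr0, mul0r, subrr, subr0); apply.
  move=> y _; have := is_derive_expN y => h.
  by apply: is_derive_eq; rewrite /GRing.scale /=; field.
by move=> y _; have := expR_ge1Dx (- y); lra.
Qed.

Lemma expRN_ge3 x : 0 <= x -> 1 - x + x ^+ 2 / 2 - x ^+ 3 / 6 <= expR (- x).
Proof.
move=> x0; rewrite -subr_ge0.
have := @le_of_derive (fun y => expR (- y) - (1 - y + y ^+ 2 / 2 - y ^+ 3 / 6))
  (fun y => 1 - y + y ^+ 2 / 2 - expR (- y)) 0 x x0.
rewrite !expr0n /= !(oppr0, expR0, addr0, mul0r, subrr, subr0); apply.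
  move=> y _; have := is_derive_expN y => h.
  by apply: is_derive_eq; rewrite /GRing.scale /=; field.
by move=> y /andP[y0 _]; have := expRN_le2 y0; lra.
Qed.

(** Invert the cubic lower bound for e^(-x). *)
Lemma expR_le3 x : 0 <= x <= 1/2 -> expR x <= 1 + x + x ^+ 2 / 2 + x ^+ 3.
Proof.
case/andP=> x0 x1; set p := 1 - x + x ^+ 2 / 2 - x ^+ 3 / 6.
have p0 : 0 < p by rewrite /p !exprS expr0; nra.
have h := expRN_ge3 x0; rewrite -/p in h.
have e : expR x * expR (- x) = 1 by rewrite -expRD subrr expR0.
have : expR x * p <= 1 by rewrite -e ler_pM2l // expR_gt0.
rewrite -ler_pdivlMr // => /le_trans; apply; rewrite ler_pdivrMr //.
have -> : (1 + x + x ^+ 2 / 2 + x ^+ 3) * p =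
  1 + x ^+ 3 * (5/6 - 11/12 * x + 5/12 * x ^+ 2 - x ^+ 3 / 6) by rewrite /p; field.
have : 0 <= x ^+ 3 by rewrite exprn_ge0.
have : 0 <= 5/6 - 11/12 * x + 5/12 * x ^+ 2 - x ^+ 3 / 6 by rewrite !exprS expr0; nra.
nra.
Qed.

Lemma expR_le_quad x : - (1/2) <= x <= 1/2 -> expR x <= 1 + x + x ^+ 2.
Proof.
case/andP=> x0 x1; have [h|h] := leP 0 x.
  have := @expR_le3 x; rewrite h x1 => /(_ isT)/le_trans; apply.
  by rewrite !exprS expr0; nra.
have := @expRN_le2 (- x); rewrite opprK => /(_ _)/le_trans; apply; first by lra.
by rewrite !exprS expr0; nra.
Qed.

End Calculus.

Section Step.
Variable R : realType.
Implicit Types a h B D x k : R.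

Lemma powers_le a B h : 0 <= a <= 1 -> 0 < B <= 1/100/100 -> 0 <= h <= 1 ->
  [/\ 0 <= B * a ^+ 2 <= B, 0 <= B ^+ 2 * a ^+ 5 <= B ^+ 2 * a ^+ 4,
      B ^+ 2 * a ^+ 4 <= B ^+ 2, 0 <= B * a ^+ 3 <= B * a ^+ 2 &
      [/\ 0 <= B * h <= B, 0 < B ^+ 2 <= 1/100/100 * B & 0 < B ^+ 3 <= 1/100/100 * B ^+ 2]].
Proof.
move=> /andP[a0 a1] /andP[B0 B1] /andP[h0 h1].
have le1 n : a ^+ n.+1 <= a ^+ n by rewrite exprS ler_piMl ?exprn_ge0.
have ge0 n : 0 <= a ^+ n by apply: exprn_ge0.
have B20 : 0 < B ^+ 2 by rewrite exprn_gt0.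
have a2 : a ^+ 2 <= 1 by apply: exprn_ile1.
have a4 : a ^+ 4 <= 1 by apply: exprn_ile1.
have Bw := ltW B0; have B2w := ltW B20.
split.
- by rewrite mulr_ge0 //= ler_piMr.
- by rewrite mulr_ge0 //= ler_wpM2l.
- by rewrite ler_piMr.
- by rewrite mulr_ge0 //= ler_wpM2l.
split.
- by apply/andP; split; nra.
- by apply/andP; split; rewrite // expr2; nra.
by rewrite exprn_gt0 //= exprS; nra.
Qed.

(* For a = (m+1)/n, h = 1/n and B = b^2, D is the increment of Phi from (m+1, n) to
   (m+2, n) and x the one from (m+1, n) to (m, n-2); k is the coefficient of the
   recursion. *)
Lemma step_up a h B D x k : 0 <= a <= 1 -> 0 <= h <= 1 -> 0 < B <= 1/100/100 ->
  B * a ^+ 2 - 3/2 * (B ^+ 2 * a ^+ 4) + 4/3 * (B ^+ 2 * a ^+ 5) - 8 * B ^+ 2 * h <= D ->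
  x <= - (B * a ^+ 2) + 4/3 * (B * a ^+ 3) + (31 * 100) * (B * h) + 200 * B ^+ 2 ->
  0 <= k <= B * a ^+ 2 ->
  1 + k * expR x <= expR (D + 500 * (B * h) + 500 * B ^+ 3).
Proof.
move=> ha hh hB hD hx /andP[k0 k1].
have [/andP[p1 p2] /andP[p3 p4] p5 /andP[p6 p7] [/andP[p8 p9] /andP[p10 p11] /andP[p12 p13]]] := powers_le ha hB hh.
have [/andP[a0 a1] /andP[B0 B1] /andP[h0 h1]] := And3 ha hB hh.
set X := - _ + _ + _ + _ in hx.
have X1 : X <= 1/2 by rewrite /X; clear - p1 p2 p6 p7 p8 p9 p10 p11 B1 B0; lra.
have X0 : - (1/2) <= X by rewrite /X; clear - p1 p2 p6 p7 p8 p9 p10 p11 B1 B0; lra.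
have eX : expR x <= 1 + X + X ^+ 2.
  apply: (@le_trans _ _ (expR X)); first by rewrite ler_expR.
  by apply: expR_le_quad; rewrite X0 X1.
set A2 := B * a ^+ 2 in p1 p2 p7 hD k1 X X1 X0 hx eX *.
set A4 := B ^+ 2 * a ^+ 4 in p4 p5 hD *.
set A5 := B ^+ 2 * a ^+ 5 in p3 p4 hD *.
set H := B * h in p8 p9 X X1 X0 hx eX *.
set T := B ^+ 3 in p12 p13 *.
have kE : k * expR x <= A2 * (1 + X + X ^+ 2).
  by apply: ler_pM => //; exact: expR_ge0.
have B2H : B ^+ 2 * h <= 1/100/100 * H by rewrite /H expr2 -mulrA ler_wpM2r.
have B2h0 : 0 <= B ^+ 2 * h by rewrite mulr_ge0 // ltW.
have A2X : A2 * X = - A4 + 4/3 * A5 + (31 * 100) * (A2 * H) + 200 * (A2 * B ^+ 2).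
  by rewrite /X /A2 /A4 /A5; ring.
have A2H : A2 * H <= 1/100/100 * H by rewrite ler_wpM2r //; clear - p2 B1; lra.
have A2B2 : A2 * B ^+ 2 <= T by rewrite /T exprS ler_pM2r.
(* X is O(B), so this product is of third order and fits into the slack; X is split as Y + Z to keep
   the large coefficients apart from the main part. *)
have A2X2 : A2 * X ^+ 2 <= H + 20 * T.
  have X1' : X = (- A2 + 4/3 * (B * a ^+ 3)) + ((31 * 100) * H + 200 * B ^+ 2) by rewrite /X; ring.
  set Y := - A2 + _ in X1'; set Z := _ + 200 * _ in X1'.
  have Y2 : Y ^+ 2 <= B ^+ 2.
    have : 0 <= (B - Y) * (B + Y) by rewrite mulr_ge0 // /Y; clear - p1 p2 p6 p7; lra.
    by rewrite -subr_sqr; clear; lra.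
  have Z2 : Z ^+ 2 <= 2 * (31 * 100) ^+ 2 * (B * H) + (400 * 200) * (B ^+ 2 * B ^+ 2).
    have : 0 <= ((31 * 100) * H - 200 * B ^+ 2) ^+ 2 by apply: sqr_ge0.
    have : H ^+ 2 <= B * H by rewrite expr2 ler_wpM2r.
    rewrite /Z; clear - p8; nra.
  have YZ : X ^+ 2 <= 2 * Y ^+ 2 + 2 * Z ^+ 2.
    by rewrite X1'; move: (Y) (Z) => y z; have := sqr_ge0 (y - z); clear; nra.
  have BH : B * (B * H) <= 1/100/100 * (1/100/100) * H.
    by rewrite mulrA ler_wpM2r // ler_pM // ltW.
  have BT : B * (B ^+ 2 * B ^+ 2) <= 1/100/100 * T.
    by rewrite mulrA -exprS mulrC /T ler_pM2r //; clear - p11 B1 B0; lra.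
  have TT : B * B ^+ 2 = T by rewrite /T exprS.
  apply: (@le_trans _ _ (B * (2 * B ^+ 2 + 2 * (2 * (31 * 100) ^+ 2 * (B * H) + (400 * 200) * (B ^+ 2 * B ^+ 2))))).
    apply: ler_pM; rewrite ?sqr_ge0 //; clear - YZ Y2 Z2; lra.
  by clear - BH BT TT p12 p8; lra.
set S := D + _ + _.
have S0 : A2 - 3/2 * A4 + 4/3 * A5 + 499 * H + 500 * T <= S by rewrite /S; clear - hD B2H p8; lra.
have S1 : 0 <= A2 - 3/2 * A4.
  have : A4 = A2 * A2 by rewrite /A4 /A2; ring.
  by clear - p1 p2 B1; nra.
have S2 : (A2 - 3/2 * A4) ^+ 2 <= S ^+ 2 by rewrite ler_sqr ?nnegrE //; clear - S0 S1 p3 p8 p12; lra.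
have A44 : A4 = A2 ^+ 2 by rewrite /A4 /A2; ring.
have A24 : A2 * A4 <= T by rewrite /T exprS; apply: ler_pM => //; clear - p3 p4; lra.
have S3 : A4 - 3 * T <= S ^+ 2.
  apply: le_trans S2; rewrite A44 -subr_ge0.
  have -> : (A2 - 3 / 2 * A2 ^+ 2) ^+ 2 - (A2 ^+ 2 - 3 * T) = 3 * (T - A2 * A2 ^+ 2) + 9/4 * (A2 ^+ 2) ^+ 2 by field.
  have : 0 <= T - A2 * A2 ^+ 2 by rewrite subr_ge0 -A44.
  by have := sqr_ge0 (A2 ^+ 2); clear; lra.
have := @expR_ge2 R S; rewrite (_ : 0 <= S); last by clear - S0 S1 p3 p8 p12; lra.
move=> /(_ isT); apply: le_trans.
apply: (@le_trans _ _ (1 + A2 * (1 + X + X ^+ 2))); first by rewrite lerD2l.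
have -> : A2 * (1 + X + X ^+ 2) = A2 + A2 * X + A2 * X ^+ 2 by ring.
by rewrite A2X; move: (A2 * X ^+ 2) A2X2 => W A2X2; clear - S0 S3 A2X2 A2H A2B2 p8 p12; lra.
Qed.

(** Write A2, A4, A5 for B a^2, B^2 a^4, B^2 a^5. Both sides are 1 + A2 - A4 + 4/3 A5 up to O(B h +
    B^3): on the right the second-order part comes from k x, on the left -A4 is the sum of -3/2 A4
    in D and of A4/2 in D^2/2. The slack 500 covers the rest. *)
Lemma step_down a h B D x k : 0 <= a <= 1 -> 0 <= h <= 1 -> 0 < B <= 1/100/100 ->
  D <= B * a ^+ 2 - 3/2 * (B ^+ 2 * a ^+ 4) + 4/3 * (B ^+ 2 * a ^+ 5) + 2 * (B * h) + 13 * B ^+ 2 * h ->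
  - (B * a ^+ 2) + 4/3 * (B * a ^+ 3) - (31 * 100) * (B * h) - 200 * B ^+ 2 <= x ->
  0 <= k -> B * a ^+ 2 - 2 * (B * h) <= k ->
  expR (D - 500 * (B * h) - 500 * B ^+ 3) <= 1 + k * expR x.
Proof.
move=> ha hh hB hD hx k0 k1.
have [/andP[p1 p2] /andP[p3 p4] p5 /andP[p6 p7] [/andP[p8 p9] /andP[p10 p11] /andP[p12 p13]]] := powers_le ha hB hh.
have [/andP[a0 a1] /andP[B0 B1] /andP[h0 h1]] := And3 ha hB hh.
set X := - _ + _ - _ - _ in hx.
have X1 : X <= 1/2 by rewrite /X; clear - p1 p2 p6 p7 p8 p9 p10 p11 B1 B0; lra.
have X0 : - (1/2) <= X by rewrite /X; clear - p1 p2 p6 p7 p8 p9 p10 p11 B1 B0; lra.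
set A2 := B * a ^+ 2 in p1 p2 p7 hD k1 X X1 X0 hx *.
set A4 := B ^+ 2 * a ^+ 4 in p4 p5 hD *.
set A5 := B ^+ 2 * a ^+ 5 in p3 p4 hD *.
set H := B * h in p8 p9 X X1 X0 hx hD k1 *.
set T := B ^+ 3 in p12 p13 *.
have B2H : B ^+ 2 * h <= 1/100/100 * H by rewrite /H expr2 -mulrA ler_wpM2r.
have A2X : A2 * X = - A4 + 4/3 * A5 - (31 * 100) * (A2 * H) - 200 * (A2 * B ^+ 2).
  by rewrite /X /A2 /A4 /A5; ring.
have A2H : A2 * H <= 1/100/100 * H by rewrite ler_wpM2r //; clear - p2 B1; lra.
have A2B2 : A2 * B ^+ 2 <= T by rewrite /T exprS ler_pM2r.
have A44 : A4 = A2 ^+ 2 by rewrite /A4 /A2; ring.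
have A23 : A2 ^+ 3 <= T by rewrite /T lerXn2r // nnegrE // ltW.
clearbody X; clearbody A2 A4 A5 H T.
have rhs : 1 + A2 - A4 + 4/3 * A5 - 4 * H - 200 * T <= 1 + k * expR x.
  apply: (@le_trans _ _ (1 + (A2 - 2 * H) * (1 + X))).
    have -> : 1 + (A2 - 2 * H) * (1 + X) = 1 + A2 + A2 * X - 2 * H - 2 * (H * X) by ring.
    have HX : H * X <= H * (1/2) by rewrite ler_wpM2l.
    by rewrite A2X; clear - HX A2H A2B2 p8 p12; lra.
  rewrite lerD2l; apply: (@le_trans _ _ (k * (1 + X))).
    by rewrite ler_wpM2r //; clear - X0; lra.
  rewrite ler_wpM2l //; apply: le_trans (expR_ge1Dx _) _.
  by rewrite ler_expR.
apply: le_trans rhs.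
set Y := A2 - 3/2 * A4 + 4/3 * A5; set w := 480 * H + 500 * T.
apply: (@le_trans _ _ (expR Y * expR (- w))).
  by rewrite -expRD ler_expR /Y /w; clear - hD B2H p8; lra.
have Y0 : 0 <= Y by rewrite /Y A44; clear - p1 p2 B1 p3; nra.
have YA : Y <= A2 * (1 + 4/3 * A2) by rewrite /Y A44; clear - p4 A44 p1; nra.
have A2s : A2 <= 1/100/100 by clear - p2 B1; lra.
have Y2 : Y ^+ 2 <= A4 + 3 * T.
  apply: (@le_trans _ _ ((A2 * (1 + 4/3 * A2)) ^+ 2)).
    by rewrite lerXn2r ?nnegrE //; apply: le_trans YA.
  have -> : (A2 * (1 + 4/3 * A2)) ^+ 2 = A2 ^+ 2 + 8/3 * A2 ^+ 3 + 16/9 * (A2 * A2 ^+ 3) by field.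
  have : A2 * A2 ^+ 3 <= 1/100/100 * A2 ^+ 3 by rewrite ler_wpM2r // exprn_ge0.
  have : 0 <= A2 ^+ 3 by rewrite exprn_ge0.
  by rewrite A44; clear - A23; lra.
have Y3 : Y ^+ 3 <= 2 * T.
  have YA' : Y <= A2 * (1 + 1/100).
    by apply: le_trans YA _; rewrite ler_wpM2l //; clear - A2s; lra.
  have c3 : (1 + 1/100) ^+ 3 <= 2 :> R by clear; lra.
  have c0 : 0 <= 1 + 1/100 :> R by clear; lra.
  apply: (@le_trans _ _ ((A2 * (1 + 1/100)) ^+ 3)).
    by apply: lerXn2r => //; rewrite nnegrE ?mulr_ge0.
  by rewrite exprMn mulrC ler_pM ?exprn_ge0.
have Ys : Y <= 1/2 by apply: le_trans YA _; clear - p1 A2s; nra.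
have eY : expR Y <= 1 + Y + A4 / 2 + 4 * T.
  have := @expR_le3 R Y; rewrite Y0 Ys => /(_ isT)/le_trans; apply.
  by clear - Y2 Y3 p12; lra.
have w0 : 0 <= w by rewrite /w; clear - p8 p12; lra.
have w1 : w <= 1 by rewrite /w; clear - p9 B1 p13 p11 p10 B0; lra.
have ew : expR (- w) <= 1 - w / 2.
  by apply: le_trans (expRN_le2 w0) _; rewrite expr2; clear - w0 w1; nra.
have eY1 : 1 <= expR Y by rewrite -expR0 ler_expR.
apply: (@le_trans _ _ (expR Y * (1 - w / 2))).
  by rewrite ler_wpM2l // expR_ge0.
apply: (@le_trans _ _ (expR Y - w / 2)).
  by clear - eY1 w0; nra.
by move: eY; rewrite /w /Y; clear - p8 p12; lra.
Qed.

End Step.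

Section Zeta.
Variable R : realType.
Implicit Types (a h c r B : R).

(* Solves the recursion to second order in B: the derivative in a is
   B a^2 + B^2 (4/3 a^5 - 3/2 a^4). *)
Definition phi (B a : R) : R :=
  B * a ^+ 3 / 3 + B ^+ 2 * (2/9 * a ^+ 6 - 3/10 * a ^+ 5).

Definition Phi (B : R) (m n : nat) : R := n%:R * phi B (m%:R / n%:R).

(** At fixed n each step from m to m+1 adds 500 B/n + 500 B^3, exactly the slack of [step_up] and
    [step_down]. *)
Definition Err (B : R) (m n : nat) : R := 500 * B * (m%:R / n%:R) + 500 * B ^+ 3 * m%:R.

(** P5 and P6 are ((a+h)^5 - a^5)/h and ((a+h)^6 - a^6)/h. *)
Lemma pow_bounds a h : 0 <= a -> 0 <= h -> a + h <= 1 ->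
  let P5 := 5 * a ^+ 4 + 10 * a ^+ 3 * h + 10 * a ^+ 2 * h ^+ 2 + 5 * a * h ^+ 3 + h ^+ 4 in
  let P6 := 6 * a ^+ 5 + 15 * a ^+ 4 * h + 20 * a ^+ 3 * h ^+ 2 + 15 * a ^+ 2 * h ^+ 3
            + 6 * a * h ^+ 4 + h ^+ 5 in
  (5 * a ^+ 4 <= P5 <= 5 * a ^+ 4 + 26 * h) /\ (6 * a ^+ 5 <= P6 <= 6 * a ^+ 5 + 57 * h).
Proof.
move=> a0 h0 ah P5 P6.
have ge i j : 0 <= a ^+ i * h ^+ j.+1 <= h.
  rewrite mulr_ge0 ?exprn_ge0 //= exprS mulrCA ler_piMr // mulr_ile1 ?exprn_ge0 ?exprn_ile1 //; lra.
have [/andP[q1 q2] /andP[q3 q4] /andP[q5 q6]] := And3 (ge 3 0) (ge 2 1) (ge 1 2).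
have /andP[q7 q8] := ge 0 3.
have [/andP[s1 s2] /andP[s3 s4] /andP[s5 s6]] := And3 (ge 4 0) (ge 3 1) (ge 2 2).
have [/andP[s7 s8] /andP[s9 s10]] := conj (ge 1 3) (ge 0 4).
rewrite !(expr0, expr1, mul1r) in q1 q2 q3 q4 q5 q6 q7 q8 s1 s2 s3 s4 s5 s6 s7 s8 s9 s10.
split.
  by rewrite /P5; apply/andP; split; clear - q1 q2 q3 q4 q5 q6 q7 q8; lra.
by rewrite /P6; apply/andP; split; clear - s1 s2 s3 s4 s5 s6 s7 s8 s9 s10; lra.
Qed.

Lemma phi_incr a h B : 0 <= a -> 0 < h -> a + h <= 1 -> 0 < B ->
  let D := (phi B (a + h) - phi B a) / h in
  B * a ^+ 2 - 3/2 * (B ^+ 2 * a ^+ 4) + 4/3 * (B ^+ 2 * a ^+ 5) - 8 * B ^+ 2 * h <= D /\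
  D <= B * a ^+ 2 - 3/2 * (B ^+ 2 * a ^+ 4) + 4/3 * (B ^+ 2 * a ^+ 5) + 2 * (B * h) + 13 * B ^+ 2 * h.
Proof.
move=> a0 h0 ah B0 D.
have [] := pow_bounds a0 (ltW h0) ah.
set P5 := 5 * _ + _ + _ + _ + _; set P6 := 6 * _ + _ + _ + _ + _ + _.
move=> /andP[l5 u5] /andP[l6 u6].
have DE : D = B * (a ^+ 2 + a * h + h ^+ 2 / 3) + B ^+ 2 * (2/9 * P6 - 3/10 * P5).
  by rewrite /D /phi /P5 /P6; field; rewrite gt_eqF.
have B20 : 0 <= B ^+ 2 by rewrite exprn_ge0 // ltW.
have g1 : a ^+ 2 <= a ^+ 2 + a * h + h ^+ 2 / 3 <= a ^+ 2 + 2 * h.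
  by apply/andP; split; clear - a0 h0 ah; nra.
case/andP: g1 => g1 g2.
have k1 : -3/2 * a ^+ 4 + 4/3 * a ^+ 5 - 8 * h <= 2/9 * P6 - 3/10 * P5.
  by clear - u5 l6 h0; lra.
have k2 : 2/9 * P6 - 3/10 * P5 <= -3/2 * a ^+ 4 + 4/3 * a ^+ 5 + 13 * h.
  by clear - l5 u6 h0; lra.
have m1 := ler_wpM2l (ltW B0) g1; have m2 := ler_wpM2l (ltW B0) g2.
have n1 := ler_wpM2l B20 k1; have n2 := ler_wpM2l B20 k2.
by rewrite DE; split; clear - m1 m2 n1 n2; lra.
Qed.

(** Meant for c = m/n, h = 1/n and r = n/(n-2): then c r = m/(n-2), and r = 1 + 2 h r says n = (n-2)
    + 2. First order in B is enough, as x only enters multiplied by a coefficient of order B. *)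
Lemma phi_back c h r B : 0 <= c -> 0 < h <= 1/3 -> c + h <= 1 -> 1 <= r <= 3 -> r = 1 + 2 * h * r ->
  0 < B ->
  let a := c + h in
  let x := (phi B (c * r) / r - phi B a) / h in
  - (B * a ^+ 2) + 4/3 * (B * a ^+ 3) - 100 * (B * h) - 200 * B ^+ 2 <= x /\
  x <= - (B * a ^+ 2) + 4/3 * (B * a ^+ 3) + 100 * (B * h) + 200 * B ^+ 2.
Proof.
move=> c0 /andP[h0 h1] ch /andP[r1 r3] rE B0 a x.
have hE : h = (r - 1) / (2 * r) by move: rE r1; clear; move=> rE r1; apply/esym; rewrite {1}rE; field; lra.
have [] := pow_bounds c0 (ltW h0) ch.
set P5 := 5 * _ + _ + _ + _ + _; set P6 := 6 * _ + _ + _ + _ + _ + _.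
move=> /andP[l5 u5] /andP[l6 u6].
have xE : x = B / 3 * (2 * r * (r + 1) * c ^+ 3 - 3 * c ^+ 2 - 3 * c * h - h ^+ 2)
  + B ^+ 2 * (2/9 * (2 * r * (1 + r + r ^+ 2 + r ^+ 3 + r ^+ 4) * c ^+ 6 - P6)
             - 3/10 * (2 * r * (1 + r + r ^+ 2 + r ^+ 3) * c ^+ 5 - P5)).
  rewrite /x /phi /a /P5 /P6; rewrite hE; field.
  by rewrite hE in h0; clear - r1 h0; move: h0; nra.
have rh : r <= 1 + 6 * h by rewrite rE; clear - h0 r3; nra.
have u1 : 2 <= r * (r + 1) by clear - r1; nra.
have u2 : r * (r + 1) <= 2 + 30 * h.
  apply: (@le_trans _ _ ((1 + 6 * h) * (1 + 6 * h + 1))); last by clear - h0 h1; nra.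
  by apply: ler_pM => //; clear - r1 rh; lra.
have c1 : c <= 1 by clear - ch h0; lra.
have ci n : 0 <= c ^+ n <= 1 by rewrite exprn_ge0 //= exprn_ile1.
have [/andP[c30 c31] /andP[c50 c51] /andP[c60 c61]] := And3 (ci 3) (ci 5) (ci 6).
have ri n : 0 <= r ^+ n <= 3 ^+ n.
  by rewrite exprn_ge0 ?lerXn2r ?nnegrE //; clear - r1; lra.
have [/andP[r20 r21] /andP[r30 r31] /andP[r40 r41]] := And3 (ri 2) (ri 3) (ri 4).
have uc1 : 2 * c ^+ 3 <= r * (r + 1) * c ^+ 3 by rewrite ler_wpM2r.
have uc2 : r * (r + 1) * c ^+ 3 <= 2 * c ^+ 3 + 30 * h.
  apply: (@le_trans _ _ ((2 + 30 * h) * c ^+ 3)); first by rewrite ler_wpM2r.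
  by clear - h0 c31; nra.
have a3 : a ^+ 3 - 3 * h <= c ^+ 3 <= a ^+ 3.
  have -> : a ^+ 3 = c ^+ 3 + h * (3 * c ^+ 2 + 3 * c * h + h ^+ 2) by rewrite /a; ring.
  have : 0 <= 3 * c ^+ 2 + 3 * c * h + h ^+ 2 <= 3.
    by apply/andP; split; clear - c0 h0 ch; nra.
  by move: (3 * c ^+ 2 + _ + _) => q; clear - h0; nra.
have a2 : a ^+ 2 - 2 * h <= c ^+ 2 + c * h + h ^+ 2 / 3 <= a ^+ 2.
  by rewrite /a; apply/andP; split; clear - c0 h0 ch; nra.
case/andP: a3 => a3 a3'; case/andP: a2 => a2 a2'.
have E1l : - a ^+ 2 + 4/3 * a ^+ 3 - 100 * h <= (2 * r * (r + 1) * c ^+ 3 - 3 * c ^+ 2 - 3 * c * h - h ^+ 2) / 3.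
  by clear - uc1 a3 a2' h0; lra.
have E1u : (2 * r * (r + 1) * c ^+ 3 - 3 * c ^+ 2 - 3 * c * h - h ^+ 2) / 3 <= - a ^+ 2 + 4/3 * a ^+ 3 + 100 * h.
  by clear - uc2 a3' a2 h0; lra.
have s1 : 0 <= 2 * r * (1 + r + r ^+ 2 + r ^+ 3) <= 240.
  have -> : 2 * r * (1 + r + r ^+ 2 + r ^+ 3) = 2 * (r + r ^+ 2 + r ^+ 3 + r ^+ 4) by ring.
  by apply/andP; split; clear - r1 r3 r20 r21 r30 r31 r40 r41; lra.
have s2 : 0 <= 2 * r * (1 + r + r ^+ 2 + r ^+ 3 + r ^+ 4) <= 726.
  have /andP[r50 r51] := ri 5.
  have -> : 2 * r * (1 + r + r ^+ 2 + r ^+ 3 + r ^+ 4) = 2 * (r + r ^+ 2 + r ^+ 3 + r ^+ 4 + r ^+ 5) by ring.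
  by apply/andP; split; clear - r1 r3 r20 r21 r30 r31 r40 r41 r50 r51; lra.
case/andP: s1 => s10 s11; case/andP: s2 => s20 s21.
have [/andP[c40 c41]] := ci 4.
have h1' : h <= 1/3 by [].
set S1 := 2 * r * (1 + r + r ^+ 2 + r ^+ 3) in xE s10 s11.
set S2 := 2 * r * (1 + r + r ^+ 2 + r ^+ 3 + r ^+ 4) in xE s20 s21.
have t1 : 0 <= S1 * c ^+ 5 <= 240 by rewrite mulr_ge0 //= -[leRHS]mulr1 ler_pM.
have t2 : 0 <= S2 * c ^+ 6 <= 726 by rewrite mulr_ge0 //= -[leRHS]mulr1 ler_pM.
case/andP: t1 => t10 t11; case/andP: t2 => t20 t21.
have E2l : - 200 <= 2/9 * (S2 * c ^+ 6 - P6) - 3/10 * (S1 * c ^+ 5 - P5).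
  by clear - t20 t11 u6 l5 c40 c51 h1'; lra.
have E2u : 2/9 * (S2 * c ^+ 6 - P6) - 3/10 * (S1 * c ^+ 5 - P5) <= 200.
  by clear - t21 t10 l6 u5 c50 c41 h1'; lra.
have B20 : 0 <= B ^+ 2 by rewrite exprn_ge0 // ltW.
have m1 := ler_wpM2l (ltW B0) E1l; have m2 := ler_wpM2l (ltW B0) E1u.
have n1 := ler_wpM2l B20 E2l; have n2 := ler_wpM2l B20 E2u.
move: xE; set E1 := _ - h ^+ 2 in m1 m2 *; set E2 := _ - 3/10 * _ in n1 n2 *.
by move=> ->; split; clear - m1 m2 n1 n2; lra.
Qed.
End Zeta.

Section ZetaRec.
Variable R : realType.
Implicit Types (B : R).

(** The coefficient (m+1) m of the recursion once zeta(m,N) is divided by (N+m)!/(2 b^(N+m+1)), for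
    B = b^2. *)
Definition rec_coef B (m N : nat) : R :=
  B * ((m.+1 * m)%:R / ((N + m).+2 * (N + m).+1)%:R).

Lemma zeta_step B m N : 0 < B <= 1/100/100 ->
  let n := (N + m).+2 in
  (expR (Phi B m.+1 n + Err B m.+1 n) + rec_coef B m N * expR (Phi B m (N + m) + Err B m (N + m))
   <= expR (Phi B m.+2 n + Err B m.+2 n)) /\
  (expR (Phi B m.+2 n - Err B m.+2 n) <=
  expR (Phi B m.+1 n - Err B m.+1 n) + rec_coef B m N * expR (Phi B m (N + m) - Err B m (N + m))).
Proof.
move=> hB n.
pose a : R := m.+1%:R / n%:R.
pose h : R := n%:R^-1.
have n0 : 0 < n%:R :> R.
  by rewrite ltr0n.
have h0 : 0 < h.
  by rewrite invr_gt0.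
have a0 : 0 <= a.
  by rewrite divr_ge0.
have ahE : a + h = m.+2%:R / n%:R.
  by rewrite /a /h -[m.+2%:R]natr1 mulrDl mul1r.
have ah1 : a + h <= 1.
  by rewrite ahE ler_pdivrMr // mul1r ler_nat /n; lia.
have B0 : 0 < B.
  by case/andP: hB.
have a1 : a <= 1.
  by have := h0; have := ah1; clear; lra.
have h1 : h <= 1.
  by have := a0; have := ah1; clear; lra.
pose D := Phi B m.+2 n - Phi B m.+1 n.
have DE : D = (phi B (a + h) - phi B a) / h.
  by rewrite /D /Phi -ahE -/a /h invrK; ring.
have eE : Err B m.+2 n - Err B m.+1 n = 500 * (B * h) + 500 * B ^+ 3.
  by rewrite /Err -ahE -/a -[m.+2%:R]natr1; ring.
have k0 : 0 <= rec_coef B m N.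
  by rewrite mulr_ge0 ?divr_ge0 // ltW.
have kE : rec_coef B m N = B * (a * (a - h) / (1 - h)).
{ congr (_ * _).
  have gen (x q : R) : 0 < q -> (x + 1) * x / ((q + 1) * q) =
      (x + 1) / (q + 1) * ((x + 1) / (q + 1) - (q + 1)^-1) / (1 - (q + 1)^-1).
    move=> q0; field.
    by do ?[apply/andP; split]; rewrite gt_eqF //; clear - q0; lra.
  have q0 : 0 < (N + m).+1%:R :> R by rewrite ltr0n.
  have e : n%:R = (N + m).+1%:R + 1 :> R by rewrite natr1.
  by rewrite !natrM -/n /a /h -[m.+1%:R]natr1 e gen.
}
have ah : 0 <= a - h.
  by rewrite /a /h -[m.+1%:R]natr1 mulrDl mul1r addrK divr_ge0.
have h12 : h <= 1/2.
  by rewrite /h div1r lef_pV2 ?posrE // ler_nat.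
have kbound : B * a ^+ 2 - 2 * (B * h) <= rec_coef B m N <= B * a ^+ 2.
{ have l1 : a * (a - h) / (1 - h) <= a ^+ 2.
  rewrite ler_pdivrMr; last by have := h12; clear; lra.
  have : 0 <= a * h * (1 - a) by rewrite !mulr_ge0 ?subr_ge0 // ltW.
  by clear; lra.
have l2 : a ^+ 2 - 2 * h <= a * (a - h) / (1 - h).
  rewrite ler_pdivlMr; last by have := h12; clear; lra.
  have : 0 <= h * ((1 - a) + (1 - 2 * h) + a ^+ 2).
    apply: mulr_ge0; first exact: ltW.
    by have := sqr_ge0 a; clear - a1 h12; lra.
  by clear; lra.
rewrite kE; have m1 := ler_wpM2l (ltW B0) l1; have m2 := ler_wpM2l (ltW B0) l2.
by apply/andP; split; clear - m1 m2; lra.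
}
have back : exists x : R, exists e2 : R,
  [/\ - (B * a ^+ 2) + 4/3 * (B * a ^+ 3) - 100 * (B * h) - 200 * B ^+ 2 <= x,
      x <= - (B * a ^+ 2) + 4/3 * (B * a ^+ 3) + 100 * (B * h) + 200 * B ^+ 2,
      e2 <= (30 * 100) * (B * h),
      rec_coef B m N * expR (Phi B m (N + m) + Err B m (N + m)) =
        rec_coef B m N * (expR (Phi B m.+1 n + Err B m.+1 n) * expR (x + e2)) &
      rec_coef B m N * expR (Phi B m (N + m) - Err B m (N + m)) =
        rec_coef B m N * (expR (Phi B m.+1 n - Err B m.+1 n) * expR (x - e2))].
(* For m = 0 the coefficient vanishes and any x within the bounds serves; otherwise n - 2 is
   positive. *)
{ case: (posnP m) => [m0|m0].
  have k00 : rec_coef B m N = 0 by rewrite /rec_coef m0 muln0 mul0r mulr0.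
  have Bh0 : 0 <= B * h by rewrite mulr_ge0 // ltW.
  have B2 : 0 <= B ^+ 2 by rewrite exprn_ge0 // ltW.
  exists (- (B * a ^+ 2) + 4/3 * (B * a ^+ 3)), 0; split; rewrite ?k00 ?mul0r //; clear - Bh0 B2; lra.
pose c := a - h; have ca : c + h = a by rewrite subrK.
pose r : R := n%:R / (N + m)%:R.
have nm0 : 0 < (N + m)%:R :> R by rewrite ltr0n addn_gt0 m0 orbT.
have nE : n%:R = (N + m)%:R + 2 :> R by rewrite /n -natr1 -natr1 -addrA.
have r1 : 1 <= r by rewrite ler_pdivlMr // mul1r nE; clear; lra.
have nm1 : 1 <= (N + m)%:R :> R by rewrite ler1n addn_gt0 m0 orbT.
have r3 : r <= 3 by rewrite ler_pdivrMr // nE; clear - nm1; lra.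
have rE : r = 1 + 2 * h * r.
  rewrite /r /h nE; move: nm0; move: ((N + m)%:R) => q q0; field.
  by do ?[apply/andP; split]; rewrite gt_eqF //; clear - q0; lra.
have h3 : h <= 1/3.
  rewrite /h div1r lef_pV2 ?posrE //; by rewrite nE; clear - nm1; lra.
have [] := @phi_back R c h r B ah _ _ _ rE B0.
- by rewrite h0 h3.
- by rewrite ca.
- by rewrite r1 r3.
rewrite ca; set x := _ / h => x1 x2.
have hr : h * r = (N + m)%:R^-1 by rewrite /h /r mulrA mulVf ?mul1r // gt_eqF.
have cE : c = m%:R / n%:R by rewrite /c /a /h -[m.+1%:R]natr1 mulrDl mul1r addrK.
have crE : c * r = m%:R / (N + m)%:R.
  by rewrite cE /r mulrA divfK // gt_eqF.
have xE : Phi B m (N + m) = Phi B m.+1 n + x.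
  have rn0 : r != 0 by rewrite gt_eqF //; clear - r1; lra.
  have nn : n%:R = h^-1 by rewrite /h invrK.
  have nmE : (N + m)%:R = (h * r)^-1 :> R by rewrite hr invrK.
  rewrite /Phi -crE -/a nmE nn /x; field.
  by rewrite rn0 gt_eqF.
(* The change of [Err] from (m+1, n) to (m, n-2). It may be positive, since m/(n-2) can exceed
   (m+1)/n, but it is at most O(B h). *)
pose e2 := 500 * B * (c * r - a) - 500 * B ^+ 3.
have e2E : Err B m (N + m) = Err B m.+1 n + e2.
  by rewrite /Err -crE -/a /e2 -[m.+1%:R]natr1; ring.
exists x, e2; split=> //.
- rewrite /e2.
  have e3 : c * r - a <= 6 * h.
    have -> : c * r - a = 2 * h * (c * r) - h by rewrite -ca [in LHS]rE; ring.
    have cr : c * r <= 3.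
      rewrite -[leRHS]mul1r ler_pM //; first by clear - r1; lra.
      by rewrite /c; have := a1; have := h0; clear; lra.
    by have := h0; clear - cr; nra.
  have B3 : 0 < B ^+ 3 by rewrite exprn_gt0.
  have := ler_wpM2l (ltW B0) e3; clear - B3; lra.
- by rewrite xE e2E -expRD; congr (_ * expR _); ring.
- by rewrite xE e2E -expRD; congr (_ * expR _); ring.
}
split.
{ have [x [e2 [x1 x2 e2u eq1 _]]] := back.
have [kl ku] := andP kbound.
have [d1 d2] := phi_incr a0 h0 ah1 B0; rewrite -DE in d1 d2.
have hx : x + e2 <= - (B * a ^+ 2) + 4/3 * (B * a ^+ 3) + (31 * 100) * (B * h) + 200 * B ^+ 2.
  by clear - x2 e2u; lra.
have := @step_up R a h B D (x + e2) (rec_coef B m N) _ _ hB d1 hx _.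
rewrite a0 a1 ltW // h1 k0 ku => /(_ isT isT isT) st.
rewrite eq1 (_ : forall V k E : R, V + k * (V * E) = V * (1 + k * E)); last by move=> *; ring.
have -> : expR (Phi B m.+2 n + Err B m.+2 n) = expR (Phi B m.+1 n + Err B m.+1 n) *
    expR (D + 500 * (B * h) + 500 * B ^+ 3).
  by rewrite -expRD; congr expR; rewrite -[D + _ + _]addrA -eE /D; ring.
by rewrite ler_pM2l // expR_gt0.
}
have [x [e2 [x1 x2 e2u _ eq1]]] := back.
have [kl ku] := andP kbound.
have [d1 d2] := phi_incr a0 h0 ah1 B0; rewrite -DE in d1 d2.
have hx : - (B * a ^+ 2) + 4/3 * (B * a ^+ 3) - (31 * 100) * (B * h) - 200 * B ^+ 2 <= x - e2.
  by clear - x1 e2u; lra.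
have := @step_down R a h B D (x - e2) (rec_coef B m N) _ _ hB d2 hx k0 kl.
rewrite a0 a1 ltW // h1 => /(_ isT isT) st.
rewrite eq1 (_ : forall V k E : R, V + k * (V * E) = V * (1 + k * E)); last by move=> *; ring.
have -> : expR (Phi B m.+2 n - Err B m.+2 n) = expR (Phi B m.+1 n - Err B m.+1 n) *
    expR (D - 500 * (B * h) - 500 * B ^+ 3).
  rewrite -expRD; congr expR.
  have -> : D - 500 * (B * h) - 500 * B ^+ 3 = D - (500 * (B * h) + 500 * B ^+ 3) by ring.
  by rewrite -eE /D; ring.
by rewrite ler_pM2l // expR_gt0.
Qed.

(** The coefficients of the recursion are nonnegative, so a sequence that starts between the
    subsolution and the supersolution stays there. *)
Lemma zeta_bounds (B c0 c1 : R) (z : nat -> nat -> R) : 0 < B <= 1/100/100 ->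
  0 <= c0 ->
  (forall N, c0 <= z 0%N N <= c1) -> (forall N, c0 <= z 1%N N <= c1) ->
  (forall m N, z m.+2 N = z m.+1 N.+1 + rec_coef B m N * z m N) ->
  forall m N, c0 * expR (Phi B m (N + m) - Err B m (N + m)) <= z m N
           <= c1 * expR (Phi B m (N + m) + Err B m (N + m)).
Proof.
move=> hB c00 h0 h1 hrec.
have [B0 B1] := andP hB.
have c10 : 0 <= c1 by have /andP[p1 p2] := h0 0%N; apply: le_trans c00 (le_trans p1 p2).
have kp m N : 0 <= rec_coef B m N by rewrite mulr_ge0 ?divr_ge0 // ltW.
suff gen m : (forall N, c0 * expR (Phi B m (N + m) - Err B m (N + m)) <= z m N
           <= c1 * expR (Phi B m (N + m) + Err B m (N + m))) /\
   (forall N, c0 * expR (Phi B m.+1 (N + m.+1) - Err B m.+1 (N + m.+1)) <= z m.+1 N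
           <= c1 * expR (Phi B m.+1 (N + m.+1) + Err B m.+1 (N + m.+1))).
  by move=> m; apply: (gen m).1.
elim: m => [|m [IH0 IH1]]; split=> N.
- rewrite /Phi /Err !mul0r /phi !expr0n /= !(mulr0, mul0r, subr0, addr0) expR0 !mulr1.
  exact: h0.
(* For m = 1, [Phi] is at most 500 B/n in absolute value, and [Err] absorbs it. *)
- set n := (N + 1)%N.
  have n1 : 1 <= n%:R :> R by rewrite ler1n /n addn1.
  set t : R := 1%:R / n%:R.
  have nt : n%:R * t = 1 by rewrite /t mulrC divfK // gt_eqF //; clear - n1; lra.
  have t0 : 0 < t by rewrite divr_gt0 //; clear - n1; lra.
  have t1 : t <= 1 by rewrite ler_pdivrMr ?mul1r //; clear - n1; lra.
  have ti i : 0 <= t ^+ i <= 1 by rewrite exprn_ge0 ?exprn_ile1 // ltW.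
  have e0 : 0 <= Err B 1 n - 500 * B * t.
    have -> : Err B 1 n = 500 * B * t + 500 * B ^+ 3 by rewrite /Err -/t; ring.
    have B3 : 0 <= B ^+ 3 by rewrite exprn_ge0 // ltW.
    by clear - B3; lra.
  have PE : Phi B 1 n = t * (B * t / 3 + B ^+ 2 * (2/9 * t ^+ 4 - 3/10 * t ^+ 3)).
    have pE : phi B t = t * (t * (B * t / 3 + B ^+ 2 * (2/9 * t ^+ 4 - 3/10 * t ^+ 3))).
      by rewrite /phi; ring.
    by rewrite /Phi -/t pE mulrA nt mul1r.
  have in1 : - (500 * B) <= B * t / 3 + B ^+ 2 * (2/9 * t ^+ 4 - 3/10 * t ^+ 3) <= 500 * B.
    have [/andP[q1 q2] /andP[q3 q4]] := conj (ti 4%N) (ti 3%N).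
    have Bt : 0 <= B * t <= B by have := ltW B0; have := ltW t0 => t0' B0'; rewrite mulr_ge0 // ler_piMr.
    have B2 : 0 <= B ^+ 2 <= B by rewrite exprn_ge0 ?(ltW B0) //= expr2; clear - B0 B1; nra.
    case/andP: Bt => Bt1 Bt2; case/andP: B2 => B21 B22.
    have k1 : -1 <= 2/9 * t ^+ 4 - 3/10 * t ^+ 3 <= 1 by apply/andP; split; clear - q1 q2 q3 q4; lra.
    case/andP: k1 => k1 k2.
    have j1 := ler_wpM2l B21 k1; have j2 := ler_wpM2l B21 k2.
    by apply/andP; split; clear - j1 j2 B21 B22 Bt1 Bt2; lra.
  case/andP: in1 => in1 in2.
  have p1 := ler_wpM2l (ltW t0) in1; have p2 := ler_wpM2l (ltW t0) in2.
  rewrite -PE in p1 p2.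
  have s1 : Phi B 1 n - Err B 1 n <= 0 by clear - p2 e0; lra.
  have s2 : 0 <= Phi B 1 n + Err B 1 n by clear - p1 e0; lra.
  have /andP[z1 z2] := h1 N.
  apply/andP; split.
    by apply: le_trans z1; rewrite ler_piMr // -expR0 ler_expR.
  by apply: le_trans z2 _; rewrite ler_peMr // -expR0 ler_expR.
- by apply: IH1.
rewrite hrec.
have /andP[u1 u2] := IH1 N.+1; have /andP[v1 v2] := IH0 N.
have nE : (N.+1 + m.+1 = (N + m).+2)%N by lia.
rewrite nE in u1 u2; have -> : (N + m.+2 = (N + m).+2)%N by lia.
apply/andP; split.
  apply: le_trans (ler_wpM2l c00 (zeta_step m N hB).2) _.
  by rewrite mulrDr lerD // mulrCA ler_wpM2l.
apply: le_trans _ (ler_wpM2l c10 (zeta_step m N hB).1).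
by rewrite [leRHS]mulrDr lerD // [leRHS]mulrCA ler_wpM2l.
Qed.
End ZetaRec.

(** * Riemann sums *)

Lemma is_derive_pow (R : realType) n (x : R) :
  is_derive x 1 (fun y : R => y ^+ n) (n%:R * x ^+ n.-1).
Proof.
elim: n => [|n IH].
  rewrite (_ : (fun y : R => y ^+ 0) = cst 1) ?mul0r; first exact: is_derive_cst.
  by apply/funext => y; rewrite expr0.
rewrite (_ : (fun y : R => y ^+ n.+1) = fun y => y * y ^+ n); last first.
  by apply/funext => y; rewrite exprS.
apply: is_derive_eq; rewrite /GRing.scale /=; case: n {IH} => [|n] /=.
  by rewrite !expr0; ring.
by rewrite exprS -[n.+2%:R]natr1; ring.
Qed.

Section PowerSum.
Variables (R : realType) (b : R).
Hypothesis b0 : 0 < b.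

Definition expNb (x : R) := expR (- (b * x)).

Lemma expNb_gt0 x : 0 < expNb x. Proof. exact: expR_gt0. Qed.

Lemma is_derive_expNb (x : R) : is_derive x 1 expNb (- b * expNb x).
Proof.
have h : is_derive x 1 (fun y : R => - (b * y)) (- b).
  by apply: is_derive_eq; rewrite /GRing.scale /=; ring.
have := @is_derive1_comp R expR (fun y : R => - (b * y)) x _ _ (is_derive_expR _) h.
by move=> h'; apply: is_derive_eq h' _; rewrite mulrC.
Qed.

(* A primitive of x^N e^(-bx) vanishing at infinity. *)
Fixpoint prim (N : nat) (x : R) : R :=
  if N is N'.+1 then b^-1 * (N'.+1%:R * prim N' x - x ^+ N'.+1 * expNb x) else - (b^-1 * expNb x).

Lemma is_derive_prim N (x : R) : is_derive x 1 (prim N) (x ^+ N * expNb x).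
Proof.
have bn : b != 0 by rewrite gt_eqF.
have de := is_derive_expNb x.
elim: N => [|N IH].
  by apply: is_derive_eq; rewrite /GRing.scale /= expr0; field.
have dX : is_derive x 1 (fun y : R => y ^+ N.+1) (N.+1%:R * x ^+ N).
  exact: is_derive_pow.
rewrite -[prim N.+1]/(fun x => b^-1 * (N.+1%:R * prim N x - x ^+ N.+1 * expNb x)).
by apply: is_derive_eq; rewrite /GRing.scale /= !exprS; field.
Qed.

Lemma prim0 N : prim N 0 = - (N`!%:R / b ^+ N.+1).
Proof.
have bn : b != 0 by rewrite gt_eqF.
have e0 : expNb 0 = 1 by rewrite /expNb mulr0 oppr0 expR0.
elim: N => [|N IH] /=; first by rewrite e0 expr1 fact0 mulr1 mul1r.
by rewrite IH expr0n /= mul0r subr0 factS natrM [b ^+ N.+2]exprS; field; rewrite expf_neq0.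
Qed.

Lemma prim_le0 N x : 0 <= x -> prim N x <= 0.
Proof.
move=> x0; have bi : 0 <= b^-1 by rewrite invr_ge0 ltW.
have e0 := ltW (expNb_gt0 x).
elim: N => [|N IH] /=; first by rewrite oppr_le0 mulr_ge0.
rewrite mulr_ge0_le0 // subr_le0; apply: (@le_trans _ _ 0).
  by rewrite mulr_ge0_le0.
by rewrite mulr_ge0 // exprn_ge0.
Qed.

(* A primitive of N x^(N-1) e^(-bx) + b x^N e^(-bx), which bounds the derivative of
   x^N e^(-bx) in absolute value. *)
Definition var (N : nat) (x : R) : R := N%:R * prim N.-1 x + b * prim N x.

Lemma var_le0 N x : 0 <= x -> var N x <= 0.
Proof.
move=> x0; rewrite -[0]addr0 lerD //; first by rewrite mulr_ge0_le0 ?prim_le0.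
by rewrite mulr_ge0_le0 ?prim_le0 // ltW.
Qed.

Lemma var0 N : - (2 * (N`!%:R / b ^+ N)) <= var N 0.
Proof.
have bn : b != 0 by rewrite gt_eqF.
rewrite /var !prim0; case: N => [|N] /=.
  by rewrite mul0r add0r fact0 expr0 expr1 (_ : b * _ = -1); [clear - b0; lra|field].
rewrite le_eqVlt; apply/orP; left; apply/eqP.
by rewrite factS natrM [b ^+ N.+2]exprS; field; rewrite expf_neq0.
Qed.

(** For f(x) = x^N e^(-bx) the difference is the integral of (x - y) f'(x) over [y, y+2], where x -
    y is at most 2 and f' is at most p + q in absolute value. Monotonicity of two auxiliary
    functions replaces the integral. *)
Lemma riemann_step N y : 0 <= y ->
  `|2 * ((y + 2) ^+ N * expNb (y + 2)) - (prim N (y + 2) - prim N y)| <= 2 * (var N (y + 2) - var N y).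
Proof.
move=> y0.
pose p x : R := N%:R * x ^+ N.-1 * expNb x; pose q x : R := b * (x ^+ N * expNb x).
have p0 x : 0 <= x -> 0 <= p x by move=> x0; rewrite !mulr_ge0 ?exprn_ge0 // ltW // expNb_gt0.
have q0 x : 0 <= x -> 0 <= q x by move=> x0; rewrite !mulr_ge0 ?exprn_ge0 // ltW // expNb_gt0.
have dD (x : R) : is_derive x 1 (var N) (p x + q x).
  have d1 := is_derive_prim N.-1 x; have d2 := is_derive_prim N x.
  rewrite /var; apply: is_derive_eq; rewrite /GRing.scale /p /q /=; ring.
have dg (x : R) : is_derive x 1 (fun z : R => z ^+ N * expNb z) (p x - q x).
  have dX : is_derive x 1 (fun y : R => y ^+ N) (N%:R * x ^+ N.-1).
    exact: is_derive_pow.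
  have de := is_derive_expNb x.
  by apply: is_derive_eq; rewrite /GRing.scale /p /q /=; ring.
have dphi (x : R) : is_derive x 1 (fun z => prim N z - (z - y) * (z ^+ N * expNb z)) (- (x - y) * (p x - q x)).
  have d1 := is_derive_prim N x; have d2 := dg x.
  by apply: is_derive_eq; rewrite /GRing.scale /=; ring.
have yy : y <= y + 2 by rewrite lerDl.
have up := @le_of_derive R (fun z => 2 * var N z + (prim N z - (z - y) * (z ^+ N * expNb z)))
  (fun x => 2 * (p x + q x) + - (x - y) * (p x - q x)) y (y + 2) yy _ _.
have dn := @le_of_derive R (fun z => 2 * var N z - (prim N z - (z - y) * (z ^+ N * expNb z)))
  (fun x => 2 * (p x + q x) - - (x - y) * (p x - q x)) y (y + 2) yy _ _.
have pos x : y <= x <= y + 2 -> 0 <= 2 * (p x + q x) + - (x - y) * (p x - q x) /\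
   0 <= 2 * (p x + q x) - - (x - y) * (p x - q x).
  case/andP=> h1 h2; have x0 : 0 <= x by apply: le_trans h1.
  have := p0 _ x0; have := q0 _ x0; move: (p x) (q x) => P Q Q0 P0.
  by split; clear - b0 Q0 P0 h1 h2; nra.
have {}up := up (fun x _ => _) (fun x h => (pos x h).1).
have {}dn := dn (fun x _ => _) (fun x h => (pos x h).2).
have := up _; have := dn _; rewrite subrr mul0r (_ : y + 2 - y = 2); last by ring.
move=> dn' up'.
have up1 : 2 * var N y + (prim N y - 0) <= 2 * var N (y + 2) + (prim N (y + 2) - 2 * ((y + 2) ^+ N * expNb (y + 2))).
  by apply: up' => x; have d1 := dD x; have d2 := dphi x; apply: is_derive_eq; rewrite /GRing.scale /=; ring.
have dn1 : 2 * var N y - (prim N y - 0) <= 2 * var N (y + 2) - (prim N (y + 2) - 2 * ((y + 2) ^+ N * expNb (y + 2))).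
  by apply: dn' => x; have d1 := dD x; have d2 := dphi x; apply: is_derive_eq; rewrite /GRing.scale /=; ring.
by rewrite ler_norml; apply/andP; split; clear - b0 up1 dn1; lra.
Qed.
Let t : R := expR (- (2 * b)).

Lemma expN_itv01 : 0 < t < 1.
Proof. by rewrite expR_gt0 -expR0 ltr_expR oppr_lt0 mulr_gt0. Qed.

Lemma expNb_pow v : expNb (2 * v)%:R = t ^+ v.
Proof. by rewrite /expNb /t -expRM_natl natrM; congr expR; ring. Qed.

(** The sum uses right endpoints; the term v = 0, equal to [0 ^+ N], is not one of them and is
    subtracted. *)
Lemma riemann_sum N n :
  `|2 * series (fun v => (2 * v)%:R ^+ N * t ^+ v) n.+1 - 2 * 0 ^+ N - (prim N (2 * n)%:R - prim N 0)|
  <= 2 * (var N (2 * n)%:R - var N 0).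
Proof.
elim: n => [|n IH].
  rewrite seriesS series0 muln0 expr0 (_ : 2 * _ - _ - _ = 0) ?normr0; last by ring.
  by rewrite subrr mulr0.
have st := @riemann_step N (2 * n)%:R (ler0n _ _).
have e2 : (2 * n)%:R + 2 = (2 * n.+1)%:R :> R by rewrite mulnS addnC natrD.
rewrite e2 in st; rewrite seriesS -expNb_pow.
set S := series _ _ in IH *; set g := _ * expNb _ in st *.
set G0 := prim N 0 in IH *; set G1 := prim N (2 * n)%:R in IH st *; set G2 := prim N (2 * n.+1)%:R in st *.
have -> : 2 * (S + g) - 2 * 0 ^+ N - (G2 - G0) = (2 * S - 2 * 0 ^+ N - (G1 - G0)) + (2 * g - (G2 - G1)) by ring.
apply: le_trans (ler_normD _ _) _; apply: le_trans (lerD IH st) _.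
by rewrite le_eqVlt; apply/orP; left; apply/eqP; ring.
Qed.

Lemma gf_pow_ex N : exists l, gf (fun v => (2 * v)%:R ^+ N) t l.
Proof.
have /andP[t0 _] := expN_itv01.
have tn v : 0 <= (2 * v)%:R ^+ N * t ^+ v by rewrite mulr_ge0 ?exprn_ge0 // ltW.
apply: (@gf_cvg_bounded _ _ _ (1 + (- prim N 0) - var N 0) t0) => [v|n].
  by rewrite exprn_ge0.
apply: (@le_trans _ _ (series (fun v => (2 * v)%:R ^+ N * t ^+ v) n.+1)).
  by rewrite seriesS lerDl.
have := riemann_sum N n; rewrite ler_norml => /andP[_].
have := prim_le0 N (ler0n R (2 * n)); have := var_le0 N (ler0n R (2 * n)).
have := prim_le0 N (lexx 0).
have : 0 ^+ N <= 1 :> R by case: N {tn} => [|N]; rewrite ?expr0 ?expr0n.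
move: (series _ _) (prim N _) (var N _) (0 ^+ N) (prim N 0) (var N 0) => S G D z G0 D0.
clear -b0; lra.
Qed.

Lemma pow_exp_cvg0 N : (fun v => (2 * v)%:R ^+ N * t ^+ v) @ \oo --> (0 : R).
Proof.
have [l hl] := gf_pow_ex N.
by apply: cvg_series_cvg_0; apply/cvg_ex; exists l.
Qed.

Lemma prim_cvg0 N : (fun n => prim N (2 * n)%:R) @ \oo --> (0 : R).
Proof.
elim: N => [|N IH].
  rewrite (_ : (fun n => _) = fun n => (- b^-1) * ((2 * n)%:R ^+ 0 * t ^+ n)).
    by rewrite -[X in _ --> X](mulr0 (- b^-1)); apply: cvgMr; apply: pow_exp_cvg0.
  by apply/funext => n; rewrite /= expNb_pow expr0; ring.
rewrite (_ : (fun n => _) = fun n => b^-1 * (N.+1%:R * prim N (2 * n)%:R - (2 * n)%:R ^+ N.+1 * t ^+ n)).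
  rewrite -[X in _ --> X](mulr0 b^-1); apply: cvgMr.
  rewrite -[X in _ --> X]subr0; apply: cvgB; last exact: pow_exp_cvg0.
  by rewrite -[X in _ --> X](mulr0 N.+1%:R); apply: cvgMr.
by apply/funext => n; rewrite /= expNb_pow.
Qed.

Lemma var_cvg0 N : (fun n => var N (2 * n)%:R) @ \oo --> (0 : R).
Proof.
rewrite /var -[X in _ --> X]addr0; apply: cvgD.
  by rewrite -[X in _ --> X](mulr0 N%:R); apply: cvgMr; apply: prim_cvg0.
by rewrite -[X in _ --> X](mulr0 b); apply: cvgMr; apply: prim_cvg0.
Qed.

Lemma cvg_ge0 (f : nat -> R) l : (forall n, 0 <= f n) -> f @ \oo --> l -> 0 <= l.
Proof.
move=> f0 h; rewrite -(cvg_lim _ h) //; apply: limr_ge; first by apply/cvg_ex; exists l.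
by apply: nearW => n; apply: f0.
Qed.

Lemma gf_pow N l : gf (fun v => (2 * v)%:R ^+ N) t l ->
  `|2 * l - N`!%:R / b ^+ N.+1| <= 4 * (N`!%:R / b ^+ N).
Proof.
move=> hl; set F := N`!%:R / b ^+ N.+1; set F' := N`!%:R / b ^+ N.
pose S n := series (fun v => (2 * v)%:R ^+ N * t ^+ v) n.+1.
have hS : S @ \oo --> l by rewrite /S (cvg_shiftS (series (fun v => (2 * v)%:R ^+ N * t ^+ v))).
pose A n := 2 * S n - 2 * 0 ^+ N - (prim N (2 * n)%:R - prim N 0).
have hA : A @ \oo --> 2 * l - 2 * 0 ^+ N - (0 - prim N 0).
  apply: cvgB; last by apply: cvgB; [exact: prim_cvg0|exact: cvg_cst].
  by apply: cvgB; [exact: cvgMr|exact: cvg_cst].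
pose B n := 2 * (var N (2 * n)%:R - var N 0).
have hB : B @ \oo --> 2 * (0 - var N 0).
  by apply: cvgMr; apply: cvgB; [exact: var_cvg0|exact: cvg_cst].
have AB n : 0 <= B n - A n /\ 0 <= B n + A n.
  have := riemann_sum N n; rewrite -/(S n) -/(A n) -/(B n) ler_norml => /andP[h1 h2].
  by split; move: h1 h2; lra.
have l1 : 0 <= 2 * (0 - var N 0) - (2 * l - 2 * 0 ^+ N - (0 - prim N 0)).
  exact: (cvg_ge0 (fun n => (AB n).1) (cvgB hB hA)).
have l2 : 0 <= 2 * (0 - var N 0) + (2 * l - 2 * 0 ^+ N - (0 - prim N 0)).
  exact: (cvg_ge0 (fun n => (AB n).2) (cvgD hB hA)).
move: l1 l2; rewrite prim0 -/F.
(* For N = 0 the subtracted term 1 adds 2 to the error, but the total variation is 1, half the bound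
   in [var0]; so the constant is 4 in both cases. *)
have hz : N = 0%N -> 0 ^+ N = 1 :> R /\ F' = 1 /\ - 1 <= var N 0.
  move=> N0; rewrite /F' N0 !expr0 fact0 divr1; split => //; split => //.
  rewrite /var mul0r add0r prim0 fact0 expr1 (_ : b * _ = -1) //.
  by field; rewrite gt_eqF.
have hp : (0 < N)%N -> 0 ^+ N = 0 :> R by move=> N0; rewrite expr0n eqn0Ngt N0.
have := var0 N; rewrite -/F'.
move: hz hp; move: (var N 0) (0 ^+ N) F F' => D0 Z G G' hz hp d2 l1 l2.
have [N0|N0] := posnP N; rewrite ler_norml.
  have [z1 [z2 z3]] := hz N0; rewrite z1 z2 in l1 l2 d2 *.
  by apply/andP; split; move: l1 l2 z3; clear -b0; lra.
have z1 := hp N0; rewrite z1 in l1 l2.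
by apply/andP; split; move: l1 l2 d2; clear -b0; lra.
Qed.
End PowerSum.

(** * The counts in which only the fixed points are ordered *)

Definition fixcount (m N a : nat) : nat := ((2 * a) ^ N * (m`! * sphere_count m a))%N.

Lemma sphere_count_mono m a a' : (a <= a')%N -> (sphere_count m a <= sphere_count m a')%N.
Proof.
move=> h; elim: m a a' h => [//|m IH] a a' h.
elim: a' h => [|a' IHa]; first by rewrite leqn0 => /eqP->.
rewrite leq_eqVlt => /orP[/eqP->//|]; rewrite ltnS => /IHa/leq_trans; apply.
by rewrite sphere_countS leq_addr.
Qed.

Lemma fixcount_mono m N a a' : (a <= a')%N -> (fixcount m N a <= fixcount m N a')%N.
Proof. by move=> h; rewrite !leq_mul ?sphere_count_mono ?leq_expl // leq_mul. Qed.

Lemma word_count_mono asc k j j' : (j <= j')%N -> (word_count asc k j <= word_count asc k j')%N.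
Proof.
case: k => [//|k]; elim: j' => [|j' IH]; first by rewrite leqn0 => /eqP->.
rewrite leq_eqVlt => /orP[/eqP->//|]; rewrite ltnS => /IH/leq_trans; apply.
by rewrite word_countS leq_addr.
Qed.

Lemma sum_orders_fixset n (tau : 'S_n) a : (0 < a)%N ->
  (\sum_g orders (L := 2 * a) tau (fixset tau) g)%N
  = fixcount #|fixset tau| (n - #|fixset tau|) a.
Proof.
move=> a0; have L0 : (0 < 2 * a)%N by rewrite muln_gt0.
have mn : (#|fixset tau| <= n)%N by rewrite -[X in (_ <= X)%N]card_ord max_card.
apply/eqP; rewrite -(eqn_pmul2l (_ : 0 < (2 * a) ^ #|fixset tau|)%N) ?expn_gt0 ?L0 //.
rewrite sum_orders_fix card_ord /fixcount mulnA -expnD subnKC //.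
rewrite -mulnA mulnCA; apply/eqP; congr (_ * (_ * _))%N.
by case: #|fixset tau| => [//|k]; rewrite word_count_true.
Qed.

(** [sphere_count_rec] times (m+1)! and (2a)^N; its factor 2a is read as one more free label. *)
Lemma fixcountS m N a : fixcount m.+2 N a = (fixcount m.+1 N.+1 a + m.+1 * m * fixcount m N a)%N.
Proof.
rewrite /fixcount expnS !factS.
transitivity ((2 * a) ^ N * (m.+1 * m`!) * (m.+2 * sphere_count m.+2 a))%N; first by lia.
rewrite sphere_count_rec; move: (sphere_count m.+1 a) (sphere_count m a) ((2 * a) ^ N)%N (m`!) => c1 c0 p f; lia.
Qed.

(** * Asymptotics *)

Section Link.
Variables (R : realType) (b : R).
Hypotheses (b0 : 0 < b).
Let t : R := expR (- (2 * b)).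

(** Convergence follows the recursion up from the power sums. A single point can carry any of the 2a
    letters, whence zeta(1,N) = zeta(0,N+1). *)
Lemma zeta_exists : exists z : nat -> nat -> R,
  (forall m N, gf (fun a => (fixcount m N a)%:R) t (z m N)) /\
  (forall N, z 1%N N = z 0%N N.+1) /\
  (forall m N, z m.+2 N = z m.+1 N.+1 + (m.+1 * m)%:R * z m N).
Proof.
have ex m : (forall N, exists l, gf (fun a => (fixcount m N a)%:R) t l) /\
            (forall N, exists l, gf (fun a => (fixcount m.+1 N a)%:R) t l).
  elim: m => [|m [IH0 IH1]]; split=> // N.
  - have [l hl] := gf_pow_ex b0 N; exists l; apply: gf_eq hl => // a.
    by rewrite /fixcount fact0 /= !muln1 natrX.
  - have [l hl] := gf_pow_ex b0 N.+1; exists l; apply: gf_eq hl => // a.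
    by rewrite /fixcount (_ : 1`! = 1)%N // mul1n /= sum_nat_const card_ord -natrX expnSr [(a * 2)%N]mulnC.
  have [l1 h1] := IH1 N.+1; have [l2 h2] := IH0 N.
  exists (l1 + (m.+1 * m)%:R * l2); apply: gf_eq (gfD h1 (gfZ (c := (m.+1 * m)%:R) h2)) => // a.
  by rewrite fixcountS natrD [in RHS]natrM.
pose z m N : R := limn (series (fun a => (fixcount m N a)%:R * t ^+ a)).
have hz m N : gf (fun a => (fixcount m N a)%:R) t (z m N).
  by have [l hl] := (ex m).1 N; rewrite /z (cvg_lim _ hl).
have uniq u l l' : gf u t l -> gf u t l' -> l = l'.
  by move=> h h'; rewrite -(cvg_lim _ h) // -(cvg_lim _ h').
exists z; split=> //; split=> [N|m N].
  apply: uniq (hz 1%N N) _; apply: gf_eq (hz 0%N N.+1) => // a.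
  by rewrite /fixcount fact0 /= !muln1 mul1n sum_nat_const card_ord expnSr [(a * 2)%N]mulnC.
apply: uniq (hz m.+2 N) _.
apply: gf_eq (gfD (hz m.+1 N.+1) (gfZ (c := (m.+1 * m)%:R) (hz m N))) => // a.
by rewrite fixcountS natrD [in RHS]natrM.
Qed.

Definition scaled_zeta (z : nat -> nat -> R) m N : R := 2 * b ^+ (N + m).+1 / ((N + m)`!)%:R * z m N.

Lemma scaled_zeta_props z :
  (forall m N, gf (fun a => (fixcount m N a)%:R) t (z m N)) ->
  (forall N, z 1%N N = z 0%N N.+1) ->
  (forall m N, z m.+2 N = z m.+1 N.+1 + (m.+1 * m)%:R * z m N) ->
  [/\ forall N, 1 - 4 * b <= scaled_zeta z 0 N <= 1 + 4 * b,
      forall N, 1 - 4 * b <= scaled_zeta z 1 N <= 1 + 4 * b &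
      forall m N, scaled_zeta z m.+2 N = scaled_zeta z m.+1 N.+1 + rec_coef (b ^+ 2) m N * scaled_zeta z m N].
Proof.
move=> h1 h2 h3; have bn : b != 0 by rewrite gt_eqF.
have fn k : (k`!)%:R != 0 :> R by rewrite pnatr_eq0 -lt0n fact_gt0.
have base N : 1 - 4 * b <= scaled_zeta z 0 N <= 1 + 4 * b.
  have hN : gf (fun v => (2 * v)%:R ^+ N) t (z 0%N N).
    by apply: gf_eq (h1 0%N N) => // a; rewrite /fixcount fact0 /= !muln1 natrX.
  have := gf_pow b0 hN; rewrite ler_norml => /andP[g1 g2].
  have c0 : 0 <= b ^+ N.+1 / (N`!)%:R by rewrite divr_ge0 // exprn_ge0 // ltW.
  have := ler_wpM2l c0 g1; have := ler_wpM2l c0 g2.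
  have e1 : b ^+ N.+1 / (N`!)%:R * (2 * z 0%N N - (N`!)%:R / b ^+ N.+1) = scaled_zeta z 0 N - 1.
    by rewrite /scaled_zeta addn0; field; rewrite ?fn ?expf_neq0.
  have e2 : b ^+ N.+1 / (N`!)%:R * (4 * ((N`!)%:R / b ^+ N)) = 4 * b.
    by rewrite exprS; field; rewrite fn expf_neq0.
  rewrite mulrN e1 e2 => u1 u2; apply/andP; split; move: u1 u2; clear - b0; lra.
have s1 N : scaled_zeta z 1 N = scaled_zeta z 0 N.+1 by rewrite /scaled_zeta h2 addn1 addn0.
split=> // [N|m N]; first by rewrite s1.
rewrite /scaled_zeta h3 mulrDr; congr (_ + _).
  by rewrite (_ : (N.+1 + m.+1 = N + m.+2)%N) //; lia.
rewrite /rec_coef !addnS !factS !natrM !exprS; field.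
have p : 0 <= N%:R + m%:R :> R by rewrite addr_ge0.
rewrite fn /=; apply/andP; split; rewrite gt_eqF //; move: p; clear - b0; lra.
Qed.

Lemma scaled_zeta_ge z : b <= 1/100 ->
  (forall N, 1 - 4 * b <= scaled_zeta z 0 N) -> (forall N, 1 - 4 * b <= scaled_zeta z 1 N) ->
  (forall m N, scaled_zeta z m.+2 N = scaled_zeta z m.+1 N.+1 + rec_coef (b ^+ 2) m N * scaled_zeta z m N) ->
  forall m N, 1 - 4 * b <= scaled_zeta z m N.
Proof.
move=> b1 h0 h1 h2 m.
have p0 : 0 <= 1 - 4 * b by move: b1; clear -b0; lra.
suff : (forall N, 1 - 4 * b <= scaled_zeta z m N) /\ (forall N, 1 - 4 * b <= scaled_zeta z m.+1 N) by case.
elim: m => [|m [IH0 IH1]]; split=> // N.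
rewrite h2; apply: le_trans (IH1 N.+1) _; rewrite lerDl mulr_ge0 //; last exact: le_trans (IH0 _).
by rewrite mulr_ge0 ?divr_ge0 // exprn_ge0 // ltW.
Qed.

(** Each of the A exceptional terms is at most M, because t^a <= 1. *)
Lemma gf_compare (u v : nat -> R) (U V c M : R) A :
  (forall a, 0 <= u a) -> 0 <= M -> gf u t U -> gf v t V ->
  (forall a, u a <= c * v a + (if (a < A)%N then M else 0)) ->
  U <= c * V + A%:R * M.
Proof.
move=> u0 M0 hU hV huv; have /andP[t0 t1] := expN_itv01 b0.
have ps n : 0 <= c * series (fun a => v a * t ^+ a) n + (minn n A)%:R * M
              - series (fun a => u a * t ^+ a) n.
  elim: n => [|n IH]; first by rewrite !series0 min0n; rewrite mulr0 mul0r addr0 subr0.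
  rewrite !seriesS; have := huv n; rewrite -(ler_pM2r (_ : 0 < t ^+ n)) ?exprn_gt0 // => h.
  have tn : M * t ^+ n <= M by rewrite ler_piMr // exprn_ile1 // ltW.
  case: ltnP h => nA h.
    have -> : minn n.+1 A = (minn n A).+1 by lia.
    rewrite -natr1; set k : R := (minn n A)%:R in IH *.
    by move: IH h tn; move: (series _ _) (series _ _) (t ^+ n) k => S1 S2 T k; clear - b0; lra.
  have -> : minn n.+1 A = minn n A by lia.
  set k : R := (minn n A)%:R in IH *.
  by move: IH h; move: (series _ _) (series _ _) (t ^+ n) k => S1 S2 T k; clear - b0; lra.
suff : 0 <= c * V + A%:R * M - U by rewrite subr_ge0.
apply: (cvg_ge0 (f := fun n => c * series (fun a => v a * t ^+ a) n + A%:R * M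
              - series (fun a => u a * t ^+ a) n)).
  move=> n; apply: le_trans (ps n) _; rewrite lerD2r lerD2l ler_wpM2r //.
  by rewrite ler_nat geq_minr.
by apply: cvgB hU; apply: cvgD; [apply: cvgMr|apply: cvg_cst].
Qed.
End Link.

(** * Comparison of the generating functions *)

Section Sandwich.
Variable R : realType.

Lemma expR1_le : expR 1 <= 49/16 :> R.
Proof.
have -> : expR 1 = expR (1/2) * expR (1/2) :> R by rewrite -expRD; congr expR; lra.
have h : expR (1/2) <= 7/4 :> R.
  have := @expR_le3 R (1/2); rewrite (_ : 0 <= 1/2 <= 1/2); last by apply/andP; split; lra.
  by move=> /(_ isT)/le_trans; apply; lra.
apply: (@le_trans _ _ (7/4 * (7/4))); last by lra.
by rewrite ler_pM // ltW // expR_gt0.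
Qed.

(** n^n / n! is a single term of the series of e^n. *)
Lemma natpow_le_fact n : n%:R ^+ n <= expR 1 ^+ n * (n`!)%:R :> R.
Proof.
rewrite -expRM_natl mulr1.
case: n => [|n]; first by rewrite expr0 fact0 expR0 mulr1.
have := @expR_ge1Dxn R n.+1%:R n (ler0n _ _).
rewrite -ler_pdivrMr ?ltr0n ?fact_gt0 //; apply: le_trans.
by rewrite lerDr.
Qed.

(** Put n = N + m and x = 1 + (n/2a)^2. Up to index n the recursion multiplies by 2a and adds at
    most (2a)^2 (x - 1) times the value before, so the bound (2a)^k x^k is inherited because x >=
    1. *)
Lemma fixcount_le m N a : (0 < a)%N ->
  (fixcount m N a)%:R <= (2 * a)%:R ^+ (N + m) * (1 + ((N + m)%:R / (2 * a)%:R) ^+ 2) ^+ (N + m) :> R.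
Proof.
move=> a0; have l0 : 0 < (2 * a)%:R :> R by rewrite ltr0n muln_gt0.
suff gen (x : R) (k n : nat) : 1 <= x -> (n%:R / (2 * a)%:R) ^+ 2 <= x - 1 ->
   ((k <= n)%N -> (k`! * sphere_count k a)%:R <= (2 * a)%:R ^+ k * x ^+ k) /\
   ((k.+1 <= n)%N -> (k.+1`! * sphere_count k.+1 a)%:R <= (2 * a)%:R ^+ k.+1 * x ^+ k.+1).
  set x := 1 + _ ^+ 2.
  have x1 : 1 <= x by rewrite lerDl sqr_ge0.
  have [|h _] := gen x m (N + m)%N x1 _; first by rewrite /x addrC addKr.
  have := h (leq_addl _ _) => {}h; rewrite /fixcount natrM natrX exprD -mulrA ler_wpM2l ?exprn_ge0 //.
  apply: le_trans h _; rewrite ler_wpM2l ?exprn_ge0 //.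
  by rewrite ler_weXn2l // leq_addl.
move=> x1 hx; elim: k => [|k [IH0 IH1]]; split=> // kn.
  - by rewrite fact0 /= muln1 !expr0 mulr1.
  - by rewrite /= sum_nat_const card_ord mul1n !expr1 mulnC ler_peMr // ltW.
have e : (k.+2`! * sphere_count k.+2 a)%N = (2 * a * (k.+1`! * sphere_count k.+1 a) + k.+1 * k * (k`! * sphere_count k a))%N.
  have := fixcountS k 0 a; rewrite /fixcount !expn0 !mul1n expn1 => ->; lia.
rewrite e natrD natrM [X in _ + X]natrM.
have h1 := IH1 (ltnW kn); have h0 := IH0 (ltnW (ltnW kn)).
have x0 : 0 <= x by apply: le_trans x1.
apply: (@le_trans _ _ ((2 * a)%:R * ((2 * a)%:R ^+ k.+1 * x ^+ k.+1) +
   ((2 * a)%:R ^+ 2 * (x - 1)) * ((2 * a)%:R ^+ k * x ^+ k))).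
  rewrite lerD //; first by rewrite ler_wpM2l // ltW.
  rewrite ler_pM //; apply: le_trans (ler_wpM2l (exprn_ge0 2 (ltW l0)) hx).
  rewrite expr_div_n mulrC divfK ?expf_neq0 ?gt_eqF // -natrX ler_nat.
  by move: kn; clear; nia.
have -> : (2 * a)%:R * ((2 * a)%:R ^+ k.+1 * x ^+ k.+1) + (2 * a)%:R ^+ 2 * (x - 1) * ((2 * a)%:R ^+ k * x ^+ k)
   = (2 * a)%:R ^+ k.+2 * (x ^+ k.+1 + (x - 1) * x ^+ k) by rewrite !exprS; ring.
rewrite ler_wpM2l ?exprn_ge0 // ?(ltW l0) //.
have xk : x ^+ k <= x ^+ k.+1 by rewrite exprS ler_peMl // exprn_ge0.
have xk' : 0 <= x - 1 by rewrite subr_ge0.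
have := ler_wpM2l xk' xk; rewrite [x ^+ k.+2]exprS; clear; lra.
Qed.

Variables (n : nat) (tau : 'S_n).
Hypothesis n0 : (0 < n)%N.
Let m := #|fixset tau|.
Let N := (n - m)%N.
Let mn : (m <= n)%N. Proof. by rewrite /m -[X in (_ <= X)%N]card_ord max_card. Qed.
Let NmE : (N + m = n)%N. Proof. by rewrite /N subnK. Qed.

Definition conj_word_count a := (\sum_(sg : 'S_n) word_count (ascent (tau ^ sg)%g) n.-1 (2 * a))%N.

Lemma conj_word_count_mono a a' : (a <= a')%N -> (conj_word_count a <= conj_word_count a')%N.
Proof. by move=> h; apply: leq_sum => sg _; apply: word_count_mono; rewrite leq_mul. Qed.

Lemma conj_word_count_upper a : (0 < a)%N ->
  (conj_word_count a)%:R <= (fixcount m N a)%:R * expR (n%:R / (2 * a)%:R + 2 * (n%:R / (2 * a)%:R) ^+ 2) :> R.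
Proof.
move=> a0; have L0 : (0 < 2 * a)%N by rewrite muln_gt0.
have l0 : 0 < (2 * a)%:R :> R by rewrite ltr0n.
have := @sum_orders_le _ (2 * a) tau _ (fixset tau) _ (@invariant_fixset _ tau) (finset.subsetT _) _.
rewrite cardsT card_ord sum_orders_perm // -/(conj_word_count a) sum_orders_fixset // -/m -/N => /(_ _ _) h.
have {}h : (((2 * a) ^ 2) ^ n * conj_word_count a <= ((2 * a) ^ 2 + 2 * a + 2 * n) ^ n * fixcount m N a)%N.
  by apply: h => [x|x]; rewrite ?inE // => _ ->.
move: h; move: (fixcount m N a) => F h.
rewrite -(ler_nat R) !(natrM, natrX, natrD) -!(natrM _ 2 a) in h.
set l : R := (2 * a)%:R in h l0 *; clearbody l.
have lp : 0 < (l ^+ 2) ^+ n by rewrite !exprn_gt0.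
rewrite -(ler_pM2l lp); apply: le_trans h _.
rewrite [leRHS]mulrCA [leLHS]mulrC; apply: ler_wpM2l; first exact: ler0n.
have -> : n%:R / l + 2 * (n%:R / l) ^+ 2 = n%:R * ((l + 2 * n%:R) / l ^+ 2).
  by field; rewrite gt_eqF.
rewrite expRM_natl -exprMn lerXn2r // ?nnegrE ?mulr_ge0 ?addr_ge0 ?exprn_ge0 ?expR_ge0 ?(ltW l0) //.
have -> : (l ^+ 2 + l + 2 * n%:R) = l ^+ 2 * (1 + (l + 2 * n%:R) / l ^+ 2).
  by field; rewrite gt_eqF.
by rewrite ler_wpM2l ?exprn_ge0 ?expR_ge1Dx // ltW.
Qed.

Lemma conj_word_count_lower a : (0 < a)%N ->
  (1 - n%:R / (2 * a)%:R - (n%:R / (2 * a)%:R) ^+ 2) * (fixcount m N a)%:R <= (conj_word_count a)%:R :> R.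
Proof.
move=> a0; have L0 : (0 < 2 * a)%N by rewrite muln_gt0.
have l0 : 0 < (2 * a)%:R :> R by rewrite ltr0n.
have := @sum_orders_ge _ (2 * a) tau.
rewrite card_ord sum_orders_perm // -/(conj_word_count a) sum_orders_fixset // -/m -/N.
have cn : (#|~: fixset tau| <= n)%N by rewrite -[X in (_ <= X)%N]card_ord max_card.
move=> h; have {}h : ((2 * a) ^ 2 * fixcount m N a <= (2 * a) ^ 2 * conj_word_count a + n * (n + 2 * a) * fixcount m N a)%N.
  by apply: leq_trans h _; rewrite leq_add2l !leq_mul.
move: h; move: (fixcount m N a) => F' h.
rewrite -(ler_nat R) !(natrM, natrX, natrD) in h.
rewrite -(natrM _ 2 a) in h.
set l : R := (2 * a)%:R in h l0 *; clearbody l; set F : R := F'%:R in h *; set w : R := (conj_word_count a)%:R in h *.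
rewrite -(ler_pM2l (exprn_gt0 2 l0)).
have -> : l ^+ 2 * ((1 - n%:R / l - (n%:R / l) ^+ 2) * F) = l ^+ 2 * F - n%:R * (n%:R + l) * F.
  by field; rewrite gt_eqF.
by rewrite lerBlDr.
Qed.
End Sandwich.

Definition peak_sum (R : realType) n (tau : 'S_n) (t : R) : R :=
  \sum_(sg : 'S_n) 2^-1 * ((1 + t) / (1 - t)) ^+ n.+1 * (4 * t / (1 + t) ^+ 2) ^+ (peaks (tau ^ sg)%g).+1.

Lemma gf_conj_word_count (R : realType) n (tau : 'S_n) (t : R) : (0 < n)%N -> 0 < t < 1 ->
  gf (fun a => (conj_word_count tau a)%:R) t (peak_sum tau t).
Proof.
move=> n0 ht.
rewrite /peak_sum.
have h (sg : 'S_n) : gf (fun a => (word_count (ascent (tau ^ sg)%g) n.-1 (2 * a))%:R) t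
    (2^-1 * ((1 + t) / (1 - t)) ^+ n.+1 * (4 * t / (1 + t) ^+ 2) ^+ (peaks (tau ^ sg)%g).+1).
  have := (gf_peak ht (ascent (tau ^ sg)%g) n.-1).1.
  by rewrite (_ : n.-1.+2 = n.+1) ?prednK // -peaksE.
have hs := gf_sum (r := index_enum {perm 'I_n}) h.
by apply: gf_eq hs => // a; rewrite /conj_word_count natr_sum.
Qed.

(** As b <= 1/16, the lower end is at least 1, so rounding up stays within a factor 2. *)
Lemma cutoff_exists (R : realType) (b : R) n : (0 < n)%N -> 0 < b <= 1/16 ->
  exists A : nat, n%:R / (16 * b) <= A%:R <= n%:R / (8 * b).
Proof.
move=> n0 /andP[b0 b1]; set x := n%:R / (16 * b).
have x1 : 1 <= x.
  rewrite ler_pdivlMr ?mulr_gt0 // mul1r; apply: (@le_trans _ _ 1); last by rewrite ler1n.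
  by move: b1; clear; lra.
have x0 : 0 <= x by apply: le_trans x1.
have /andP[h1 h2] := Num.Theory.truncn_itv x0.
exists (Num.trunc x).+1; rewrite ltW //=.
have -> : n%:R / (8 * b) = 2 * x by rewrite /x; field; rewrite gt_eqF.
by rewrite -natr1; move: h1 x1; clear; lra.
Qed.

(* The comparison of the two counts fails for a below n/b, but these a contribute
   only a fraction n e^(-n/8). *)
Lemma tail_bound (R : realType) (b : R) n m N A : (0 < n)%N -> (N + m = n)%N -> 0 < b <= 1/100 ->
  n%:R / (16 * b) <= A%:R <= n%:R / (8 * b) ->
  A%:R * (fixcount m N A)%:R <= n%:R / 8 * expR (- (n%:R / 8)) * ((n`!)%:R / b ^+ n.+1) :> R.
Proof.
move=> n0 Nm /andP[b0 b1] /andP[A1 A2].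
have nr : 0 < n%:R :> R by rewrite ltr0n.
have A0 : 0 < A%:R :> R by apply: lt_le_trans A1; rewrite divr_gt0 // mulr_gt0.
have A0n : (0 < A)%N by rewrite ltr0n in A0.
set l : R := (2 * A)%:R; have lE : l = 2 * A%:R by rewrite /l natrM.
have l0 : 0 < l by rewrite lE mulr_gt0.
have l1 : n%:R / 8 <= l * b.
  by rewrite lE -ler_pdivrMr // -ler_pdivrMl //; apply: le_trans A1; rewrite le_eqVlt; apply/orP; left; apply/eqP; field; rewrite gt_eqF.
have l2 : l * b <= n%:R / 4.
  by rewrite lE -ler_pdivlMr // -ler_pdivlMl //; apply: le_trans A2 _; rewrite le_eqVlt; apply/orP; left; apply/eqP; field; rewrite gt_eqF.
have q0 : 0 <= n%:R / l <= 8 * b.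
  rewrite divr_ge0 ?(ltW l0) //= ler_pdivrMr //; move: l1; clear; lra.
case/andP: q0 => q0 q1.
have f1 := @fixcount_le R m N A A0n; rewrite Nm -/l in f1.
have e1 : (1 + (n%:R / l) ^+ 2) ^+ n <= expR (n%:R / 8).
  apply: (@le_trans _ _ (expR ((n%:R / l) ^+ 2) ^+ n)).
    by rewrite lerXn2r ?nnegrE ?addr_ge0 ?sqr_ge0 ?expR_ge0 ?expR_ge1Dx.
  rewrite -expRM_natl ler_expR ler_wpM2l //.
  apply: (@le_trans _ _ ((8 * b) ^+ 2)); first by rewrite lerXn2r ?nnegrE // mulr_ge0 // ltW.
  by move: b0 b1; clear; nra.
(* n^n <= e^n n! turns (n/4)^n into (e/4)^n n!, and e/4 <= e^(-1/4). This decay e^(-n/4) outweighs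
   the growth e^(n/8) in [e1]. *)
have e2 : (l * b) ^+ n <= expR (- (n%:R / 4)) * (n`!)%:R.
  apply: (@le_trans _ _ ((n%:R / 4) ^+ n)).
    by rewrite lerXn2r ?nnegrE ?divr_ge0 // mulr_ge0 // ltW.
  rewrite expr_div_n ler_pdivrMr ?exprn_gt0 //.
  apply: le_trans (@natpow_le_fact R n) _.
  rewrite mulrAC ler_wpM2r //.
  rewrite (_ : - (n%:R / 4) = n%:R * - (1/4)); last by field.
  rewrite expRM_natl -exprMn lerXn2r ?nnegrE ?mulr_ge0 ?expR_ge0 //.
  have g0 : 0 <= 1/4 :> R by lra.
  have g := @expRN_ge3 R (1/4) g0; have e := @expR1_le R.
  apply: le_trans e _; rewrite -ler_pdivrMr //; apply: le_trans g; rewrite !exprS expr0; clear; lra.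
have bn : 0 < b ^+ n by rewrite exprn_gt0.
have e3 : (fixcount m N A)%:R * b ^+ n <= expR (- (n%:R / 8)) * (n`!)%:R.
  apply: (@le_trans _ _ ((l ^+ n * (1 + (n%:R / l) ^+ 2) ^+ n) * b ^+ n)); first by rewrite ler_wpM2r // ltW.
  rewrite mulrAC -exprMn.
  apply: (@le_trans _ _ (expR (- (n%:R / 4)) * (n`!)%:R * expR (n%:R / 8))).
    by apply: ler_pM => //; rewrite exprn_ge0 // ?addr_ge0 ?sqr_ge0 // mulr_ge0 // ltW.
  rewrite mulrAC -expRD (_ : - (n%:R / 4) + n%:R / 8 = - (n%:R / 8)) //; by field.
have Ab : A%:R * b <= n%:R / 8 by move: l2; rewrite lE; clear; lra.
have bn1 : 0 < b ^+ n.+1 by rewrite exprn_gt0.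
rewrite mulrA ler_pdivlMr // exprS.
rewrite (_ : A%:R * _ * (b * b ^+ n) = (A%:R * b) * ((fixcount m N A)%:R * b ^+ n)); last by ring.
rewrite -[leRHS]mulrA.
by apply: ler_pM => //; rewrite mulr_ge0 // ltW.
Qed.

(** For a >= A one has n/(2a) <= 8b, so the two counts agree up to a factor between 1 - 16b and 1 +
    16b. For a < A both are bounded by their values at A, since they increase with a, and by
    [tail_bound] this part is a fraction rho of zeta. *)
Lemma sandwich (R : realType) (b : R) n (tau : 'S_n) (z : nat -> nat -> R) :
  (0 < n)%N -> 0 < b <= 1/100 ->
  (forall m N, gf (fun a => (fixcount m N a)%:R) (expR (- (2 * b))) (z m N)) ->
  (forall m N, 1 - 4 * b <= scaled_zeta b z m N) ->
  let m := #|fixset tau| in let N := (n - m)%N in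
  let rho := n%:R * expR (- (n%:R / 8)) in
  let X := 2 * b ^+ n.+1 / (n`!)%:R * peak_sum tau (expR (- (2 * b))) in
  (1 - 16 * b) * (1 - rho) * scaled_zeta b z m N <= X /\ X <= (1 + 16 * b) * (1 + rho) * scaled_zeta b z m N.
Proof.
move=> n0 hb hz hs m N rho; cbv zeta; have /andP[b0 b1] := hb.
set t := expR (- (2 * b)) in hz *.
have ht : 0 < t < 1 by apply: expN_itv01.
have mn : (m <= n)%N by rewrite /m -[X in (_ <= X)%N]card_ord max_card.
have NmE : (N + m = n)%N by rewrite /N subnK.
have nr : 0 < n%:R :> R by rewrite ltr0n.
have [A hA] : exists A : nat, n%:R / (16 * b) <= A%:R <= n%:R / (8 * b).
  by apply: cutoff_exists => //; rewrite b0 /=; move: b1; clear; lra.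
have /andP[A1 A2] := hA.
have A0 : 0 < A%:R :> R by apply: lt_le_trans A1; rewrite divr_gt0 // mulr_gt0.
have A0n : (0 < A)%N by rewrite ltr0n in A0.
set K := 2 * b ^+ n.+1 / (n`!)%:R.
have K0 : 0 < K by rewrite !mulr_gt0 ?exprn_gt0 ?invr_gt0 ?ltr0n ?fact_gt0.
have scE : scaled_zeta b z m N = K * z m N by rewrite /scaled_zeta NmE.
set Z := z m N in scE; set G := peak_sum tau t.
have hG : gf (fun a => (conj_word_count tau a)%:R) t G by apply: gf_conj_word_count.
have tail : A%:R * (fixcount m N A)%:R <= rho * Z.
  apply: le_trans (tail_bound n0 NmE hb hA) _.
  have Zl : (1 - 4 * b) * ((n`!)%:R / (2 * b ^+ n.+1)) <= Z.
    rewrite -(ler_pM2l K0) -scE; apply: le_trans (hs m N); rewrite le_eqVlt; apply/orP; left; apply/eqP.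
    rewrite /K; field.
    by rewrite expf_neq0 ?gt_eqF // ltr0n fact_gt0.
  rewrite /rho; apply: le_trans (ler_wpM2l _ Zl); last by rewrite mulr_ge0 // ?expR_ge0 // ltW.
  rewrite (_ : (1 - 4 * b) * _ = (1 - 4 * b) / 2 * ((n`!)%:R / b ^+ n.+1)); last by field; rewrite expf_neq0 ?gt_eqF.
  rewrite [leRHS]mulrA ler_wpM2r ?divr_ge0 ?exprn_ge0 ?(ltW b0) //.
  have P0 : 0 <= n%:R * expR (- (n%:R / 8)) :> R by apply: mulr_ge0; [exact: ltW|exact: expR_ge0].
  have b1' : 0 <= 1/100 - b by rewrite subr_ge0.
  move: P0; set E := expR _; set q : R := n%:R => P0.
  have := mulr_ge0 P0 b1'; move: E q P0 => E q; clear; lra.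
have eta a : (A <= a)%N -> (0 : R) <= n%:R / (2 * a)%:R <= 8 * b.
  move=> Aa; have a0 : (0 < a)%N by apply: leq_trans Aa.
  rewrite divr_ge0 //= ler_pdivrMr ?ltr0n ?muln_gt0 // natrM.
  have h : A%:R <= a%:R :> R by rewrite ler_nat.
  move: A1; rewrite ler_pdivrMr ?mulr_gt0 // => A1'.
  apply: le_trans A1' _; rewrite (_ : 8 * b * (2 * a%:R) = a%:R * (16 * b)); last by ring.
  by rewrite ler_wpM2r // mulr_ge0 // ltW.
have up a : (A <= a)%N -> (conj_word_count tau a)%:R <= (1 + 16 * b) * (fixcount m N a)%:R :> R.
  move=> Aa; have a0 : (0 < a)%N by apply: leq_trans Aa.
  apply: le_trans (conj_word_count_upper R tau n0 a0) _; rewrite mulrC ler_wpM2r //.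
  have := eta a Aa; set e := _ / _ => /andP[e0 e1].
  have e2 : e + 2 * e ^+ 2 <= 10 * b by move: e0 e1 b0 b1; clear; nra.
  have b1' : - (1 / 2) <= 10 * b <= 1/2 by apply/andP; split; move: b0 b1; clear; lra.
  apply: (@le_trans _ _ (expR (10 * b))); first by rewrite ler_expR.
  apply: le_trans (expR_le_quad b1') _.
  by move: b0 b1; clear; nra.
have lo a : (A <= a)%N -> (1 - 16 * b) * (fixcount m N a)%:R <= (conj_word_count tau a)%:R :> R.
  move=> Aa; have a0 : (0 < a)%N by apply: leq_trans Aa.
  apply: le_trans (conj_word_count_lower R tau n0 a0); rewrite ler_wpM2r //.
  have := eta a Aa; set e := _ / _ => /andP[e0 e1].
  by move: e0 e1 b0 b1; clear; nra.
have c2 : 0 < 1 - 16 * b by move: b1; clear; lra.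
have c1 : 0 < 1 + 16 * b by move: b0; clear; lra.
have GU : G <= (1 + 16 * b) * Z + A%:R * (conj_word_count tau A)%:R.
  apply: (gf_compare b0 _ _ hG (hz m N)) => // a.
  case: ltnP => aA; last by rewrite addr0; apply: up.
  rewrite -[leLHS]add0r lerD ?mulr_ge0 ?(ltW c1) // ler_nat; exact/conj_word_count_mono/ltnW.
have GL : Z <= (1 - 16 * b)^-1 * G + A%:R * (fixcount m N A)%:R.
  apply: (gf_compare b0 _ _ (hz m N) hG) => // a.
  case: ltnP => aA; last by rewrite addr0 ler_pdivlMl //; apply: lo.
  rewrite -[leLHS]add0r lerD ?mulr_ge0 ?invr_ge0 ?(ltW c2) // ler_nat; exact/fixcount_mono/ltnW.
rewrite scE; split.
  rewrite mulrCA ler_pM2l // -mulrA -ler_pdivlMl // mulrBl mul1r lerBlDr.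
  by apply: le_trans GL _; rewrite lerD2l.
rewrite [leRHS]mulrCA ler_pM2l //; clearbody rho.
have -> : (1 + 16 * b) * (1 + rho) * Z = (1 + 16 * b) * Z + (1 + 16 * b) * (rho * Z) by ring.
apply: le_trans GU _; rewrite lerD2l.
apply: (@le_trans _ _ (A%:R * ((1 + 16 * b) * (fixcount m N A)%:R))).
  by rewrite ler_wpM2l // up.
by rewrite mulrCA ler_wpM2l // ltW.
Qed.

(** * Expansion of b in terms of w *)

Section Expansion.
Variable R : realType.
Implicit Types (x u U : R).

Definition lnpoly x := x - x ^+ 2 / 2 + x ^+ 3 / 3 - x ^+ 4 / 4 + x ^+ 5 / 5 - x ^+ 6 / 6.

Lemma is_derive_ln_lnpoly x : -1 < x ->
  is_derive x 1 (fun y => ln (1 + y) - lnpoly y) (x ^+ 6 / (1 + x)).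
Proof.
move=> x1; have p : 0 < 1 + x by move: x1; clear; lra.
have d1 : is_derive x 1 (fun y : R => 1 + y) 1.
  by apply: is_derive_eq; rewrite ?addr0 ?add0r ?mulr1.
have d2 := @is_derive1_comp R (@ln R) (fun y : R => 1 + y) x _ _ (is_derive1_ln p) d1.
rewrite /comp in d2.
rewrite /lnpoly; apply: is_derive_eq; rewrite /GRing.scale /=.
by field; rewrite gt_eqF.
Qed.

(** Degree six leaves an error of order u^7, which becomes U^3 for U = u^2 after division by u in
    [expansion]. *)
Lemma ln_taylor x : - (1/2) <= x <= 1/2 -> `|ln (1 + x) - lnpoly x| <= 2 * `|x| ^+ 7.
Proof.
case/andP=> x1 x2.
have key c : - (1/2) <= c <= 1/2 -> `|c| <= `|x| -> `|c ^+ 6 / (1 + c)| <= 2 * `|x| ^+ 6.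
  case/andP=> c1 c2 cx; rewrite normrM normrX normfV (@ger0_norm _ (1 + c)); last by move: c1; clear; lra.
  rewrite mulrC ler_pM ?invr_ge0 ?exprn_ge0 //; first by move: c1; clear; lra.
    by rewrite invf_ple ?posrE //; move: c1; clear; lra.
  by rewrite lerXn2r ?nnegrE.
have f0 : ln (1 + 0) - lnpoly 0 = 0 :> R.
  by rewrite addr0 ln1 /lnpoly !expr0n /= !mul0r; ring.
have fin c : - (1/2) <= c <= 1/2 -> `|c| <= `|x| -> `|ln (1 + x) - lnpoly x| = `|c ^+ 6 / (1 + c)| * `|x| ->
   `|ln (1 + x) - lnpoly x| <= 2 * `|x| ^+ 7.
  by move=> hc cx ->; rewrite [`|x| ^+ 7]exprSr mulrA ler_wpM2r // key.
have [x0|x0] := leP 0 x.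
  have hd y : 0 <= y <= x -> is_derive y 1 (fun y => ln (1 + y) - lnpoly y) (y ^+ 6 / (1 + y)).
    by case/andP=> h1 h2; apply: is_derive_ln_lnpoly; move: h1; clear; lra.
  have [c /andP[c1 c2] e] := MVT_global x0 hd.
  rewrite f0 !subr0 in e.
  apply: (fin c); first by apply/andP; split; move: c1 c2 x2; clear; lra.
    by rewrite !ger0_norm.
  by rewrite e normrM.
have hd y : x <= y <= 0 -> is_derive y 1 (fun y => ln (1 + y) - lnpoly y) (y ^+ 6 / (1 + y)).
  by case/andP=> h1 h2; apply: is_derive_ln_lnpoly; move: h1 x1; clear; lra.
have [c /andP[c1 c2] e] := MVT_global (ltW x0) hd.
rewrite f0 !sub0r in e.
apply: (fin c); first by apply/andP; split; move: c1 c2 x1; clear; lra.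
  by rewrite !ler0_norm ?lerN2 // ltW.
by rewrite -normrN e normrM normrN.
Qed.

(** Here u = tanh b, U = 1 - w and th = -ln w. The series of the logarithm give th = U + U^2/2 +
    O(U^3) and b/u = 1 + U/3 + U^2/5 + O(U^3), and eliminating U gives the estimates. An error U^3
    suffices, since n U^3 will be of order n^(-1/2). *)
Lemma expansion u : 0 < u <= 1/10 ->
  let U := u ^+ 2 in
  let th := - ln (1 - U) in
  let b := (ln (1 + u) - ln (1 - u)) / 2 in
  [/\ 0 < b, U <= th <= 2 * U, b ^+ 2 <= 2 * U,
      `|b ^+ 2 - (th + th ^+ 2 / 6)| <= 10 * U ^+ 3 &
      `|b ^+ 4 - th ^+ 2| <= 10 * U ^+ 3 /\
      `|ln (b / u) - (th / 3 - th ^+ 2 / 45)| <= 10 * U ^+ 3].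
Proof.
case/andP=> u0 u1 U th b.
have U0 : 0 < U by rewrite exprn_gt0.
have U1 : U <= 1/100 by rewrite /U; move: u0 u1; clear; nra.
have U3 : 0 < U ^+ 3 by rewrite exprn_gt0.
have Uk k : U ^+ (3 + k) <= (1/100) ^+ k * U ^+ 3.
  by rewrite exprD mulrC ler_wpM2r ?(ltW U3) // lerXn2r ?nnegrE ?(ltW U0).
have [t1 t2] : - (U ^+ 3) <= th - U - U ^+ 2 / 2 /\ th - U - U ^+ 2 / 2 <= U ^+ 3.
  have hU : - (1/2) <= - U <= 1/2 by apply/andP; split; move: U0 U1; clear; lra.
  have := ln_taylor hU; rewrite normrN (ger0_norm (ltW U0)) ler_norml => /andP[l1 l2].
  have pE : lnpoly (- U) = - (U + U ^+ 2 / 2 + U ^+ 3 / 3 + U ^+ 4 / 4 + U ^+ 5 / 5 + U ^+ 6 / 6).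
    by rewrite /lnpoly; field.
  rewrite pE in l1 l2.
  have k1 := Uk 1%N; have k2 := Uk 2%N; have k3 := Uk 3%N; have k4 := Uk 4%N.
  have [q4 q5 q6 q7] : [/\ 0 <= U ^+ 4, 0 <= U ^+ 5, 0 <= U ^+ 6 & 0 <= U ^+ 7].
    by split; rewrite exprn_ge0 // ltW.
  rewrite ![(3 + _)%N]/= !exprS !expr0 in k1 k2 k3 k4.
  rewrite /th; split; move: l1 l2 k1 k2 k3 k4 q4 q5 q6 q7 U3; rewrite !exprS !expr0; clear; lra.
pose c := b / u; pose x := c - 1.
have bE : b = u * (1 + x) by rewrite /x /c; field; rewrite gt_eqF.
have [x1 x2] : - (2 * U ^+ 3) <= x - U / 3 - U ^+ 2 / 5 /\ x - U / 3 - U ^+ 2 / 5 <= 2 * U ^+ 3.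
  have hu : - (1/2) <= u <= 1/2 by apply/andP; split; move: u0 u1; clear; lra.
  have hu' : - (1/2) <= - u <= 1/2 by apply/andP; split; move: u0 u1; clear; lra.
  have := ln_taylor hu; rewrite (ger0_norm (ltW u0)) ler_norml => /andP[l1 l2].
  have := ln_taylor hu'; rewrite normrN (ger0_norm (ltW u0)) ler_norml => /andP[l3 l4].
  have pE : lnpoly u - lnpoly (- u) = 2 * (u * (1 + U / 3 + U ^+ 2 / 5)).
    by rewrite /lnpoly /U; field.
  have u7 : u ^+ 7 = u * U ^+ 3 by rewrite /U; ring.
  rewrite u7 in l1 l2 l3 l4.
  have b2 : ln (1 + u) - ln (1 - u) = 2 * (u * (1 + x)) by rewrite -bE /b; field.
  have k1 : u * (- (2 * U ^+ 3)) <= u * (x - U / 3 - U ^+ 2 / 5).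
    by move: b2 pE l1 l2 l3 l4; move: (lnpoly u) (lnpoly (- u)) (ln _) (ln _) (U ^+ 3) => P Q X Y T; clear; lra.
  have k2 : u * (x - U / 3 - U ^+ 2 / 5) <= u * (2 * U ^+ 3).
    by move: b2 pE l1 l2 l3 l4; move: (lnpoly u) (lnpoly (- u)) (ln _) (ln _) (U ^+ 3) => P Q X Y T; clear; lra.
  by rewrite !ler_pM2l // in k1 k2.
have U2b : U ^+ 2 <= 1/100 * U by rewrite expr2 ler_wpM2r // ltW.
have U3b : U ^+ 3 <= 1/100 * U ^+ 2 by rewrite exprS ler_wpM2r // exprn_ge0 // ltW.
have U20 : 0 < U ^+ 2 by rewrite exprn_gt0.
have UU : U * U ^+ 2 = U ^+ 3 by rewrite exprS.
have x0 : 0 <= x by move: x1 U3b U2b U0 U20; clear; lra.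
have x3 : x <= 4/10 * U by move: x2 U3b U2b U0 U20; clear; lra.
have xm : - (1/2) <= x <= 1/2 by apply/andP; split; move: x0 x3 U1; clear; lra.
have xU : x ^+ 2 <= 2/10 * U ^+ 2.
  apply: (@le_trans _ _ ((4/10 * U) ^+ 2)).
    by rewrite lerXn2r ?nnegrE // mulr_ge0 // ?(ltW U0) //; lra.
  by rewrite exprMn; move: U20; clear; lra.
have x20 : 0 <= x ^+ 2 by apply: sqr_ge0.
have th1 : - (6/10 * U ^+ 2) <= th - U /\ th - U <= 6/10 * U ^+ 2.
  by split; move: t1 t2 U3b U20; clear; lra.
have th2 : U <= th by move: t1 U3b U20; clear; lra.
have th3 : th <= 2 * U by move: th1.2 U2b U0; clear; lra.
have th2E : - (2 * U ^+ 3) <= th ^+ 2 - U ^+ 2 /\ th ^+ 2 - U ^+ 2 <= 2 * U ^+ 3.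
  have p1 : 0 <= th + U <= 3 * U by apply/andP; split; move: th2 th3 U0; clear; lra.
  case/andP: p1 => p1 p2.
  have -> : th ^+ 2 - U ^+ 2 = (th - U) * (th + U) by ring.
  have m1 := ler_wpM2r p1 th1.1; have m2 := ler_wpM2r p1 th1.2.
  have m3 := ler_wpM2l (ltW U20) p2.
  by split; move: m1 m2 m3 UU U3; move: (th - U) (th + U) => P Q; rewrite mulrCA; clear; nra.
have b2E : b ^+ 2 = U + 2 * U * x + U * x ^+ 2 by rewrite bE /U; ring.
have Ux1 := ler_wpM2l (ltW U0) x1; have Ux2 := ler_wpM2l (ltW U0) x2.
have UxU := ler_wpM2l (ltW U0) xU; have Ux0 := mulr_ge0 (ltW U0) x20.
have U4 : U * U ^+ 3 <= 1/100 * U ^+ 3 by rewrite ler_wpM2r // ltW.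
have b0 : 0 < b by rewrite bE mulr_gt0 //; move: x0; clear; lra.
have b2u : b ^+ 2 <= U + U ^+ 2.
  by rewrite b2E; move: Ux2 UxU U4 U3b U20 U3; clear; lra.
have b2l : U <= b ^+ 2 by rewrite b2E; have := mulr_ge0 (ltW U0) x0; move: Ux0; clear; lra.
have d1 : - (10 * U ^+ 3) <= b ^+ 2 - (th + th ^+ 2 / 6).
  by rewrite b2E; move: Ux1 Ux0 U4 t2 th2E.2 U3; clear; lra.
have d2 : b ^+ 2 - (th + th ^+ 2 / 6) <= 10 * U ^+ 3.
  by rewrite b2E; move: Ux2 UxU U4 t1 th2E.1 U3; clear; lra.
have b4 : - (10 * U ^+ 3) <= b ^+ 4 - th ^+ 2 <= 10 * U ^+ 3.
  have q1 : - (2 * U ^+ 2) <= b ^+ 2 - th by move: b2l th1.2 U20; clear; lra.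
  have q2 : b ^+ 2 - th <= 2 * U ^+ 2 by move: b2u th2 U20; clear; lra.
  have p1 : 0 <= b ^+ 2 + th by move: b2l th2 U0; clear; lra.
  have p2 : b ^+ 2 + th <= 4 * U by move: b2u th3 U2b U0; clear; lra.
  have -> : b ^+ 4 - th ^+ 2 = (b ^+ 2 - th) * (b ^+ 2 + th) by ring.
  have m1 := ler_wpM2r p1 q1; have m2 := ler_wpM2r p1 q2.
  have m3 := ler_wpM2l (ltW U20) p2.
  by apply/andP; split; move: m1 m2 m3 U3; clear; lra.
have lb : - (10 * U ^+ 3) <= ln (b / u) - (th / 3 - th ^+ 2 / 45) <= 10 * U ^+ 3.
  have -> : b / u = 1 + x by rewrite /x /c; ring.
  have := ln_taylor xm; rewrite (ger0_norm x0) ler_norml => /andP[l1 l2].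
  have xs : x <= 1/100 by move: x3 U1; clear; lra.
  have x30 : 0 <= x ^+ 3 by rewrite exprn_ge0.
  have xk k : 0 <= x ^+ (3 + k) <= (1/100) ^+ k * x ^+ 3.
    by rewrite exprn_ge0 //= exprD mulrC ler_wpM2r // lerXn2r ?nnegrE.
  have [/andP[y1 y1'] /andP[y2 y2'] /andP[y3 y3']] := And3 (xk 1%N) (xk 2%N) (xk 3%N).
  have /andP[y4 y4'] := xk 4%N.
  rewrite ![(3 + _)%N]/= in y1 y1' y2 y2' y3 y3' y4 y4'.
  have lp1 : x - x ^+ 2 / 2 - x ^+ 3 <= lnpoly x.
    by rewrite /lnpoly; move: y1 y1' y2 y2' y3 y3' x30; rewrite !expr1 !exprS; clear; lra.
  have lp2 : lnpoly x <= x - x ^+ 2 / 2 + x ^+ 3.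
    by rewrite /lnpoly; move: y1 y1' y2 y2' y3 y3' x30; rewrite !exprS; clear; lra.
  have xc : x ^+ 3 <= U ^+ 3.
    by rewrite lerXn2r ?nnegrE ?(ltW U0) //; move: x3 U0; clear; lra.
  have x7 : x ^+ 7 <= x ^+ 3.
    by apply: le_trans y4' _; rewrite ler_piMl // exprn_ile1 //; lra.
  have xq : - (U ^+ 3) <= x ^+ 2 - U ^+ 2 / 9 <= U ^+ 3.
    have q1 : - (3/10 * U ^+ 2) <= x - U / 3 by move: x1 U3b U20; clear; lra.
    have q2 : x - U / 3 <= 3/10 * U ^+ 2 by move: x2 U3b U20; clear; lra.
    have p1 : 0 <= x + U / 3 by move: x0 U0; clear; lra.
    have p2 : x + U / 3 <= U by move: x3 U0; clear; lra.
    have -> : x ^+ 2 - U ^+ 2 / 9 = (x - U / 3) * (x + U / 3) by field.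
    have m1 := ler_wpM2r p1 q1; have m2 := ler_wpM2r p1 q2.
    have m3 := ler_wpM2l (ltW U20) p2.
    by apply/andP; split; move: m1 m2 m3 U3; clear; lra.
  case/andP: xq => xq1 xq2.
  apply/andP; split.
    by move: l1 lp1 xc x7 xq2 x1 t2 th2E.1 U3 x30; move: (ln _) (lnpoly _) => X P; clear; lra.
  by move: l2 lp2 xc x7 xq1 x2 t1 th2E.2 U3 x30; move: (ln _) (lnpoly _) => X P; clear; lra.
split; rewrite ?th2 ?th3 ?ler_norml ?d1 ?d2 //.
by move: b2u U2b U0; clear; lra.
Qed.
End Expansion.

(** * The expectation over the class *)

(** Conjugation by each sg permutes the class, so the n! sums over the class are equal. *)
Lemma sum_peak_sum (R : realType) n lam (t : R) :
  \sum_(pi in conj_class n lam) peak_sum pi t =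
  2^-1 * ((1 + t) / (1 - t)) ^+ n.+1 * (4 * t / (1 + t) ^+ 2) * (n`!)%:R *
  \sum_(pi in conj_class n lam) (4 * t / (1 + t) ^+ 2) ^+ peaks pi.
Proof.
rewrite /peak_sum exchange_big /=; set w := 4 * t / _; set z := _ ^+ n.+1.
rewrite (eq_bigr (fun=> 2^-1 * z * w * \sum_(pi in conj_class n lam) w ^+ peaks pi)).
  rewrite sumr_const [RHS]mulrAC mulr_natr; congr (_ *+ _).
  by rewrite -card_Sn; apply: eq_card => sg; rewrite !inE.
move=> sg _; rewrite [in RHS](reindex_inj (conjg_inj sg)) /= big_distrr /=.
apply: eq_big => [pi|pi _]; first by rewrite conj_class_conj.
by rewrite exprS mulrA.
Qed.

Lemma exp_ge_1B (R : realType) (x : R) : 0 <= x <= 1/2 -> expR (- (2 * x)) <= 1 - x.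
Proof.
case/andP=> x0 x1; have h : 0 <= 2 * x by rewrite mulr_ge0.
by apply: le_trans (expRN_le2 h) _; move: x0 x1; clear; nra.
Qed.

(** With t = e^(-2b) and u = tanh b, z = 1/u and w = e^(-th). The average of the normalised
    [peak_sum] over the class is then (b/u)^(n+1) e^(-th) E, and [sandwich] and [zeta_bounds]
    enclose each summand, with the same bounds for the whole class. *)
Lemma core_bound (R : realType) n lam (th : R) : (0 < n)%N -> is_partition n lam ->
  0 < th -> th <= 1/100/100/2 ->
  let rho := n%:R * expR (- (n%:R / 8)) in rho <= 1/2 ->
  let u := Num.sqrt (1 - expR (- th)) in
  let b := (ln (1 + u) - ln (1 - u)) / 2 in
  let m := mult_part lam 1 in
  let E := unif_expect (conj_class n lam) (fun pi => expR (- th) ^+ peaks pi) in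
  0 < E /\ `|ln E - (th + n.+1%:R * ln (u / b) + Phi (b ^+ 2) m n)|
    <= Err (b ^+ 2) m n + 40 * b + 2 * rho.
Proof.
move=> n0 hlam th0 th1 rho rho1 u b m E.
pose U := 1 - expR (- th).
have U0 : 0 < U by rewrite subr_gt0 expR_lt1 oppr_lt0.
have Uth : U <= th by have := expR_ge1Dx (- th); rewrite /U; clear; lra.
have uU : u ^+ 2 = U by rewrite /u sqr_sqrtr // ltW.
have u0 : 0 < u by rewrite /u sqrtr_gt0.
have u1 : u <= 1/10.
  have U1 : u ^+ 2 <= 1/100 by rewrite uU; move: Uth th1; clear; lra.
  by move: U1 u0; clear; nra.
have hu : 0 < u <= 1/10 by rewrite u0 u1.
have [] := expansion hu; rewrite uU -/b.
have -> : - ln (1 - U) = th by rewrite /U opprB addrC subrK expRK opprK.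
move=> b0 _ b2 _ _.
have b1 : b <= 1/100.
  have B1 : b ^+ 2 <= 1/100/100 by move: b2 Uth th1; clear; lra.
  by move: B1 b0; clear; nra.
have p1 : 0 < 1 + u by move: u0; clear; lra.
have p2 : 0 < 1 - u by move: u1; clear; lra.
have tE : expR (- (2 * b)) = (1 - u) / (1 + u).
  rewrite /b -mulrN mulrC mulNr divfK ?pnatr_eq0 // opprB.
  by rewrite expRD expRN !lnK ?posrE.
set t := expR (- (2 * b)) in tE.
have zE : (1 + t) / (1 - t) = u^-1.
  rewrite tE; field; move: u0 u1; clear=> u0 u1.
  by do ?[apply/andP; split]; rewrite gt_eqF //; move: u0 u1; clear; lra.
have wE : 4 * t / (1 + t) ^+ 2 = expR (- th).
  have -> : expR (- th) = 1 - u ^+ 2 by rewrite uU /U opprB addrC subrK.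
  rewrite tE; field; move: u0 u1; clear=> u0 u1.
  by do ?[apply/andP; split]; rewrite gt_eqF //; move: u0 u1; clear; lra.
have hb : 0 < b <= 1/100 by rewrite b0 b1.
have [z [hz [hz1 hz2]]] := zeta_exists b0.
have [s0 s1 srec] := scaled_zeta_props b0 hz hz1 hz2.
have sge := scaled_zeta_ge b0 b1 (fun N => (andP (s0 N)).1) (fun N => (andP (s1 N)).1) srec.
have hB : 0 < b ^+ 2 <= 1/100/100.
  by rewrite exprn_gt0 //= expr2; move: b0 b1; clear; nra.
have c0 : 0 <= 1 - 4 * b by move: b1; clear; lra.
set N := (n - m)%N.
have [pi0 hpi0] := conj_class_neq0 hlam.
have fixm pi : pi \in conj_class n lam -> #|fixset pi| = m.
  by rewrite inE => /eqP e; rewrite fixset_card e.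
have mn : (m <= n)%N by rewrite -(fixm _ hpi0) -[X in (_ <= X)%N]card_ord max_card.
have NmE : (N + m = n)%N by rewrite /N subnK.
have := zeta_bounds hB c0 s0 s1 srec m N; rewrite NmE => /andP[zl zu].
set Z := scaled_zeta b z m N in zl zu.
set P := Phi _ _ _ in zl zu *; set Er := Err _ _ _ in zl zu *; clearbody P Er.
(* Below, 1 - 16b, 1 - 4b and 1 - rho are at least e^(-32b), e^(-8b) and e^(-2 rho), whence 40 b and
   2 rho; above, 1 + y <= e^y gives 20 b and rho. *)
set lo := expR (P - Er - 40 * b - 2 * rho); set hi := expR (P + Er + 20 * b + rho).
have rho0 : 0 <= rho by rewrite mulr_ge0 ?expR_ge0.
have loE : lo <= (1 - 16 * b) * (1 - rho) * Z.
  have q1 : expR (- (2 * (16 * b))) <= 1 - 16 * b.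
    by apply: exp_ge_1B; apply/andP; split; move: b0 b1; clear; lra.
  have q2 : expR (- (2 * (4 * b))) <= 1 - 4 * b.
    by apply: exp_ge_1B; apply/andP; split; move: b0 b1; clear; lra.
  have q3 : expR (- (2 * rho)) <= 1 - rho by apply: exp_ge_1B; rewrite rho0.
  apply: (@le_trans _ _ ((1 - 16 * b) * (1 - rho) * ((1 - 4 * b) * expR (P - Er)))).
    rewrite /lo (_ : P - Er - 40 * b - 2 * rho = - (2 * (16 * b)) + - (2 * rho) + (- (2 * (4 * b)) + (P - Er))); last by ring.
    rewrite !expRD; apply: ler_pM; rewrite ?mulr_ge0 ?expR_ge0 //; first by apply: ler_pM; rewrite ?expR_ge0.
    by rewrite ler_wpM2r // expR_ge0.
  rewrite ler_wpM2l // mulr_ge0 //; first by move: b1; clear; lra.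
  by move: rho1; clear; lra.
have hiE : (1 + 16 * b) * (1 + rho) * Z <= hi.
  have g1 : 0 <= 1 + 16 * b by move: b0; clear; lra.
  have g2 : 0 <= 1 + 4 * b by move: b0; clear; lra.
  have g3 : 0 <= 1 + rho by move: rho0; clear; lra.
  apply: (@le_trans _ _ ((1 + 16 * b) * (1 + rho) * ((1 + 4 * b) * expR (P + Er)))).
    by rewrite ler_wpM2l // mulr_ge0.
  rewrite /hi (_ : P + Er + 20 * b + rho = 16 * b + rho + (4 * b + (P + Er))); last by ring.
  rewrite [expR (_ + (_ + _))]expRD [expR (16 * b + rho)]expRD [expR (4 * b + _)]expRD.
  apply: ler_pM; [by rewrite mulr_ge0|by rewrite mulr_ge0 ?expR_ge0| |].
    by apply: ler_pM => //; apply: expR_ge1Dx.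
  by rewrite ler_wpM2r ?expR_ge0 ?expR_ge1Dx.
have each pi : pi \in conj_class n lam ->
    lo <= 2 * b ^+ n.+1 / (n`!)%:R * peak_sum pi t /\ 2 * b ^+ n.+1 / (n`!)%:R * peak_sum pi t <= hi.
  move=> hpi; have := sandwich pi n0 hb hz sge; cbv zeta; rewrite (fixm _ hpi) -/N -/Z -/t => -[h1 h2].
  by split; [apply: le_trans h1|apply: le_trans h2 _].
set C := conj_class n lam in each fixm hpi0 E *.
have cC : 0 < #|C|%:R :> R by rewrite ltr0n; apply/card_gt0P; exists pi0.
pose Q := (b / u) ^+ n.+1 * expR (- th).
have Q0 : 0 < Q by rewrite mulr_gt0 ?expR_gt0 // exprn_gt0 // divr_gt0.
have QE : #|C|%:R * (Q * E) = \sum_(pi in C) 2 * b ^+ n.+1 / (n`!)%:R * peak_sum pi t.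
  rewrite -big_distrr /= sum_peak_sum zE wE /E /unif_expect /Q expr_div_n exprVn.
  field; rewrite !gt_eqF // ?exprn_gt0 // ltr0n fact_gt0.
have bl : lo <= Q * E.
  rewrite -(ler_pM2l cC) QE [leLHS]mulr_natl -[leLHS]sumr_const.
  by apply: ler_sum => pi hpi; case: (each pi hpi).
have bu : Q * E <= hi.
  rewrite -(ler_pM2l cC) QE [leRHS]mulr_natl -[leRHS]sumr_const.
  by apply: ler_sum => pi hpi; case: (each pi hpi).
have E0 : 0 < E by rewrite -(pmulr_rgt0 _ Q0); apply: lt_le_trans bl; apply: expR_gt0.
split=> //.
clearbody t; clearbody b.
have lQE : ln (Q * E) = - (n.+1%:R * ln (u / b)) - th + ln E.
  have bu0 : 0 < b / u by rewrite divr_gt0.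
  have lub : ln (u / b) = - ln (b / u) by rewrite -lnV ?posrE // invf_div.
  have lQ : ln Q = n.+1%:R * ln (b / u) - th.
    by rewrite [ln Q]lnM ?posrE ?expR_gt0 ?exprn_gt0 // expRK lnXn // mulr_natl.
  by rewrite lnM ?posrE // lQ lub mulrN opprK.
have QE0 : 0 < Q * E by rewrite mulr_gt0.
have l1 : P - Er - 40 * b - 2 * rho <= ln (Q * E).
  by rewrite -[leLHS](@expRK R) ler_ln ?posrE ?expR_gt0.
have l2 : ln (Q * E) <= P + Er + 20 * b + rho.
  by rewrite -[leRHS](@expRK R) ler_ln ?posrE ?expR_gt0.
rewrite lQE in l1 l2.
set X := n.+1%:R * ln (u / b) in l1 l2 *; set Y := ln E in l1 l2 *; clearbody X Y.
by rewrite ler_norml; apply/andP; split; move: l1 l2 b0 rho0; clear; lra.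
Qed.

Lemma unif_expect_bounds (R : realType) n (A : {set 'S_n}) (f : 'S_n -> R) lo hi :
  (exists pi, pi \in A) -> (forall pi, pi \in A -> lo <= f pi <= hi) ->
  lo <= unif_expect A f <= hi.
Proof.
move=> [pi0 h0] h.
have cA : 0 < #|A|%:R :> R by rewrite ltr0n; apply/card_gt0P; exists pi0.
rewrite /unif_expect; apply/andP; split.
  rewrite ler_pdivlMr // mulr_natr -sumr_const.
  by apply: ler_sum => pi /h/andP[].
rewrite ler_pdivrMr // mulr_natr -sumr_const.
by apply: ler_sum => pi /h/andP[].
Qed.

Lemma peaks_le n (pi : 'S_n) : (peaks pi <= n)%N.
Proof. by rewrite /peaks -[X in (_ <= X)%N](size_iota 0 n) count_size. Qed.

Lemma mult_part_le n lam : is_partition n lam -> (mult_part lam 1 <= n)%N.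
Proof.
move=> /conj_class_neq0[pi]; rewrite inE => /eqP e.
by rewrite -e -fixset_card -[X in (_ <= X)%N]card_ord max_card.
Qed.

(** From e^y >= y^2/2 at y = n/8. *)
Lemma rho_le (R : realType) n : (0 < n)%N -> n%:R * expR (- (n%:R / 8)) <= 128 / n%:R :> R.
Proof.
move=> n0; have nr : 0 < n%:R :> R by rewrite ltr0n.
rewrite ler_pdivlMr // expRN mulrAC ler_pdivrMr ?expR_gt0 //.
have h := @expR_ge2 R (n%:R / 8) (divr_ge0 (ltW nr) (ler0n R 8)).
have h0 : 0 <= n%:R / 8 :> R by rewrite divr_ge0.
by move: h h0; move: (expR _) => X; clear; lra.
Qed.

Lemma main_term_le (R : realType) (a : R) : 0 <= a <= 1 ->
  0 <= (1 - a ^+ 3) / 3 <= 1 /\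
  - 1 <= 45^-1 + a ^+ 3 / 18 - 3 * a ^+ 5 / 10 + 2 * a ^+ 6 / 9 <= 1 /\
  - 1 <= 2/9 * a ^+ 6 - 3/10 * a ^+ 5 <= 1.
Proof.
case/andP=> a0 a1; have ai k : 0 <= a ^+ k <= 1 by rewrite exprn_ge0 //= exprn_ile1.
have [/andP[h1 h2] /andP[h3 h4] /andP[h5 h6]] := And3 (ai 3%N) (ai 5%N) (ai 6%N).
by do ?split; try (apply/andP; split); move: h1 h2 h3 h4 h5 h6; clear; lra.
Qed.

Lemma log_deviation (R : realType) n lam (th : R) : (0 < n)%N -> is_partition n lam ->
  0 < th -> th <= 1/100/100/2 -> (256 <= n)%N ->
  let a : R := (mult_part lam 1)%:R / n%:R in
  let E := unif_expect (conj_class n lam) (fun pi => expR (- th) ^+ peaks pi) in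
  0 < E /\
  exists2 b : R, 0 <= b /\ b ^+ 2 <= 2 * th &
  `|ln E - (- ((1 - a ^+ 3) / 3) * (th * n%:R) +
     (45^-1 + a ^+ 3 / 18 - 3 * a ^+ 5 / 10 + 2 * a ^+ 6 / 9) * (th ^+ 2 * n%:R))|
   <= (11 * 100) * th + (50 * 100) * (n%:R * th ^+ 3) + 40 * b + 256 / n%:R.
Proof.
move=> n0 hlam th0 th1 n256 a E; have nr : 0 < n%:R :> R by rewrite ltr0n.
have mn := mult_part_le hlam.
have ha : 0 <= a <= 1 by rewrite divr_ge0 //= ler_pdivrMr // mul1r ler_nat.
have [_ [_ /andP[q1 q2]]] := main_term_le ha.
have r1 : n%:R * expR (- (n%:R / 8)) <= 1/2 :> R.
  apply: le_trans (@rho_le R n n0) _; rewrite ler_pdivrMr //.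
  have : 256 <= n%:R :> R by rewrite ler_nat.
  by clear; lra.
have [E0 dev] := core_bound n0 hlam th0 th1 r1.
split=> //.
pose U := 1 - expR (- th); pose u := Num.sqrt U; pose b := (ln (1 + u) - ln (1 - u)) / 2.
have U0 : 0 < U by rewrite subr_gt0 expR_lt1 oppr_lt0.
have Uth : U <= th by have := expR_ge1Dx (- th); rewrite /U; clear; lra.
have uU : u ^+ 2 = U by rewrite sqr_sqrtr // ltW.
have u0 : 0 < u by rewrite sqrtr_gt0.
have u1 : u <= 1/10.
  have U1 : u ^+ 2 <= 1/100 by rewrite uU; move: Uth th1; clear; lra.
  by move: U1 u0; clear; nra.
have hu : 0 < u <= 1/10 by rewrite u0 u1.
have [] := expansion hu; rewrite uU -/b.
have -> : - ln (1 - U) = th by rewrite /U opprB addrC subrK expRK opprK.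
move=> b0 _ b2; rewrite !ler_norml => /andP[b21 b22] [/andP[b41 b42] /andP[l1 l2]].
have bth : b ^+ 2 <= 2 * th by move: b2 Uth; clear; lra.
exists b; first by split => //; exact: ltW.
rewrite -/U -/u -/b -/E in dev.
have lub : ln (u / b) = - ln (b / u).
  have bu : b / u \is Num.pos by rewrite posrE divr_gt0.
  by rewrite -(invf_div b) lnV.
rewrite lub in dev.
have U3 : U ^+ 3 <= th ^+ 3 by rewrite lerXn2r ?nnegrE // ltW.
have n3 : 0 <= n%:R * th ^+ 3 by rewrite mulr_ge0 ?exprn_ge0 // ltW.
have rr := @rho_le R n n0.
have [a0 a1] := andP ha.
have B0 : 0 <= b ^+ 2 by apply: sqr_ge0.
have ErrE : Err (b ^+ 2) (mult_part lam 1) n <= (10 * 100) * th + (40 * 100) * (n%:R * th ^+ 3).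
  rewrite /Err -/a; apply: lerD.
    apply: (@le_trans _ _ (500 * (2 * th) * 1)); last by clear; lra.
    have p5 : 0 <= 500 :> R by exact: ler0n.
    exact: ler_pM (mulr_ge0 p5 B0) a0 (ler_wpM2l p5 bth) a1.
  apply: (@le_trans _ _ (500 * (2 * th) ^+ 3 * n%:R)).
    have p5 : 0 <= 500 :> R by exact: ler0n.
    have B3 : (b ^+ 2) ^+ 3 <= (2 * th) ^+ 3.
      by rewrite lerXn2r ?nnegrE //; exact: le_trans bth.
    apply: ler_pM (ler_wpM2l p5 B3) _; last by rewrite ler_nat.
      by apply: mulr_ge0 p5 _; exact: exprn_ge0.
    exact: ler0n.
  by rewrite exprMn; clear; lra.
move: dev; rewrite /Phi -/a /phi; set Er := Err _ _ _ in ErrE *; clearbody Er.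
set Y := ln E; set L := ln (b / u) in l1 l2 *.
set B := b ^+ 2 in B0 b21 b22 *.
have B4 : b ^+ 4 = B ^+ 2 by rewrite /B -exprM.
rewrite B4 in b41 b42.
set q := 2/9 * a ^+ 6 - 3/10 * a ^+ 5 in q1 q2 *.
set e5 := L - (th / 3 - th ^+ 2 / 45) in l1 l2.
set e6 := B - (th + th ^+ 2 / 6) in b21 b22.
set e7 := B ^+ 2 - th ^+ 2 in b41 b42.
move=> dev.
pose main := - ((1 - a ^+ 3) / 3) * (th * n%:R) +
     (45^-1 + a ^+ 3 / 18 - 3 * a ^+ 5 / 10 + 2 * a ^+ 6 / 9) * (th ^+ 2 * n%:R).
(* What remains after the terms in th n and th^2 n: th itself, the surplus of n+1 over n in front of
   the logarithm, and the errors e5, e6, e7 of order th^3. *)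
pose D := 2/3 * th + th ^+ 2 / 45 - (n%:R + 1) * e5 + n%:R * (a ^+ 3 / 3 * e6 + q * e7).
have DE : th + n.+1%:R * - L + n%:R * (B * a ^+ 3 / 3 + B ^+ 2 * q) - main = D.
  by rewrite /D /e5 /e6 /e7 /main /q -[n.+1%:R]natr1; field.
have n1 : 1 <= n%:R :> R by rewrite ler1n.
have a3 : 0 <= a ^+ 3 <= 1 by rewrite exprn_ge0 ?exprn_ile1.
case/andP: a3 => a30 a31.
set V := th ^+ 3 in U3 n3 *.
have V0 : 0 <= V by rewrite exprn_ge0 // ltW.
have k5 : `|(n%:R + 1) * e5| <= 20 * (n%:R * V).
  rewrite normrM ger0_norm ?addr_ge0 // (_ : 20 * (n%:R * V) = (2 * n%:R) * (10 * V)); last by ring.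
  apply: ler_pM; rewrite ?addr_ge0 //; first by move: n1; clear; lra.
  by rewrite ler_norml; apply/andP; split; move: l1 l2 U3; clear; lra.
have k6 : `|n%:R * (a ^+ 3 / 3 * e6)| <= 10 * (n%:R * V).
  rewrite normrM ger0_norm // mulrCA ler_wpM2l // normrM.
  rewrite -[leRHS]mul1r; apply: ler_pM => //; first by rewrite ger0_norm ?divr_ge0 //; move: a31; clear; lra.
  by rewrite ler_norml; apply/andP; split; move: b21 b22 U3; clear; lra.
have k7 : `|n%:R * (q * e7)| <= 10 * (n%:R * V).
  rewrite normrM ger0_norm // mulrCA ler_wpM2l // normrM.
  rewrite -[leRHS]mul1r; apply: ler_pM => //; first by rewrite ler_norml q1 q2.
  by rewrite ler_norml; apply/andP; split; move: b41 b42 U3; clear; lra.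
have tt : th ^+ 2 <= th by rewrite expr2 ler_piMr ?(ltW th0) //; move: th1; clear; lra.
have t20 : 0 <= th ^+ 2 by apply: sqr_ge0.
have kD : `|D| <= th + 40 * (n%:R * V).
  move: k5 k6 k7; rewrite !ler_norml => /andP[k51 k52] /andP[k61 k62] /andP[k71 k72].
  rewrite /D; clearbody e5 e6 e7; rewrite mulrDr; apply/andP; split; move: k51 k52 k61 k62 k71 k72 tt t20 th0;
    move: (_ * e5) (_ * (_ * e6)) (_ * (_ * e7)) (n%:R * V) => x5 x6 x7 v; clear; lra.
rewrite -/main.
have -> : Y - main = (Y - (th + n.+1%:R * - L + n%:R * (B * a ^+ 3 / 3 + B ^+ 2 * q))) + D.
  by rewrite -DE; ring.
apply: le_trans (ler_normD _ _) _; apply: le_trans (lerD dev kD) _.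
move: ErrE rr th0; rewrite (_ : 256 / n%:R = 2 * (128 / n%:R) :> R); last by field; rewrite gt_eqF.
move: (n%:R * V) n3 (128 / _) (n%:R * expR _) => v v0 y x; move: v0; clear; lra.
Qed.

(** All powers and roots of n in the statement become integral powers of v = n^(-1/4). *)
Lemma quarter_root (R : realType) (n : nat) : (0 < n)%N ->
  let v : R := n%:R `^ (- (4%:R)^-1) in
  0 < v <= 1 /\ Num.sqrt n%:R = (v ^+ 2)^-1 /\ v ^+ 4 * n%:R = 1.
Proof.
move=> n0 v; have nr : 0 < n%:R :> R by rewrite ltr0n.
have v0 : 0 < v by rewrite powR_gt0.
have v4 : v ^+ 4 * n%:R = 1.
  rewrite /v -powR_mulrn ?powR_ge0 // -powRrM mulNr mulVf ?pnatr_eq0 //.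
  by rewrite powR_inv1 ?ltW // mulVf ?gt_eqF.
split; [rewrite v0 /= | split=> //].
  rewrite -(@ler_pXn2r _ 4) ?nnegrE ?(ltW v0) // expr1n.
  by apply: (@le_trans _ _ (v ^+ 4 * n%:R)); [rewrite ler_peMr ?ler1n ?exprn_ge0 ?(ltW v0) | rewrite v4].
have -> : n%:R = ((v ^+ 2)^-1) ^+ 2 :> R.
  by rewrite exprVn -exprM; apply: (mulfI (negbT (gt_eqF (exprn_gt0 4 v0)))); rewrite v4 mulfV ?gt_eqF ?exprn_gt0.
by rewrite sqrtr_sqr ger0_norm // invr_ge0 exprn_ge0 ?(ltW v0).
Qed.

Theorem theorem1p2 (R : realType) (s : R) (hs : 0 < s) :
  exists C : R, 0 < C /\
  forall (n : nat) (lam : seq nat), (1 <= n)%N -> is_partition n lam ->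
    let a1 : R := (mult_part lam 1)%:R / n%:R in
    exists E : R,
      `|E| <= C * (n%:R `^ (- (4%:R)^-1)) /\
      unif_expect (conj_class n lam)
        (fun pi => expR (- s * (peaks pi)%:R / Num.sqrt n%:R))
      = expR (- ((1 - a1 ^+ 3) / 3%:R) * s * Num.sqrt n%:R
              + ((45%:R)^-1 + a1 ^+ 3 / 18%:R - 3%:R * a1 ^+ 5 / 10%:R
                 + 2%:R * a1 ^+ 6 / 9%:R) * s ^+ 2
              + E).
Proof.
(* Threshold for v^2 = n^(-1/2): below it th = s v^2 is at most 1/20000 and v^4 <= 1/256, that is n
   >= 256, as [log_deviation] requires. *)
pose kap := Num.min (1/100/100/2/s) (16^-1 : R).
have kap0 : 0 < kap by rewrite lt_min invr_gt0 ltr0n andbT !divr_gt0.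
(* The four error terms of [log_deviation] in units of v, with b <= (1 + s) v because b^2 <= 2 s
   v^2; C2 serves the finitely many n above the threshold for v^2. *)
pose C1 := (11 * 100) * s + (50 * 100) * s ^+ 3 + 40 * (1 + s) + 256.
pose C2 := (2 * s / kap + s ^+ 2) / kap.
have s3 : 0 <= s ^+ 3 by rewrite exprn_ge0 ?ltW.
have C10 : 0 < C1 by rewrite /C1; move: hs s3; clear; lra.
have C20 : 0 < C2 by rewrite divr_gt0 // addr_gt0 ?exprn_gt0 // !(divr_gt0, mulr_gt0).
exists (C1 + C2); split; first exact: addr_gt0.
move=> n lam n1 hlam a1.
have [/andP[v0 v1] [sv v4]] := quarter_root R n1.
set v := _ `^ _ in v0 v1 sv v4 *; clearbody v.
have nr : 0 < n%:R :> R by rewrite ltr0n.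
have nV : n%:R = (v ^+ 4)^-1 :> R.
  by apply: (mulfI (negbT (gt_eqF (exprn_gt0 4 v0)))); rewrite v4 mulfV ?gt_eqF ?exprn_gt0.
have vn : v != 0 by rewrite gt_eqF.
pose th := s * v ^+ 2.
have th0 : 0 < th by rewrite mulr_gt0 ?exprn_gt0.
set A := 45%:R^-1 + _ - _ + _.
set M := (1 - a1 ^+ 3) / 3%:R.
have thn : th * n%:R = s * Num.sqrt n%:R.
  by rewrite sv nV /th; field.
have th2n : th ^+ 2 * n%:R = s ^+ 2 by rewrite nV /th; field.
have th3n : n%:R * th ^+ 3 = s ^+ 3 * v ^+ 2 by rewrite nV /th; field.
pose X := unif_expect (conj_class n lam) (fun pi => expR (- th) ^+ peaks pi).
have -> : unif_expect (conj_class n lam)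
    (fun pi => expR (- s * (peaks pi)%:R / Num.sqrt n%:R)) = X.
  rewrite /X /unif_expect; congr (_ / _); apply: eq_bigr => pi _.
  by rewrite -expRM_natr sv invrK /th; congr expR; ring.
suff [X0 dev] : 0 < X /\ `|ln X - (- M * (th * n%:R) + A * (th ^+ 2 * n%:R))| <= (C1 + C2) * v.
  exists (ln X - (- M * (th * n%:R) + A * (th ^+ 2 * n%:R))); split=> //.
  by rewrite -mulrA -thn -th2n addrC subrK lnK ?posrE.
have [vk|vk] := leP (v ^+ 2) kap.
  have v16 : v ^+ 2 <= 1/16 by apply: le_trans vk _; rewrite [leRHS]mul1r ge_min lexx orbT.
  have th1 : th <= 1/100/100/2.
    rewrite /th mulrC -ler_pdivlMr //; apply: le_trans vk _; by rewrite ge_min lexx.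
  have n256 : (256 <= n)%N.
    rewrite -(ler_nat R) nV -[leLHS]invrK lef_pV2 ?posrE ?invr_gt0 ?exprn_gt0 ?ltr0n //.
    rewrite (_ : v ^+ 4 = v ^+ 2 * v ^+ 2); last by ring.
    have := ler_pM (sqr_ge0 v) (sqr_ge0 v) v16 v16; clear; lra.
  have [X0 [b [b0 b2] dev]] := log_deviation n1 hlam th0 th1 n256.
  split=> //; apply: le_trans dev _.
  have bv : b <= (1 + s) * v.
    have p : 0 <= (1 + s) * v by rewrite mulr_ge0 ?ltW // addr_gt0.
    rewrite -(@ler_pXn2r _ 2) ?nnegrE //; apply: le_trans b2 _.
    rewrite /th exprMn mulrA ler_wpM2r ?sqr_ge0 // -subr_ge0.
    by rewrite (_ : _ - _ = 1 + s ^+ 2); [rewrite addr_ge0 ?sqr_ge0 | ring].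
  have v2v : v ^+ 2 <= v by rewrite expr2 ler_piMr // ltW.
  have nv : 256 / n%:R <= 256 * v.
    rewrite ler_wpM2l // nV invrK (_ : v ^+ 4 = v ^+ 2 * v ^+ 2); last by ring.
    apply: le_trans (v2v); rewrite ler_piMr ?sqr_ge0 //; exact: le_trans v2v v1.
  have thv : th <= s * v by rewrite /th ler_wpM2l // ltW.
  have s3v : s ^+ 3 * v ^+ 2 <= s ^+ 3 * v by rewrite ler_wpM2l.
  have C2v : 0 <= C2 * v by rewrite mulr_ge0 ?ltW.
  rewrite th3n [leRHS]mulrDl; move: C2v; move: (C2 * v) => z.
  rewrite /C1; move: thv s3v bv nv; move: (256 / _) (th) (s ^+ 3) => x t y; clear.
  by lra.
(* Here n is bounded in terms of s, and the trivial bounds 0 <= p <= n suffice: the deviation is at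
   most 2 s/kap + s^2, while v >= v^2 > kap. *)
have /andP[l1 l2] : expR (- (th * n%:R)) <= X <= 1.
  apply: unif_expect_bounds; first exact: conj_class_neq0.
  move=> pi _; rewrite -expRM_natr expR_le1 ler_expR mulNr lerN2 ler_pM2l //.
  by rewrite ler_nat peaks_le /= oppr_le0 mulr_ge0 // ltW.
have X0 : 0 < X by apply: lt_le_trans l1; exact: expR_gt0.
split=> //.
have k1 : - (th * n%:R) <= ln X by rewrite -[leLHS]expRK ler_ln ?posrE ?expR_gt0.
have k2 : ln X <= 0 by apply: ln_le0.
have mn := mult_part_le hlam.
have ha : 0 <= a1 <= 1 by rewrite divr_ge0 //= ler_pdivrMr // mul1r ler_nat.
have [/andP[m1 m2] [/andP[A1 A2] _]] := main_term_le ha.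
rewrite -/M in m1 m2; rewrite -/A in A1 A2; clearbody M A.
have Tk : th * n%:R <= s / kap.
  by rewrite thn sv ler_wpM2l ?(ltW hs) // lef_pV2 ?posrE ?exprn_gt0 // ltW.
have T0 : 0 <= th * n%:R by rewrite mulr_ge0 // ltW.
have s20 : 0 <= s ^+ 2 by apply: sqr_ge0.
rewrite th2n; set T := th * n%:R in k1 Tk T0 *; clearbody T.
have MT : 0 <= M * T <= T by rewrite mulr_ge0 //= ler_piMl.
have AS : `|A * s ^+ 2| <= s ^+ 2.
  by rewrite normrM [X in _ * X]ger0_norm // ler_piMl // ler_norml A1.
have kv : kap <= v by apply: ltW (lt_le_trans vk _); rewrite expr2 ler_piMr // ltW.
apply: (@le_trans _ _ (2 * s / kap + s ^+ 2)).
  case/andP: MT => t1 t2; move: AS; rewrite !ler_norml => /andP[u1 u2].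
  rewrite mulNr -mulrA; apply/andP; split; move: t1 t2 u1 u2 k1 k2 Tk;
    move: (M * T) (A * _) (s / kap) (ln X) => p q r l; clear; lra.
apply: (@le_trans _ _ (C2 * v)); last by rewrite ler_wpM2r ?(ltW v0) // lerDr ltW.
rewrite /C2; set W := 2 * s / kap + s ^+ 2.
have W0 : 0 <= W by rewrite addr_ge0 // divr_ge0 ?mulr_ge0 // ltW.
by rewrite -[leRHS]mulrA ler_peMr // mulrC ler_pdivlMr // mul1r.
Qed.
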